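(* For every positive integer $N$ there exists a topologically convex polyhedron, all of whose faces are acute isosceles triangles, such that every valid edge unfolding of it (into possibly multiple non-self-overlapping pieces) has at least $N$ pieces.
   Context: A polyhedron is a compact subset of $\mathbb{R}^3$ whose boundary surface is a closed embedded surface made of finitely many planar polygonal faces meeting edge-to-edge. It is topologically convex if its surface is homeomorphic to a sphere and its graph of vertices and edges is a 3-vertex-connected planar graph. An edge unfolding (possibly into multiple pieces) is specified by a set of edges (the cut edges). Cutting the surface along them separates it into connected pieces. The unfolding is valid if each piece can be laid out isometrically in the plane, face by face, as a simple (non-self-overlapping) polygon. *)

(* Defs.v *)
From HB Require Import structures.
From mathcomp Require Import all_boot all_order all_algebra.
From mathcomp Require Import all_classical all_reals all_analysis.
Set Implicit Arguments. Unset Strict Implicit. Unset Printing Implicit Defensive.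
Import Order.TTheory GRing.Theory Num.Theory.
Import numFieldNormedType.Exports.
Local Open Scope ring_scope.

Section Polyhedra.
Variable R : realType.

Definition d2 (n : nat) (x y : 'rV[R]_n) : R := \sum_(i < n) (x 0 i - y 0 i) ^+ 2.

Definition hull (n : nat) (V : finType) (p : V -> 'rV[R]_n) (S : {set V})
  : set 'rV[R]_n :=
  ([set x | exists w : V -> R, (forall v, 0 <= w v) /\ (forall v, v \notin S -> w v = 0)
       /\ \sum_v w v = 1 /\ x = \sum_v w v *: p v])%classic.

Definition open_hull (n : nat) (V : finType) (p : V -> 'rV[R]_n) (S : {set V})
  : set 'rV[R]_n :=
  ([set x | exists w : V -> R, (forall v, v \in S -> 0 < w v) /\ (forall v, v \notin S -> w v = 0)
       /\ \sum_v w v = 1 /\ x = \sum_v w v *: p v])%classic.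

Definition aff_hull (n : nat) (V : finType) (p : V -> 'rV[R]_n) (S : {set V})
  : set 'rV[R]_n :=
  ([set x | exists w : V -> R, (forall v, v \notin S -> w v = 0)
       /\ \sum_v w v = 1 /\ x = \sum_v w v *: p v])%classic.

Definition homeomorphic (T U : topologicalType) (A : set T) (B : set U) : Prop :=
  exists (f : T -> U) (g : U -> T),
    {within A, continuous f}%classic /\ {within B, continuous g}%classic /\
    (f @` A `<=` B)%classic /\ (g @` B `<=` A)%classic /\
    (forall x, A x -> g (f x) = x) /\ (forall y, B y -> f (g y) = y).

Definition unit_sphere3 : set 'rV[R]_3 := [set x | d2 x 0 = 1]%classic.
Definition unit_disk2 : set 'rV[R]_2 := [set x | d2 x 0 <= 1]%classic.

Variables (V : finType) (pos : V -> 'rV[R]_3) (F : {set {set V}}).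

Definition edges : {set {set V}} :=
  [set e : {set V} | (#|e| == 2) && [exists f in F, e \subset f]].

Definition adjv (u v : V) : bool := (u != v) && ([set u; v] \in edges).

Definition surface : set 'rV[R]_3 := [set x | exists2 f, f \in F & hull pos f x]%classic.

(* A polyhedron all of whose faces are triangles, described by its
   boundary surface: vertex set V with positions pos, triangular faces F. *)
Definition triangulated_polyhedron : Prop :=
  injective pos /\
  (forall f, f \in F -> #|f| = 3) /\
  (forall v : V, exists2 f, f \in F & v \in f) /\
  (forall f, f \in F -> forall v, v \in f -> ~ aff_hull pos (f :\ v) (pos v)) /\
  (forall e, e \in edges -> #|[set f in F | e \subset f]| = 2) /\
  (forall f g, f \in F -> g \in F -> f != g ->
      (hull pos f `&` hull pos g)%classic = hull pos (f :&: g)) /\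
  (* the triangles really are the (planar) faces: faces sharing an edge
     are not coplanar *)
  (forall f g, f \in F -> g \in F -> #|f :&: g| = 2 ->
      forall v, v \in g :\: f -> ~ aff_hull pos f (pos v)).

Definition three_connected : Prop :=
  (4 <= #|V|)%N /\
  forall S : {set V}, (#|S| <= 2)%N -> forall u v, u \notin S -> v \notin S ->
    connect [rel x y | [&& x \notin S, y \notin S & adjv x y]] u v.

Definition topologically_convex : Prop :=
  triangulated_polyhedron /\ homeomorphic surface unit_sphere3 /\ three_connected.

Definition acute_isosceles (f : {set V}) : Prop :=
  exists a b c : V, f = [set a; b; c] /\ a != b /\ b != c /\ a != c /\
    d2 (pos a) (pos b) = d2 (pos a) (pos c) /\
    d2 (pos a) (pos b) + d2 (pos a) (pos c) > d2 (pos b) (pos c) /\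
    d2 (pos b) (pos a) + d2 (pos b) (pos c) > d2 (pos a) (pos c) /\
    d2 (pos c) (pos a) + d2 (pos c) (pos b) > d2 (pos a) (pos b).

Definition fadj (cut : {set {set V}}) : rel {set V} :=
  [rel f g | [&& f \in F, g \in F, f != g, f :&: g \in edges & f :&: g \notin cut]].

Definition pieces (cut : {set {set V}}) : {set {set {set V}}} :=
  [set [set g in F | connect (fadj cut) f g] | f in F].

(* A valid unfolding: each face f is laid out in the plane by L f (positions
   of its vertices) isometrically; faces glued along an uncut edge share the
   laid-out edge; and each piece is laid out as a simple polygon (placed
   triangles have disjoint interiors and their union is homeomorphic to a
   closed disk, i.e. is a simple polygon). *)
Definition valid_unfolding (cut : {set {set V}}) : Prop :=
  cut \subset edges /\
  exists L : {set V} -> V -> 'rV[R]_2,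
    (forall f, f \in F -> forall u v, u \in f -> v \in f ->
        d2 (L f u) (L f v) = d2 (pos u) (pos v)) /\
    (forall f g, fadj cut f g -> forall v, v \in f :&: g -> L f v = L g v) /\
    (forall P, P \in pieces cut ->
       (forall f g, f \in P -> g \in P -> f != g ->
           (open_hull (L f) f `&` open_hull (L g) g = set0)%classic) /\
       homeomorphic [set x | exists2 f, f \in P & hull (L f) f x]%classic unit_disk2).

End Polyhedra.

(* Main.v *)
(** A hat is a cap of nine acute isosceles triangles, with sides 1, 1, 40/29 or
    1, 1, 34/145, erected on an equilateral triangle of side 40/29: three inner
    vertices surround an apex. At each inner vertex five faces meet, with total
    angle about 420 degrees, so they cannot stay glued in a fan around that vertex;
    together with one overlapping chain of six triangles this forces, by a search
    over the 2^12 cut patterns, every valid unfolding to cut each hat into at least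
    two parts that are not joined inside the hat. Take a triangulated sphere with
    4K + 4 acute isosceles faces, of which 4K are equilateral, and erect hats on
    the latter. Cutting in addition all 6K + 6 original edges yields at least
    2 * 4K + 4 pieces, and each such edge creates at most one of them, so at least
    2K - 2 pieces were there before.

    The triangulated sphere is a square tube closed by two pairs of cap triangles.
    Clamping the horizontal coordinates flattens every hat onto its base triangle,
    affinely on each face, and barycentric coordinates in the flattened complex are
    unique because the vertices lift to a convex position; hence the surface is
    embedded. Radial projection of the tube gives the homeomorphism to the sphere. *)

Require Import Defs.
From HB Require Import structures.
From mathcomp Require Import all_boot all_order all_algebra.
From mathcomp Require Import all_classical all_reals all_analysis.
From mathcomp Require Import ring lra zify.
Set Implicit Arguments. Unset Strict Implicit. Unset Printing Implicit Defensive.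
Import Order.TTheory GRing.Theory Num.Theory.
Import numFieldNormedType.Exports.

Local Open Scope ring_scope.

(** * Planar layouts *)

Section Plane.
Variable R : realType.
Implicit Types (u v w p q r x y : 'rV[R]_2) (a b c e : R).

(** Why the search succeeds: nine faces need eight gluings to hang together, so a hat that is not
    split has at most four of its twelve inner edges cut. To destroy all fans, each of the three
    inner vertices must lose two of its five edges. Hence at least two sides of the inner triangle
    are cut. Cutting all three would detach the faces at the apex, so exactly two are cut, together
    with one edge to the apex and one edge to a corner. Fans alone do not exclude such patterns, but
    each of them contains a chain of six triangles that overlaps itself.

    The sides are chosen to keep the arithmetic rational: the relevant angles come from the
    Pythagorean triples 41, 840, 841 and 17, 144, 145, so a turn through several triangles has
    rational cosine and sine and an overlap can be certified by an explicit rational point.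

    A layout prescribes distances only and may reflect each triangle. The sense of rotation in a fan
    therefore has to be derived: neighbours with disjoint interiors must turn the same way. A global
    sign remains free throughout. *)

Lemma d2_2E x y : d2 x y = (x 0 0 - y 0 0) ^+ 2 + (x 0 1 - y 0 1) ^+ 2.
Proof.
rewrite /d2 !big_ord_recl big_ord0 addr0.
by congr ((x 0 _ - y 0 _) ^+ 2 + (x 0 _ - y 0 _) ^+ 2); apply: val_inj.
Qed.

Lemma rV2P x y : x 0 0 = y 0 0 -> x 0 1 = y 0 1 -> x = y.
Proof.
move=> e0 e1; apply/rowP => -[[|[|//]] Hi].
- by have -> : Ordinal Hi = 0 by apply: val_inj.
- by have -> : Ordinal Hi = 1 by apply: val_inj.
Qed.

Definition tri_int p q r : 'rV[R]_2 -> Prop := fun x =>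
  exists a b c, [/\ 0 < a, 0 < b, 0 < c, a + b + c = 1 & x = a *: p + b *: q + c *: r].

Definition overlap p q r p' q' r' := exists2 x, tri_int p q r x & tri_int p' q' r' x.

Definition rotv (c s : R) u : 'rV[R]_2 :=
  \row_j (if j == 0 then c * u 0 0 - s * u 0 1 else s * u 0 0 + c * u 0 1).

(** The distances determine the dot product of [q - p] and [r - p], and by Lagrange's identity the
    square of their cross product. The remaining sign [e] is the orientation of the triangle, which
    a layout is free to choose. *)
Lemma tri_third p q r l m c s :
  d2 p q = l ^+ 2 -> d2 p r = m ^+ 2 -> d2 q r = l ^+ 2 + m ^+ 2 - 2 * l * m * c ->
  c ^+ 2 + s ^+ 2 = 1 -> 0 < l -> 0 < m ->
  exists2 e, e ^+ 2 = 1 & r - p = (m / l) *: rotv c (e * s) (q - p).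
Proof.
rewrite !d2_2E => H1 H2 H3 Hcs l0 m0.
set u0 := q 0 0 - p 0 0; set u1 := q 0 1 - p 0 1.
set w0 := r 0 0 - p 0 0; set w1 := r 0 1 - p 0 1.
have Hu : u0 ^+ 2 + u1 ^+ 2 = l ^+ 2 by rewrite -H1 /u0 /u1; ring.
have Hw : w0 ^+ 2 + w1 ^+ 2 = m ^+ 2 by rewrite -H2 /w0 /w1; ring.
have Hd : u0 * w0 + u1 * w1 = l * m * c.
  have : 2 * (u0 * w0 + u1 * w1) = (u0 ^+ 2 + u1 ^+ 2) + (w0 ^+ 2 + w1 ^+ 2) -
    ((q 0 0 - r 0 0) ^+ 2 + (q 0 1 - r 0 1) ^+ 2) by rewrite /u0 /u1 /w0 /w1; ring.
  rewrite H3 Hu Hw; lra.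
have Hc : (u0 * w1 - u1 * w0) ^+ 2 = (l * m * s) ^+ 2.
  have -> : (u0 * w1 - u1 * w0) ^+ 2 =
    (u0 ^+ 2 + u1 ^+ 2) * (w0 ^+ 2 + w1 ^+ 2) - (u0 * w0 + u1 * w1) ^+ 2 by ring.
  rewrite Hu Hw Hd.
  transitivity ((c ^+ 2 + s ^+ 2) * l ^+ 2 * m ^+ 2 - (l * m * c) ^+ 2); last by ring.
  by rewrite Hcs mul1r.
have [e He Hx] : exists2 e, e ^+ 2 = 1 & u0 * w1 - u1 * w0 = e * (l * m * s).
  move/eqP: Hc; rewrite eqf_sqr => /orP[] /eqP ->.
  - by exists 1; rewrite ?expr1n ?mul1r.
  - by exists (-1); rewrite ?mulN1r // sqrrN expr1n.
exists e => //.
have l2 : l != 0 by rewrite gt_eqF.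
have K0 : w0 * l ^+ 2 = l * m * (c * u0 - e * s * u1).
  rewrite -Hu.
  transitivity (u0 * (u0 * w0 + u1 * w1) - u1 * (u0 * w1 - u1 * w0)); first by ring.
  by rewrite Hd Hx; ring.
have K1 : w1 * l ^+ 2 = l * m * (e * s * u0 + c * u1).
  rewrite -Hu.
  transitivity (u1 * (u0 * w0 + u1 * w1) + u0 * (u0 * w1 - u1 * w0)); first by ring.
  by rewrite Hd Hx; ring.
apply: rV2P.
- rewrite !mxE /= -/w0 -/u0 -/u1.
  apply: (mulIf (expf_neq0 2 l2)); rewrite K0; field; exact: l2.
- rewrite !mxE /= -/w1 -/u0 -/u1.
  apply: (mulIf (expf_neq0 2 l2)); rewrite K1; field; exact: l2.
Qed.

Lemma tri_int_cone p q r w a b : 0 < a -> 0 < b ->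
  w = a *: (q - p) + b *: (r - p) ->
  forall t, 0 < t -> t * (a + b) < 1 -> tri_int p q r (p + t *: w).
Proof.
move=> a0 b0 -> t t0 tab.
exists (1 - t * (a + b)), (t * a), (t * b); split; rewrite ?mulr_gt0 ?subr_gt0 //; first by ring.
by apply: rV2P; rewrite !mxE; ring.
Qed.

(** Triangles with a common corner overlap as soon as one direction is interior to both angles: a
    short enough multiple of it lies in both. *)
Lemma overlap_cone p q r q' r' w a b a' b' :
  0 < a -> 0 < b -> 0 < a' -> 0 < b' ->
  w = a *: (q - p) + b *: (r - p) -> w = a' *: (q' - p) + b' *: (r' - p) ->
  overlap p q r p q' r'.
Proof.
move=> a0 b0 a'0 b'0 Hw Hw'.
pose t := (1 + a + b + a' + b')^-1.
have D : 0 < 1 + a + b + a' + b' by lra.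
have t0 : 0 < t by rewrite invr_gt0.
exists (p + t *: w); apply: tri_int_cone.
- exact: a0.
- exact: b0.
- exact: Hw.
- exact: t0.
- rewrite /t mulrC ltr_pdivrMr //; lra.
- exact: a'0.
- exact: b'0.
- exact: Hw'.
- exact: t0.
- rewrite /t mulrC ltr_pdivrMr //; lra.
Qed.

(* Two triangles sharing the side [p q] whose interiors do not meet lie on
   different sides of it, that is, are traversed around [p] in the same sense. *)
Lemma same_sense p q r r' k c s e k' c' s' e' :
  ~ overlap p q r p r r' ->
  r - p = k *: rotv c (e * s) (q - p) -> r' - p = k' *: rotv c' (e' * s') (r - p) ->
  e ^+ 2 = 1 -> e' ^+ 2 = 1 -> 0 < k -> 0 < k' -> c ^+ 2 + s ^+ 2 = 1 -> c < s -> c' < s' ->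
  0 < s -> 0 < s' -> e' = e.
Proof.
move=> nov Hr Hr' He He' k0 k'0 Hcs cs cs' s0 s'0.
move/eqP: (He'); rewrite -He eqf_sqr => /orP[/eqP//|/eqP Ee].
exfalso; apply: nov.
have kn : k != 0 by rewrite gt_eqF.
have k'n : k' != 0 by rewrite gt_eqF.
have sn : s != 0 by rewrite gt_eqF.
have s'n : s' != 0 by rewrite gt_eqF.
have Hq : q - p = k^-1 *: rotv c (- e * s) (r - p).
  rewrite Hr; apply: rV2P; rewrite !mxE /=.
  - transitivity ((c ^+ 2 + e ^+ 2 * s ^+ 2) * (q 0 0 - p 0 0)).
      by rewrite He mul1r Hcs mul1r.
    by field.
  - transitivity ((c ^+ 2 + e ^+ 2 * s ^+ 2) * (q 0 1 - p 0 1)).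
      by rewrite He mul1r Hcs mul1r.
    by field.
(* The witness direction makes an angle of 45 degrees with the shared side [p r]; by [c < s] and
   [c' < s'] both angles at [p] are larger. *)
apply: (@overlap_cone p q r r r' (rotv 1 (- e) (r - p)) (k / s) (1 - c / s) (1 - c' / s') (k'^-1 / s')).
- by rewrite divr_gt0.
- by rewrite subr_gt0 ltr_pdivrMr // mul1r.
- by rewrite subr_gt0 ltr_pdivrMr // mul1r.
- by rewrite divr_gt0 ?invr_gt0.
- by rewrite Hq; apply: rV2P; rewrite !mxE /=; field; rewrite ?kn ?sn.
- by rewrite Hr' Ee; apply: rV2P; rewrite !mxE /=; field; rewrite ?k'n ?s'n.
Qed.
End Plane.

(** * Five triangles glued around an inner vertex *)

Section Fan.
Variable R : realType.
Implicit Types (u v w p q r x y : 'rV[R]_2) (c e : R) (b : bool).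

(* The angles of the hat faces that matter: [true] is the angle between the unit
   sides of a brim with base 40/29, [false] the base angle of the triangles with
   unit sides and base 34/145; [sidek] is the law of cosines. They total more than
   a full turn: four base angles and one brim angle add up to about 420 degrees. *)
Definition cosk (b : bool) : R := if b then 41 / 841 else 17 / 145.
Definition sink (b : bool) : R := if b then 840 / 841 else 144 / 145.

Lemma cos2Dsin2k b : cosk b ^+ 2 + sink b ^+ 2 = 1.
Proof. by case: b; rewrite /cosk /sink; field. Qed.
Lemma sink_gt0 b : 0 < sink b. Proof. by case: b; rewrite /sink; lra. Qed.
Lemma cosk_lt_sink b : cosk b < sink b. Proof. by case: b; rewrite /cosk /sink; lra. Qed.

Definition sidek (b : bool) (l m : R) : R := l ^+ 2 + m ^+ 2 - 2 * l * m * cosk b.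

Definition turn e (b : bool) k p q r := [/\ r - p = k *: rotv (cosk b) (e * sink b) (q - p) & 0 < k].

Lemma turnP p q r l m b : d2 p q = l ^+ 2 -> d2 p r = m ^+ 2 -> d2 q r = sidek b l m ->
  0 < l -> 0 < m -> exists2 e, e ^+ 2 = 1 & turn e b (m / l) p q r.
Proof.
move=> H1 H2 H3 l0 m0.
have [e He H] := tri_third H1 H2 H3 (cos2Dsin2k b) l0 m0.
by exists e => //; split=> //; rewrite divr_gt0.
Qed.

Lemma turn_next p q r r' e b b' k l m : turn e b k p q r -> e ^+ 2 = 1 ->
  ~ overlap p q r p r r' ->
  d2 p r = l ^+ 2 -> d2 p r' = m ^+ 2 -> d2 r r' = sidek b' l m -> 0 < l -> 0 < m ->
  turn e b' (m / l) p r r'.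
Proof.
move=> [H k0] He nov H1 H2 H3 l0 m0.
have [e' He' [H' k'0]] := turnP H1 H2 H3 l0 m0.
have E := same_sense nov H H' He He' k0 k'0 (cos2Dsin2k b) (cosk_lt_sink b) (cosk_lt_sink b')
  (sink_gt0 b) (sink_gt0 b').
by rewrite -E; split.
Qed.

Lemma rotvZ (k c s : R) u : rotv c s (k *: u) = k *: rotv c s u.
Proof. by apply: rV2P; rewrite !mxE /=; ring. Qed.

Lemma rotv_comp e (c s c' s' : R) u : e ^+ 2 = 1 ->
  rotv c (e * s) (rotv c' (e * s') u) = rotv (c * c' - s * s') (e * (c * s' + s * c')) u.
Proof.
move=> He; apply: rV2P; rewrite !mxE /=.
- transitivity ((c * c' - e ^+ 2 * (s * s')) * u 0 0 - (e * (c * s' + s * c')) * u 0 1); first by ring.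
  by rewrite He mul1r.
- transitivity ((e * (c * s' + s * c')) * u 0 0 + (c * c' - e ^+ 2 * (s * s')) * u 0 1); first by ring.
  by rewrite He mul1r.
Qed.

(* [(c1, s1)] and [(c5, s5)] are the cosine and sine of the first and of the last
   angle of the fan, [(c, s)] those of the total turn. *)
Lemma fan_overlap p w0 w1 w4 w5 (k1 k5 k c1 s1 c5 s5 c s : R) e :
  e ^+ 2 = 1 -> 0 < k1 -> 0 < k5 -> 0 < k -> 0 < s1 -> 0 < s5 -> 0 < s ->
  c5 ^+ 2 + s5 ^+ 2 = 1 -> c ^+ 2 + s ^+ 2 = 1 ->
  w1 - p = k1 *: rotv c1 (e * s1) (w0 - p) -> w5 - p = k5 *: rotv c5 (e * s5) (w4 - p) ->
  w5 - p = k *: rotv c (e * s) (w0 - p) ->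
  0 < 1 + c - s * c1 / s1 -> 0 < 1 + c - s * c5 / s5 -> overlap p w0 w1 p w4 w5.
Proof.
move=> He k10 k50 k0 s10 s50 s0 H5 H Hw1 Hw5 Hw C1 C5.
have k1n : k1 != 0 by rewrite gt_eqF.
have k5n : k5 != 0 by rewrite gt_eqF.
have kn : k != 0 by rewrite gt_eqF.
have s1n : s1 != 0 by rewrite gt_eqF.
have s5n : s5 != 0 by rewrite gt_eqF.
(* [rotv (1 + c) (e * s)] adds to a vector its image under the total turn, so the witness direction
   bisects the first and the last ray of the fan. The last two hypotheses put it inside the first
   and the last triangle. *)
apply: (@overlap_cone _ p w0 w1 w4 w5 (rotv (1 + c) (e * s) (w0 - p))
  (1 + c - s * c1 / s1) (s / s1 / k1) (s / s5 * k5 / k) ((1 + c - s * c5 / s5) / k)) => //.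
- by rewrite !divr_gt0.
- by rewrite divr_gt0 // mulr_gt0 // divr_gt0.
- by rewrite divr_gt0.
- by rewrite Hw1; apply: rV2P; rewrite !mxE /=; field; rewrite k1n s1n.
- have Hw4 : w4 - p = k5^-1 *: rotv c5 (- e * s5) (w5 - p).
    rewrite Hw5 rotvZ scalerA mulVf // scale1r.
    apply: rV2P; rewrite !mxE /=.
    + transitivity ((c5 ^+ 2 + e ^+ 2 * s5 ^+ 2) * (w4 0 0 - p 0 0)).
        by rewrite He mul1r H5 mul1r.
      by ring.
    + transitivity ((c5 ^+ 2 + e ^+ 2 * s5 ^+ 2) * (w4 0 1 - p 0 1)).
        by rewrite He mul1r H5 mul1r.
      by ring.
  rewrite Hw4 Hw.
  have Hc : c = (c ^+ 2 + e ^+ 2 * s ^+ 2) + c - 1 by rewrite He mul1r H; ring.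
  apply: rV2P; rewrite !mxE /=.
  + transitivity ((c + (c ^+ 2 + e ^+ 2 * s ^+ 2)) * (w0 0 0 - p 0 0) - e * s * (w0 0 1 - p 0 1)).
      by rewrite He mul1r H; ring.
    by field; rewrite kn k5n s5n.
  + transitivity ((c + (c ^+ 2 + e ^+ 2 * s ^+ 2)) * (w0 0 1 - p 0 1) + e * s * (w0 0 0 - p 0 0)).
      by rewrite He mul1r H; ring.
    by field; rewrite kn k5n s5n.
Qed.

Lemma turn_comp e (c s c' s' : R) k k' p q r r' : e ^+ 2 = 1 ->
  r - p = k *: rotv c (e * s) (q - p) -> r' - p = k' *: rotv c' (e * s') (r - p) ->
  r' - p = (k' * k) *: rotv (c' * c - s' * s) (e * (c' * s + s' * c)) (q - p).
Proof. by move=> He H1 H2; rewrite H2 H1 rotvZ rotv_comp // scalerA. Qed.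

Let c2 : R := cosk false ^+ 2 - sink false ^+ 2.
Let s2 : R := 2 * cosk false * sink false.
Let cosT : R := c2 * (c2 * cosk true - s2 * sink true) - s2 * (c2 * sink true + s2 * cosk true).
Let sinT : R := c2 * (c2 * sink true + s2 * cosk true) + s2 * (c2 * cosk true - s2 * sink true).

(** The angle formed at an inner vertex by the brim and the two skirts beside it. It is rational
    once more, by the triple 7, 24, 25, and returns as the turn [(cw, sw)] of the chain. *)
Lemma brim_angle : c2 * cosk true - s2 * sink true = - 7 / 25 /\
  c2 * sink true + s2 * cosk true = - 24 / 25.
Proof. by rewrite /c2 /s2 /cosk /sink; split; field. Qed.

Lemma totalT_gt0 : 0 < cosT /\ 0 < sinT.
Proof.
by rewrite /cosT /sinT; case: brim_angle => -> ->; rewrite /c2 /s2 /cosk /sink; split; lra.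
Qed.

(** The total exceeds a full turn by about 60 degrees, which carries the last triangle back onto the
    first. Four gluings are enough for this, and the one brim angle may stand at any of the five
    places. *)
Lemma fan5 p w0 w1 w2 w3 w4 w5 b1 b2 b3 b4 b5 (l0 l1 l2 l3 l4 l5 : R) :
  (b1 + b2 + b3 + b4 + b5 = 1)%N ->
  [/\ 0 < l0, 0 < l1, 0 < l2, 0 < l3 & 0 < l4] -> 0 < l5 ->
  [/\ d2 p w0 = l0 ^+ 2, d2 p w1 = l1 ^+ 2, d2 p w2 = l2 ^+ 2, d2 p w3 = l3 ^+ 2 &
   d2 p w4 = l4 ^+ 2] -> d2 p w5 = l5 ^+ 2 ->
  [/\ d2 w0 w1 = sidek b1 l0 l1, d2 w1 w2 = sidek b2 l1 l2, d2 w2 w3 = sidek b3 l2 l3,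
    d2 w3 w4 = sidek b4 l3 l4 & d2 w4 w5 = sidek b5 l4 l5] ->
  [/\ ~ overlap p w0 w1 p w1 w2, ~ overlap p w1 w2 p w2 w3, ~ overlap p w2 w3 p w3 w4 &
    ~ overlap p w3 w4 p w4 w5] -> overlap p w0 w1 p w4 w5.
Proof.
move=> Hb [p0 p1 p2 p3 p4] p5 [e0 e1 e2 e3 e4] e5 [f1 f2 f3 f4 f5] [n1 n2 n3 n4].
have [e He t1] := turnP e0 e1 f1 p0 p1.
have t2 := turn_next t1 He n1 e1 e2 f2 p1 p2.
have t3 := turn_next t2 He n2 e2 e3 f3 p2 p3.
have t4 := turn_next t3 He n3 e3 e4 f4 p3 p4.
have t5 := turn_next t4 He n4 e4 e5 f5 p4 p5.
move: t1 t2 t3 t4 t5 => [t1 k1] [t2 k2] [t3 k3] [t4 k4] [t5 k5].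
have T := turn_comp He (turn_comp He (turn_comp He (turn_comp He t1 t2) t3) t4) t5.
have N b c s : c ^+ 2 + s ^+ 2 = 1 -> (cosk b * c - sink b * s) ^+ 2 + (cosk b * s + sink b * c) ^+ 2 = 1.
  move=> H; transitivity ((cosk b ^+ 2 + sink b ^+ 2) * (c ^+ 2 + s ^+ 2)); first by ring.
  by rewrite cos2Dsin2k H mulr1.
have NN := N b5 _ _ (N b4 _ _ (N b3 _ _ (N b2 _ _ (cos2Dsin2k b1)))).
set c := cosk b5 * _ - _ in T NN; set s := cosk b5 * _ + _ in T NN.
have [c0 s0] : 0 < c /\ 0 < s.
  (* The sum of the angles does not depend on their order, so one total serves all five positions of
     the brim. *)
  have -> : c = cosT.
    by rewrite /c /cosT /c2 /s2; case: b1 b2 b3 b4 b5 Hb {f1 f2 f3 f4 f5 t1 t2 t3 t4 t5 T NN c s}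
      => [] [] [] [] [] //= _; rewrite -!/(cosk _) -!/(sink _); ring.
  have -> : s = sinT.
    by rewrite /s /sinT /c2 /s2; case: b1 b2 b3 b4 b5 Hb {f1 f2 f3 f4 f5 t1 t2 t3 t4 t5 T NN c s}
      => [] [] [] [] [] //= _; rewrite -!/(cosk _) -!/(sink _); ring.
  exact: totalT_gt0.
clearbody c s.
have s1 : s <= 1.
  by move: NN (sqr_ge0 c) s0 => NN cc s0; nra.
have B b : 0 < 1 + c - s * cosk b / sink b.
  have H : cosk b / sink b < 1 by rewrite ltr_pdivrMr ?sink_gt0 // mul1r cosk_lt_sink.
  have H0 : 0 <= cosk b / sink b by case: b {H}; rewrite /cosk /sink; lra.
  rewrite -mulrA; have := ler_piMl H0 s1; lra.
exact: (fan_overlap He k1 k5 (mulr_gt0 k5 (mulr_gt0 k4 (mulr_gt0 k3 (mulr_gt0 k2 k1))))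
  (sink_gt0 b1) (sink_gt0 b5) s0 (cos2Dsin2k b5) NN t1 t5 T (B b1) (B b5)).
Qed.
End Fan.

(** * A chain of six triangles around two inner vertices *)

Section Chain.
Variable R : realType.
Implicit Types (u v w p q r x y z : 'rV[R]_2) (b : bool).

Definition sl : R := 34 / 145.
Lemma sl_gt0 : 0 < sl. Proof. by rewrite /sl; lra. Qed.

(** Moves the viewpoint from one end of the base of an isosceles triangle to the other: the two
    angles are equal, and a cyclic shift of the corners keeps the sense. *)
Lemma turn_reverse p q r (e : R) : e ^+ 2 = 1 -> turn e false (sl / 1) p q r -> turn e false (1 / sl) r p q.
Proof.
move=> He [H _]; split; last by rewrite divr_gt0 ?sl_gt0.
have Hr : r = p + (sl / 1) *: rotv (cosk _ false) (e * sink _ false) (q - p) by rewrite -H addrC subrK.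
rewrite Hr; apply: rV2P; rewrite !mxE /= /sl /cosk /sink.
- transitivity ((1 - (17 / 145) * sl + (e ^+ 2 - 1) * (144 / 145) ^+ 2) * (q 0 0 - p 0 0)
    + sl * e * (144 / 145) * (q 0 1 - p 0 1)).
    by rewrite He /sl; field.
  by rewrite /sl; field.
- transitivity ((1 - (17 / 145) * sl + (e ^+ 2 - 1) * (144 / 145) ^+ 2) * (q 0 1 - p 0 1)
    - sl * e * (144 / 145) * (q 0 0 - p 0 0)).
    by rewrite He /sl; field.
  by rewrite /sl; field.
Qed.

(** Complex numbers in disguise. Put [z] at 0, [x] at 1 and [e = 1], and let [w = C + i S],
    [t = tc - i ts]; then [d = k t], [y = w], [x' = w - w^2] and [c = w - k t w^2]. The point with
    weights [c'] on [c] and [b'] on [x'] is [w - w^2 (M + i N) = p + i q]. Solving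
    [a k t + b = p + i q] gives its weights [a] on [d] and [b] on [x] in the other triangle. *)
Lemma chain_overlap z x d y x' c (C S k b' c' tc ts e : R) : e = 1 \/ e = -1 ->
  let M := b' + c' * k * tc in let N := - (c' * k * ts) in
  let p := C - ((C ^+ 2 - S ^+ 2) * M - 2 * C * S * N) in
  let q := S - ((C ^+ 2 - S ^+ 2) * N + 2 * C * S * M) in
  let a := - q / (k * ts) in let b := p + q * tc / ts in
  0 < k -> 0 < ts -> 0 < b' -> 0 < c' -> b' + c' < 1 -> 0 < a -> 0 < b -> a + b < 1 ->
  d - z = k *: rotv tc (e * - ts) (x - z) -> y - z = rotv C (e * S) (x - z) ->
  x' - y = rotv C (e * S) (z - y) -> c - y = k *: rotv tc (e * - ts) (x' - y) ->
  overlap z d x y c x'.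
Proof.
move=> He M N p q a b k0 ts0 b'0 c'0 bc' a0 b0 ab Hd Hy Hx' Hc.
have tsn : ts != 0 by rewrite gt_eqF.
have kn : k != 0 by rewrite gt_eqF.
exists (z + a *: (d - z) + b *: (x - z)).
  exists (1 - a - b), a, b; split=> //; [lra|ring|].
  by apply: rV2P; rewrite !mxE; ring.
exists (1 - b' - c'), c', b'; split=> //; [lra|ring|].
have -> : x' = y + rotv C (e * S) (z - y) by rewrite -Hx' addrC subrK.
have -> : c = y + k *: rotv tc (e * - ts) (rotv C (e * S) (z - y)).
  by rewrite -Hx' -Hc addrC subrK.
have -> : y = z + rotv C (e * S) (x - z) by rewrite -Hy addrC subrK.
rewrite Hd.
by case: He => ->; apply: rV2P; rewrite !mxE /= /a /b /p /q /M /N; field; rewrite kn tsn.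
Qed.

Let cw : R := - 7 / 25.
Let sw : R := - 24 / 25.

(** The first four triangles turn around [z], the last three around [y], and the fourth belongs to
    both groups. In the hat [x] and [x'] are the same inner vertex, torn apart by the layout. *)
Lemma chain6 z d x cy cx y cz x' :
  [/\ d2 z d = 1 ^+ 2, d2 z x = sl ^+ 2, d2 z cy = 1 ^+ 2, d2 z cx = 1 ^+ 2 & d2 z y = sl ^+ 2] ->
  [/\ d2 d x = sidek false 1 sl, d2 x cy = sidek false sl 1, d2 cy cx = sidek true 1 1 &
      d2 cx y = sidek false 1 sl] ->
  [/\ d2 y cx = 1 ^+ 2, d2 y cz = 1 ^+ 2 & d2 y x' = sl ^+ 2] ->
  [/\ d2 cx cz = sidek true 1 1 & d2 cz x' = sidek false 1 sl] ->
  [/\ ~ overlap z d x z x cy, ~ overlap z x cy z cy cx & ~ overlap z cy cx z cx y] ->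
  [/\ ~ overlap y z cx y cx cz & ~ overlap y cx cz y cz x'] -> overlap z d x y cz x'.
Proof.
move=> [e0 e1 e2 e3 e4] [f1 f2 f3 f4] [g1 g2 g3] [h1 h2] [n1 n2 n3] [m1 m2].
have l1 : 0 < 1 :> R by [].
have ls := sl_gt0.
have [e He t1] := turnP e0 e1 f1 l1 ls.
have t2 := turn_next t1 He n1 e1 e2 f2 ls l1.
have t3 := turn_next t2 He n2 e2 e3 f3 l1 l1.
have t4 := turn_next t3 He n3 e3 e4 f4 l1 ls.
have r1 := turn_reverse He t4.
have r2 := turn_next r1 He m1 g1 g2 h1 l1 l1.
have r3 := turn_next r2 He m2 g2 g3 h2 l1 ls.
have back p q r : turn e false (sl / 1) p q r -> q - p = sl^-1 *: rotv (17 / 145) (e * - (144 / 145)) (r - p).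
  move=> [-> _]; rewrite rotvZ scalerA divr1 mulVf ?gt_eqF // scale1r rotv_comp //.
  have -> : cosk R false = 17 / 145 by [].
  have -> : sink R false = 144 / 145 by [].
  have -> : 17 / 145 * (17 / 145) - - (144 / 145) * (144 / 145) = 1 :> R by field.
  have -> : 17 / 145 * (144 / 145) + - (144 / 145) * (17 / 145) = 0 :> R by field.
  by apply: rV2P; rewrite !mxE /=; ring.
have around p q r s t : turn e false (1 / sl) p q r -> turn e true (1 / 1) p r s ->
    turn e false (sl / 1) p s t -> t - p = rotv cw (e * sw) (q - p).
  move=> [T1 _] [T2 _] [T3 _].
  rewrite (turn_comp He (turn_comp He T1 T2) T3) !divr1 !mul1r mulfV ?gt_eqF // scale1r.
  by congr rotv; [|congr (_ * _)]; rewrite /cw /sw /cosk /sink; field.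
have Hy := around _ _ _ _ _ t2 t3 t4.
have Hx' := around _ _ _ _ _ r1 r2 r3.
have Ee : e = 1 \/ e = -1.
  by move/eqP: He; rewrite -[X in _ == X](expr1n _ 2) eqf_sqr => /orP[]/eqP; [left|right].
have Hd := back _ _ _ t1; have Hc := back _ _ _ r3.
(* The sample point of the overlap has weight [2 / 3] on [x'] and [1 / 25] on [cz]. The second
   weight is small because [cz] is more than four times as far from [y] as [x'] is. *)
refine (@chain_overlap z x d y x' cz cw sw sl^-1 (2 / 3) (1 / 25) (17 / 145) (144 / 145) e
  Ee _ _ _ _ _ _ _ _ Hd Hy Hx' Hc); first by rewrite invr_gt0.
all: rewrite /cw /sw /sl; lra.
Qed.
End Chain.

Local Close Scope ring_scope.

(** * Cut patterns of a single hat *)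

(** An explicit enumeration, like [kind] below, so that case analysis and evaluation meet closed
    constructors. *)
Inductive tri := t0 | t1 | t2.
Definition tri_code k : option bool := match k with t0 => None | t1 => Some false | t2 => Some true end.
Definition tri_decode o := match o with None => t0 | Some false => t1 | Some true => t2 end.
Lemma tri_codeK : cancel tri_code tri_decode. Proof. by case. Qed.
HB.instance Definition _ := Equality.copy tri (can_type tri_codeK).
HB.instance Definition _ := Choice.copy tri (can_type tri_codeK).
HB.instance Definition _ := Countable.copy tri (can_type tri_codeK).
HB.instance Definition _ := Finite.copy tri (can_type tri_codeK).

Definition nxt k := match k with t0 => t1 | t1 => t2 | t2 => t0 end.

Inductive kind := Brim | Skirt | Spike.
Definition kind_code k := match k with Brim => t0 | Skirt => t1 | Spike => t2 end.
Definition kind_decode o := match o with t0 => Brim | t1 => Skirt | t2 => Spike end.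
Lemma kind_codeK : cancel kind_code kind_decode. Proof. by case. Qed.
HB.instance Definition _ := Equality.copy kind (can_type kind_codeK).
HB.instance Definition _ := Choice.copy kind (can_type kind_codeK).
HB.instance Definition _ := Countable.copy kind (can_type kind_codeK).
HB.instance Definition _ := Finite.copy kind (can_type kind_codeK).

(* The vertices of a hat: [inl k] is a corner of the base triangle, [inr (Some k)]
   the inner vertex facing the side opposite to that corner, [inr None] the apex. *)
Definition lvert := (tri + option tri)%type.
(* [(Brim, k)] joins [Inn k] to the side opposite to [Cor k], [(Skirt, k)] joins
   [Cor k] and [(Spike, k)] joins [Apex] to the two other inner vertices. *)
Definition lface := (kind * tri)%type.
Notation Cor k := (inl k : lvert).
Notation Inn k := (inr (Some k) : lvert).
Notation Apex := (inr None : lvert).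

Definition inc (f : lface) (v : lvert) : bool :=
  match f.1, v with
  | Brim, inl k => k != f.2
  | Brim, inr (Some k) => k == f.2
  | Brim, inr None => false
  | Skirt, inl k => k == f.2
  | Skirt, inr (Some k) => k != f.2
  | Skirt, inr None => false
  | Spike, inl _ => false
  | Spike, inr (Some k) => k != f.2
  | Spike, inr None => true
  end.

Definition lverts : seq lvert :=
  [:: Cor t0; Cor t1; Cor t2; Inn t0; Inn t1; Inn t2; Apex].
Definition lfaces : seq lface := [seq (a, k) | a <- [:: Brim; Skirt; Spike], k <- [:: t0; t1; t2]].

Lemma mem_lverts v : v \in lverts. Proof. by case: v => [[]|[[]|]]. Qed.
Lemma mem_lfaces f : f \in lfaces. Proof. by case: f => [[] []]. Qed.

Definition ledges : seq (lvert * lvert) :=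
  [seq (Cor l, Inn k) | k <- [:: t0; t1; t2], l <- [:: nxt k; nxt (nxt k)]] ++
  [seq (Inn (nxt k), Inn (nxt (nxt k))) | k <- [:: t0; t1; t2]] ++
  [seq (Inn k, Apex) | k <- [:: t0; t1; t2]].

(** Cyclic order matters: consecutive entries share a face with [Inn k], and the last and the first
    share the brim. *)
Definition ring_around k : seq lvert :=
  [:: Cor (nxt k); Inn (nxt (nxt k)); Apex; Inn (nxt k); Cor (nxt (nxt k))].

Definition edge_faces (e : lvert * lvert) := [seq f <- lfaces | inc f e.1 && inc f e.2].
Definition edge_pos (x y : lvert) := find (fun e => (e == (x, y)) || (e == (y, x))) ledges.

Definition adjacency : seq (nat * nat) := Eval vm_compute in
  [seq (index (nth (Brim, t0) (edge_faces e) 0) lfaces, index (nth (Brim, t0) (edge_faces e) 1) lfaces)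
  | e <- ledges].
Definition fan_pos : seq (seq nat) := Eval vm_compute in
  [seq [seq edge_pos (Inn k) v | v <- ring_around k] | k <- [:: t0; t1; t2]].
(** The sides crossed along [Spike y], [Skirt y], [Brim z], [Skirt x], [Brim y], [Skirt z]. *)
Definition chain_edges x y z : seq (lvert * lvert) :=
  [:: (Inn z, Inn x); (Inn z, Cor y); (Inn z, Cor x); (Inn y, Cor x); (Inn y, Cor z)].
Definition orders : seq (tri * tri * tri) :=
  [:: (t0, t1, t2); (t1, t2, t0); (t2, t0, t1); (t0, t2, t1); (t2, t1, t0); (t1, t0, t2)].
Definition chain_pos : seq (seq nat) := Eval vm_compute in
  [seq [seq edge_pos e.1 e.2 | e <- chain_edges o.1.1 o.1.2 o.2] | o <- orders].

(* [u] lists which of the twelve [ledges] are uncut. *)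
Section Check.
Variable u : seq bool.
Definition fan_uncut := has (fun ps => (4 <= count (nth false u) ps)%N) fan_pos.
Definition chain_uncut := has (all (nth false u)) chain_pos.

Definition spread (s : seq bool) (ijb : nat * nat * bool) :=
  let: (i, j, b) := ijb in
  if b && (nth false s i || nth false s j) then set_nth false (set_nth false s i true) j true else s.
Definition reach := iter 8 (fun s => foldl spread s (zip adjacency u)) (true :: nseq 8 false).
(* [reach] are the faces connected to face 0 by uncut edges inside the hat. *)
Definition splits := nth false reach 0 && ~~ all (nth false reach) (iota 0 9) &&
  all (fun ijb => ijb.2 ==> eqb (nth false reach ijb.1.1) (nth false reach ijb.1.2)) (zip adjacency u).
Definition check := [|| fan_uncut, chain_uncut | splits].
End Check.

Fixpoint all_bits n (P : seq bool -> bool) :=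
  if n is n'.+1 then all_bits n' (fun s => P (true :: s)) && all_bits n' (fun s => P (false :: s)) else P [::].

Lemma all_bitsP n P : all_bits n P -> forall s, size s = n -> P s.
Proof.
elim: n P => [|n IH] P /=; first by move=> ? [].
by case/andP=> /IH Ht /IH Hf [//|[] s] [/eqP] /eqP Hs; [apply: Ht|apply: Hf].
Qed.

(* Finite search: unless the hat is cut into two parts, five triangles around an
   inner vertex, or a chain of six, are glued to each other. *)
Lemma all_check : all_bits 12 check.
Proof. by vm_compute. Qed.

Definition edge_at (f g : lface) (x y : lvert) j :=
  let e := nth (x, x) ledges j in let a := nth (9, 9) adjacency j in
  let i := index f lfaces in let i' := index g lfaces in
  ((e == (x, y)) || (e == (y, x))) && ((a == (i, i')) || (a == (i', i))).

Lemma edge_atP (f g : lface) (x y : lvert) : f != g -> x != y -> inc f x -> inc g x -> inc f y -> inc g y ->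
  has (edge_at f g x y) (iota 0 12).
Proof.
have : all (fun f => all (fun g => (f != g) ==> all (fun x => inc f x && inc g x ==>
  all (fun y => [&& x != y, inc f y & inc g y] ==> has (edge_at f g x y) (iota 0 12)) lverts) lverts)
  lfaces) lfaces by vm_compute.
move=> /allP/(_ f (mem_lfaces f))/allP/(_ g (mem_lfaces g)) H fg xy fx gx fy gy.
move: H; rewrite fg => /allP/(_ x (mem_lverts x)); rewrite fx gx => /allP/(_ y (mem_lverts y)).
by rewrite xy fy gy.
Qed.

Local Open Scope ring_scope.

Definition okverts (f : lface) (x y z : lvert) :=
  [&& x != y, y != z, x != z, inc f x, inc f y & inc f z].

Inductive len := LBase | LLeg | LTop.
(** Meant for distinct vertices of a common face; a corner and the apex share no face and get the
    junk value [LLeg]. *)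
Definition lenk (x y : lvert) : len := match x, y with
  | inl _, inl _ => LBase
  | inr (Some _), inr (Some _) => LTop
  | _, _ => LLeg end.

(** The face [f] seen from [p], with an angle of kind [b] there. Base angles of brims and apex
    angles of skirts and spikes are left out, since fans and chains never turn through them. *)
Definition okstep f p w w' (b : bool) := okverts f p w w' &&
  match lenk p w, lenk p w', lenk w w', b with
  | LLeg, LLeg, LBase, true | LLeg, LTop, LLeg, false | LTop, LLeg, LLeg, false => true
  | _, _, _, _ => false end.

(** * Layouts of a single hat *)

Section Local.
Variable R : realType.

Definition lenR (l : len) : R := match l with LBase => 40 / 29 | LLeg => 1 | LTop => sl R end.

Lemma lenR_gt0 l : 0 < lenR l.
Proof. by case: l; rewrite /lenR /sl; lra. Qed.

Lemma okstep_side f p w w' b : okstep f p w w' b ->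
  lenR (lenk w w') ^+ 2 = sidek b (lenR (lenk p w)) (lenR (lenk p w')).
Proof.
case/andP=> _; rewrite /sidek /cosk /lenR /sl.
by case: (lenk p w); case: (lenk p w'); case: (lenk w w'); case: b => // _; field.
Qed.

Variables (Lf : lface -> lvert -> 'rV[R]_2) (U : lvert -> lvert -> bool) (conn : lface -> lface -> Prop).
Hypothesis Usym : forall x y, U x y = U y x.
Hypothesis conn_trans : forall f g h, conn f g -> conn g h -> conn f h.
Hypothesis Lf_dist : forall f x y, inc f x -> inc f y -> x != y ->
  d2 (Lf f x) (Lf f y) = lenR (lenk x y) ^+ 2.
Hypothesis Lf_glue : forall (f g : lface) (x y : lvert), f != g -> x != y -> inc f x -> inc g x -> inc f y -> inc g y ->
  U x y -> [/\ Lf f x = Lf g x, Lf f y = Lf g y & conn f g].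
Hypothesis Lf_disj : forall (f g : lface) x y z x' y' z', f != g -> conn f g -> okverts f x y z -> okverts g x' y' z' ->
  ~ overlap (Lf f x) (Lf f y) (Lf f z) (Lf g x') (Lf g y') (Lf g z').

Lemma fan_local (p w0 w1 w2 w3 w4 : lvert) (f1 f2 f3 f4 f5 : lface) (b1 b2 b3 b4 b5 : bool) :
  (b1 + b2 + b3 + b4 + b5 == 1)%N && uniq [:: f1; f2; f3; f4; f5] ->
  [&& okstep f1 p w0 w1 b1, okstep f2 p w1 w2 b2, okstep f3 p w2 w3 b3, okstep f4 p w3 w4 b4 &
    okstep f5 p w4 w0 b5] -> [&& U p w1, U p w2, U p w3 & U p w4] -> False.
Proof.
case/andP=> /eqP Hb Hu /and5P[s1 s2 s3 s4 s5] /and4P[u1 u2 u3 u4].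
move: (Hu) => /= /and5P[]; rewrite !inE !negb_or => /and4P[n12 n13 n14 n15] /and3P[n23 n24 n25].
move=> /andP[n34 n35] n45 _.
have V f a b c d : okstep f a b c d -> okverts f a b c by case/andP.
have [v1 v2 v3 v4 v5] := And5 (V _ _ _ _ _ s1) (V _ _ _ _ _ s2) (V _ _ _ _ _ s3) (V _ _ _ _ _ s4) (V _ _ _ _ _ s5).
have G f g a b c d e k : f != g -> U a c -> okverts f a b c -> okverts g a d e -> c = d -> 
    [/\ Lf f a = Lf g a, Lf f c = Lf g c & conn f g] * (k = k :> nat).
  move=> fg Uac /and5P[_ _ ac fa /andP[_ fc]] /and5P[_ _ _ ga /andP[gd _]] E; split=> //.
  by apply: Lf_glue; rewrite // E.
have [[p12 e1 c12] _] := G _ _ _ _ _ _ _ 0%N n12 u1 v1 v2 erefl.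
have [[p23 e2 c23] _] := G _ _ _ _ _ _ _ 0%N n23 u2 v2 v3 erefl.
have [[p34 e3 c34] _] := G _ _ _ _ _ _ _ 0%N n34 u3 v3 v4 erefl.
have [[p45 e4 c45] _] := G _ _ _ _ _ _ _ 0%N n45 u4 v4 v5 erefl.
have c15 := conn_trans (conn_trans (conn_trans c12 c23) c34) c45.
have D1 f a b c : okverts f a b c -> d2 (Lf f a) (Lf f b) = lenR (lenk a b) ^+ 2.
  by case/and5P=> ab _ _ fa /andP[fb _]; apply: Lf_dist.
have D2 f a b c : okverts f a b c -> d2 (Lf f a) (Lf f c) = lenR (lenk a c) ^+ 2.
  by case/and5P=> _ _ ac fa /andP[_ fc]; apply: Lf_dist.
have D3 f a b c d : okstep f a b c d ->
    d2 (Lf f b) (Lf f c) = sidek d (lenR (lenk a b)) (lenR (lenk a c)).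
  move=> s; rewrite -(okstep_side s); case/V/and5P: s => _ bc _ _ /andP[fb fc].
  exact: Lf_dist.
apply: (Lf_disj n15 c15 v1 v5).
rewrite -[Lf f5 p]p45 -[Lf f4 p]p34 -[Lf f3 p]p23 -[Lf f2 p]p12.
have L := lenR_gt0.
apply: (@fan5 _ (Lf f1 p) (Lf f1 w0) (Lf f1 w1) (Lf f2 w2) (Lf f3 w3) (Lf f5 w4) (Lf f5 w0)
  b1 b2 b3 b4 b5 _ _ _ _ _ _ Hb (And5 (L _) (L _) (L _) (L _) (L _)) (L _)).
- split; [exact: D1 v1|exact: D2 v1|rewrite p12; exact: D2 v2|rewrite p12 p23; exact: D2 v3|].
  by rewrite p12 p23 p34 p45; exact: D1 v5.
- by rewrite p12 p23 p34 p45; exact: D2 v5.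
- split; [exact: D3 s1|rewrite e1; exact: D3 s2|rewrite e2; exact: D3 s3| |exact: D3 s5].
  by rewrite e3 -e4; exact: D3 s4.
- split.
  + by have := Lf_disj n12 c12 v1 v2; rewrite -p12 -e1.
  + by have := Lf_disj n23 c23 v2 v3; rewrite -p23 -p12 -e1 -e2.
  + by have := Lf_disj n34 c34 v3 v4; rewrite -p34 -p23 -p12 -e2 -e3 e4.
  + by have := Lf_disj n45 c45 v4 v5; rewrite -p45 -p34 -p23 -p12 -e3 e4.
Qed.

Lemma chain_local (z d x cy cx y cz : lvert) (f1 f2 f3 f4 f5 f6 : lface) :
  uniq [:: f1; f2; f3; f4; f5; f6] ->
  [&& okstep f1 z d x false, okstep f2 z x cy false, okstep f3 z cy cx true & okstep f4 z cx y false] ->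
  [&& okstep f5 y cx cz true & okstep f6 y cz x false] ->
  [/\ lenk z d = LLeg, lenk z x = LTop, lenk z cy = LLeg & lenk z cx = LLeg] ->
  [/\ lenk z y = LTop, lenk y cx = LLeg, lenk y cz = LLeg & lenk y x = LTop] ->
  [&& U z x, U z cy, U z cx, U y cx & U y cz] -> False.
Proof.
move=> Hu /and4P[s1 s2 s3 s4] /andP[s5 s6] [q1 q2 q3 q4] [q5 q6 q7 q8] /and5P[u1 u2 u3 u4 u5].
move: (Hu) => /= /and5P[]; rewrite !inE !negb_or => /and5P[n12 n13 n14 n15 n16] /and4P[n23 n24 n25 n26].
move=> /and3P[n34 n35 n36] /andP[n45 n46] /andP[n56 _].
have V f a b c e : okstep f a b c e -> okverts f a b c by case/andP.
have [v1 v2 v3 v4 v5] := And5 (V _ _ _ _ _ s1) (V _ _ _ _ _ s2) (V _ _ _ _ _ s3) (V _ _ _ _ _ s4) (V _ _ _ _ _ s5).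
have v6 := V _ _ _ _ _ s6.
have W f a b c : okverts f a b c -> [/\ inc f a, inc f b, inc f c & [/\ a != b, b != c & a != c]].
  by case/and5P=> ? ? ? ? /andP[? ?].
have [i1z i1d i1x [_ _ zx]] := W _ _ _ _ v1; have [i2z i2x i2cy [_ xcy zcy]] := W _ _ _ _ v2.
have [i3z i3cy i3cx [_ _ zcx]] := W _ _ _ _ v3; have [i4z i4cx i4y [_ cxy zy]] := W _ _ _ _ v4.
have [i5y i5cx i5cz [ycx _ ycz]] := W _ _ _ _ v5; have [i6y i6cz i6x [_ _ yx]] := W _ _ _ _ v6.
have [z12 x12 c12] := Lf_glue n12 zx i1z i2z i1x i2x u1.
have [z23 cy23 c23] := Lf_glue n23 zcy i2z i3z i2cy i3cy u2.
have [z34 cx34 c34] := Lf_glue n34 zcx i3z i4z i3cx i4cx u3.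
have [y45 cx45 c45] := Lf_glue n45 ycx i4y i5y i4cx i5cx u4.
have [y56 cz56 c56] := Lf_glue n56 ycz i5y i6y i5cz i6cz u5.
have c16 := conn_trans (conn_trans (conn_trans (conn_trans c12 c23) c34) c45) c56.
have D1 f a b c : okverts f a b c -> d2 (Lf f a) (Lf f b) = lenR (lenk a b) ^+ 2.
  by case/and5P=> ab _ _ fa /andP[fb _]; apply: Lf_dist.
have D2 f a b c : okverts f a b c -> d2 (Lf f a) (Lf f c) = lenR (lenk a c) ^+ 2.
  by case/and5P=> _ _ ac fa /andP[_ fc]; apply: Lf_dist.
have D3 f a b c e : okstep f a b c e ->
    d2 (Lf f b) (Lf f c) = sidek e (lenR (lenk a b)) (lenR (lenk a c)).
  move=> s; rewrite -(okstep_side s); case/V/and5P: s => _ bc _ _ /andP[fb fc].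
  exact: Lf_dist.
have v6' : okverts f6 y cz x by [].
apply: (Lf_disj n16 c16 v1 v6').
have z4 : Lf f1 z = Lf f4 z by rewrite z12 z23.
rewrite -y56 -y45 z4.
have [d1 d2' d3 d4 d5] := And5 (D1 _ _ _ _ v1) (D2 _ _ _ _ v1) (D2 _ _ _ _ v2) (D2 _ _ _ _ v3) (D2 _ _ _ _ v4).
have [d6 d7 d8] := And3 (D1 _ _ _ _ v5) (D2 _ _ _ _ v5) (D2 _ _ _ _ v6).
have [h1 h2 h3 h4 h5] := And5 (D3 _ _ _ _ _ s1) (D3 _ _ _ _ _ s2) (D3 _ _ _ _ _ s3) (D3 _ _ _ _ _ s4) (D3 _ _ _ _ _ s5).
have h6 := D3 _ _ _ _ _ s6.
move: d1 d2' d3 d4 d5 d6 d7 d8 h1 h2 h3 h4 h5 h6.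
rewrite q1 q2 q3 q4 q5 q6 q7 q8 /lenR => d1 d2' d3 d4 d5 d6 d7 d8 h1 h2 h3 h4 h5 h6.
apply: (@chain6 _ (Lf f4 z) (Lf f1 d) (Lf f1 x) (Lf f2 cy) (Lf f3 cx) (Lf f4 y) (Lf f6 cz) (Lf f6 x)).
- by split; rewrite -?z4 // ?z12 // ?z23 // z34.
- split=> //; first by rewrite x12.
  + by rewrite cy23.
  + by rewrite cx34.
- split; last by rewrite y45 y56.
  + by rewrite y45 cx34 cx45.
  + by rewrite y45 -cz56.
- by split=> //; rewrite cx34 cx45 -cz56.
- split.
  + by have := Lf_disj n12 c12 v1 v2; rewrite -z12 -x12 z4.
  + by have := Lf_disj n23 c23 v2 v3; rewrite -z23 -z12 -x12 -cy23 z4.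
  + by have := Lf_disj n34 c34 v3 v4; rewrite -z34 -z23 -z12 -cy23 -cx34 z4.
- split.
  + have v4' : okverts f4 y z cx.
      by rewrite /okverts i4z i4cx i4y zcx (eq_sym y z) zy ycx.
    by have := Lf_disj n45 c45 v4' v5; rewrite -y45 -cx45 -cx34 cz56.
  + by have := Lf_disj n56 c56 v5 v6'; rewrite -y56 -y45 -cz56 -cx45 -cx34.
Qed.

(** One instance of [fan_local] for each of the five edges that may be the cut one; if none is cut,
    the first instance serves. *)
Lemma fan_at k : (4 <= count (U (Inn k)) (ring_around k))%N -> False.
Proof.
move=> H.
pose sk1 := (Skirt, nxt k) : lface; pose sk2 := (Skirt, nxt (nxt k)) : lface.
pose sp1 := (Spike, nxt k) : lface; pose sp2 := (Spike, nxt (nxt k)) : lface.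
pose br := (Brim, k) : lface.
pose c1 := Cor (nxt k); pose c2 := Cor (nxt (nxt k)); pose i1 := Inn (nxt k); pose i2 := Inn (nxt (nxt k)).
have F := @fan_local (Inn k).
have F0 := F c1 i2 Apex i1 c2 sk1 sp1 sp2 sk2 br false false false false true.
have F1 := F i2 Apex i1 c2 c1 sp1 sp2 sk2 br sk1 false false false true false.
have F2 := F Apex i1 c2 c1 i2 sp2 sk2 br sk1 sp1 false false true false false.
have F3 := F i1 c2 c1 i2 Apex sk2 br sk1 sp1 sp2 false true false false false.
have F4 := F c2 c1 i2 Apex i1 br sk1 sp1 sp2 sk2 true false false false false.
move: H F0 F1 F2 F3 F4; rewrite /= -/c1 -/c2 -/i1 -/i2 addn0.
case: (U _ c1); case: (U _ i2); case: (U _ Apex); case: (U _ i1); case: (U _ c2) => //= _ F0 F1 F2 F3 F4;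
  [apply: F0|apply: F4|apply: F3|apply: F2|apply: F1|apply: F0] => //;
  rewrite /sk1 /sk2 /sp1 /sp2 /br /c1 /c2 /i1 /i2; by case: (k).
Qed.

Lemma chain_at x y z : x != y -> y != z -> x != z ->
  all (fun e => U e.1 e.2) (chain_edges x y z) -> False.
Proof.
move=> xy yz xz; rewrite /= andbT => H.
apply: (@chain_local (Inn z) Apex (Inn x) (Cor y) (Cor x) (Inn y) (Cor z) (Spike, y) (Skirt, y) (Brim, z)
  (Skirt, x) (Brim, y) (Skirt, z)) H => //.
- by case: x y z xy yz xz => [] [] [].
- by case: x y z xy yz xz => [] [] [].
- by case: x y z xy yz xz => [] [] [].
Qed.

(** The split is phrased as a colouring of the nine faces that is constant across uncut edges, the
    form in which it later extends to a label of whole pieces. *)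
Lemma hat_splits : exists S : lface -> bool, (exists f g, S f != S g) /\
  forall (f g : lface) (x y : lvert), f != g -> x != y -> inc f x -> inc g x -> inc f y -> inc g y ->
    U x y -> S f = S g.
Proof.
pose u := [seq U e.1 e.2 | e <- ledges].
have := all_bitsP all_check (erefl : size u = 12%N); case/or3P.
- case/hasP=> ps; rewrite !inE => /or3P[]/eqP-> H; exfalso.
  + apply: (@fan_at t0); move: H; rewrite /= !(Usym (Inn t0) (Cor _)).
    by rewrite (Usym (Inn t0) (Inn t2)).
  + apply: (@fan_at t1); move: H; rewrite /= !(Usym (Inn t1) (Cor _)).
    by rewrite (Usym (Inn t1) (Inn t0)).
  + apply: (@fan_at t2); move: H; rewrite /= !(Usym (Inn t2) (Cor _)).
    by rewrite (Usym (Inn t2) (Inn t1)).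
- case/hasP=> ps Hps H; exfalso.
  have E x y : U x y -> U y x by rewrite Usym.
  move: Hps H; rewrite !inE => /or4P[/eqP->|/eqP->|/eqP->|/or3P[]/eqP->] /= /and5P[a b c d /andP[e _]].
  + by apply: (@chain_at t0 t1 t2) => //=; rewrite !(a, b, c, d, e, E).
  + by apply: (@chain_at t1 t2 t0) => //=; rewrite !(a, b, c, d, e, E).
  + by apply: (@chain_at t2 t0 t1) => //=; rewrite !(a, b, c, d, e, E).
  + by apply: (@chain_at t0 t2 t1) => //=; rewrite !(a, b, c, d, e, E).
  + by apply: (@chain_at t2 t1 t0) => //=; rewrite !(a, b, c, d, e, E).
  + by apply: (@chain_at t1 t0 t2) => //=; rewrite !(a, b, c, d, e, E).
(* [splits] is a certificate: it tests directly that membership in [reach] agrees across every uncut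
   edge, so the saturation needs no correctness proof. *)
- set s := reach u; case/andP=> /andP[s0 Hn] Hc.
  exists (fun f => nth false s (index f lfaces)); split.
    case/allPn: Hn => j; rewrite mem_iota => /andP[_ j9] Hsj.
    exists (Brim, t0), (nth (Brim, t0) lfaces j).
    by rewrite index_uniq // (negbTE Hsj) s0.
  move=> f g x y fg xy fx gx fy gy Uxy.
  have /hasP[j] := edge_atP fg xy fx gx fy gy.
  rewrite mem_iota => /andP[_ j12] /andP[He Ha].
  have uj : nth false u j.
    by rewrite (nth_map (x, x)) //; case/orP: He => /eqP-> //=; rewrite Usym.
  move/(all_nthP ((9, 9), false)): Hc => /(_ j); rewrite size_zip size_map => /(_ j12).
  rewrite nth_zip ?size_map // uj /=.
  by case/orP: Ha => /eqP-> /eqP /=.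
Qed.
End Local.

(** * Compactness *)

Local Open Scope classical_set_scope.
Local Open Scope ring_scope.

(** Closed subsets of [A] are compact, so their images are compact and hence closed in the Hausdorff
    target; this is the continuity of the inverse. *)
Lemma compact_homeomorphic (T U : topologicalType) (x0 : T) (A : set T) (B : set U) (f : T -> U) :
  hausdorff_space U -> compact A -> {within A, continuous f} ->
  (forall x y, A x -> A y -> f x = f y -> x = y) ->
  (forall x, A x -> B (f x)) -> (forall y, B y -> exists2 x, A x & f x = y) -> homeomorphic A B.
Proof.
move=> hU cA cf injf AB BA.
pose g y := xget x0 [set x | A x /\ f x = y].
have gP y : B y -> A (g y) /\ f (g y) = y.
  by move=> /BA[x Ax fx]; apply: (xgetPex x0 (P := [set z | A z /\ f z = y])); exists x.
have gf x : A x -> g (f x) = x.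
  by move=> Ax; have [Ag fg] := gP _ (AB _ Ax); exact: injf Ag Ax fg.
exists f, g; split=> //; split; last first.
  split; first by move=> _ [x Ax <-]; apply: AB.
  split; first by move=> _ [y By <-]; have [] := gP _ By.
  by split=> // y /gP[].
apply/continuous_closedP => C cC; apply/closed_subspaceP.
exists (f @` (A `&` C)).
  apply: compact_closed => //; apply: continuous_compact; last exact: compact_closedI.
  by apply: continuous_subspaceW cf => x [].
apply/seteqP; split=> y /=.
  by move=> [[x [Ax Cx] <-] By]; split=> //; change (C (g (f x))); rewrite gf.
move=> [Cg By]; split=> //; have [Ag fg] := gP _ By; exists (g y) => //; split=> //.
Qed.

Lemma continuous_sum (R : realType) (T : topologicalType) (V : normedModType R) (I : finType) (h : I -> T -> V) :
  (forall i, continuous (h i)) -> continuous (fun x => \sum_i h i x).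
Proof. by move=> ch; apply: (continuous_big (op := +%R)) => //; apply: add_continuous. Qed.

Lemma continuous_row (R : realType) (T : topologicalType) n (h : T -> 'rV[R]_n.+1) :
  (forall i, continuous (fun x => h x 0 i)) -> continuous h.
Proof.
move=> ch; have -> : h = fun x => \sum_i h x 0 i *: delta_mx 0 i.
  by apply/funext => x; rewrite -row_sum_delta.
by apply: continuous_sum => i x; apply: continuousZr_tmp; apply: ch.
Qed.

Section Hull.
Variables (R : realType) (V : finType) (pos : V -> 'rV[R]_3).

(** The admissible weight vectors form a cube, with the coordinates outside [S] pinned to 0, cut by
    the hyperplane of total weight 1. The hull is the continuous image of this compact set. *)
Lemma hull_compact (S : {set V}) : compact (hull pos S).
Proof.
pose A (i : 'I_#|V|) := if enum_val i \in S then `[0, 1]%classic else [set 0 : R].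
pose B := [set w : 'rV[R]_#|V| | forall i, A i (w ord0 i)].
pose C := [set w : 'rV[R]_#|V| | \sum_i w ord0 i = 1].
pose phi (w : 'rV[R]_#|V|) := \sum_i w ord0 i *: pos (enum_val i).
have cB : compact B.
  by apply: rV_compact => i; rewrite /A; case: ifP => _; [exact: segment_compact|exact: compact_set1].
have cC : closed C.
  have : continuous (fun w : 'rV[R]_#|V| => \sum_i w ord0 i).
    by apply: continuous_sum => i; apply: coord_continuous.
  by move=> /continuous_closedP H; apply: (H [set x | x = 1]); exact: closed_eq.
have cphi : continuous phi.
  by apply: continuous_sum => i x; apply: continuousZr_tmp; apply: coord_continuous.
suff -> : hull pos S = phi @` (B `&` C).
  apply: continuous_compact; last exact: compact_closedI.
  exact: continuous_subspaceT.
have sumE (M : nmodType) (g : V -> M) : \sum_v g v = \sum_(i < #|V|) g (enum_val i).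
  rewrite [RHS](reindex (@enum_rank V)) /=; last exact: onW_bij (@enum_rank_bij V).
  apply: eq_bigr => v _.
  by rewrite enum_rankK.
apply/seteqP; split=> x.
  move=> [w [w0 [wS [w1 ->]]]]; exists (\row_i w (enum_val i)); last first.
    by rewrite sumE; apply: eq_bigr => i _; rewrite mxE.
  have Es : \sum_(i < #|V|) w (enum_val i) = 1 by rewrite -sumE.
  split; last by rewrite /C /= -[RHS]Es; apply: eq_bigr => i _; rewrite mxE.
  move=> i; rewrite mxE /A; case: ifPn => [_|/wS//].
  rewrite /= in_itv /= w0 -w1 (bigD1 (enum_val i)) //= lerDl.
  by apply: sumr_ge0 => v _.
move=> [w [Bw Cw] <-]; exists (fun v => w ord0 (enum_rank v)); split; [|split; [|split]].
- move=> v; have := Bw (enum_rank v); rewrite /A enum_rankK.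
  by case: ifP => _ /=; rewrite ?in_itv /= => H; [case/andP: H|rewrite H].
- by move=> v nv; have := Bw (enum_rank v); rewrite /A enum_rankK (negbTE nv).
- by rewrite sumE -[RHS]Cw; apply: eq_bigr => i _; rewrite enum_valK.
- by rewrite sumE; apply: eq_bigr => i _; rewrite enum_valK.
Qed.

Lemma surface_compact (F : {set {set V}}) : compact (surface pos F).
Proof.
have H (s : seq {set V}) : compact [set x | exists2 f, f \in s & hull pos f x].
  elim: s => [|f s IH].
    suff -> : [set x | exists2 f : {set V}, f \in [::] & hull pos f x] = set0 by exact: compact0.
    by apply/seteqP; split=> // x [].
  suff -> : [set x | exists2 g, g \in f :: s & hull pos g x] =
      hull pos f `|` [set x | exists2 f, f \in s & hull pos f x] by apply: compactU => //; exact: hull_compact.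
  apply/seteqP; split=> x /=.
    by move=> [g]; rewrite inE => /orP[/eqP->|gs] Hx; [left|right; exists g].
  by case=> [Hx|[g gs Hx]]; [exists f => //; rewrite inE eqxx|exists g => //; rewrite inE gs orbT].
suff -> : surface pos F = [set x | exists2 f, f \in enum F & hull pos f x] by exact: H.
by apply/seteqP; split=> x [f fF Hx]; exists f => //; move: fF; rewrite mem_enum.
Qed.
End Hull.

Local Close Scope classical_set_scope.

From mathcomp Require Import fintype finset.

(** * Counting pieces *)

Section Components.
Variables (T : finType) (D : {set T}) (r r' : rel T) (a b : T).
Hypothesis r'_sym : symmetric r'.
Hypothesis r_sym : symmetric r.
Hypothesis r'r : subrel r' r.
Hypothesis rr' : forall x y, r x y -> [|| r' x y, (x == a) && (y == b) | (x == b) && (y == a)].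

Definition comps (s : rel T) := [set [set y in D | connect s x y] | x in D].

(** If [x] cannot reach [a] within [r'], an [r]-path from [x] can cross the additional edge for the
    first time only from [b] to [a]. *)
Lemma connect_add x y : ~~ connect r' x a -> connect r x y ->
  connect r' x y || (connect r' x b && connect r' a y).
Proof.
move=> xa /connectP[p]; elim/last_ind: p y => [|p z IH] y /=; first by move=> _ ->; rewrite connect0.
rewrite rcons_path last_rcons => /andP[/IH/(_ erefl) IHp rz] ->; move: IHp.
set w := last x p in rz *; case/or3P: (rr' rz) => [wz|/andP[/eqP-> /eqP->]|/andP[/eqP-> /eqP->]].
- case/orP=> [xw|/andP[-> aw]]; first by rewrite (connect_trans xw (connect1 wz)).
  by rewrite (connect_trans aw (connect1 wz)) orbT.
- by rewrite (negbTE xa) => /andP[-> _].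
- by case/orP=> [->|/andP[-> _]]; rewrite connect0 orbT.
Qed.

(** Sending an [r']-component to the [r]-component around it is injective once the component of [a]
    is set aside: two components can merge only if one of them is that of [a]. *)
Lemma card_comps_add : (#|comps r'| <= #|comps r|.+1)%N.
Proof.
have cs' : connect_sym r' by apply: sym_connect_sym.
have cs : connect_sym r by apply: sym_connect_sym.
have eqc s x y : connect_sym s -> connect s x y -> [set z in D | connect s x z] = [set z in D | connect s y z].
  by move=> ss xy; apply/setP => z; rewrite !inE (same_connect ss xy).
rewrite (cardsD1 [set y in D | connect r' a y]) -add1n leq_add ?leq_b1 //.
pose h (C : {set T}) := [set y in D | [exists x in C, connect r x y]].
have hE x : x \in D -> h [set y in D | connect r' x y] = [set y in D | connect r x y].
  move=> xD; apply/setP => y; rewrite !inE; case: (y \in D) => //=.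
  apply/existsP/idP => [[z]|xy]; last by exists x; rewrite inE xD connect0.
  rewrite inE => /andP[/andP[_ xz] zy]; apply: connect_trans zy.
  by apply: connect_sub xz => u v uv; apply/connect1/r'r.
have inj : {in comps r' :\ [set y in D | connect r' a y] &, injective h}.
  move=> X Y /setD1P[na /imsetP[x xD EX]] /setD1P[nb /imsetP[y yD EY]].
  rewrite {}EX {}EY in na nb *; rewrite !hE // => E.
  have xy : connect r x y.
    have : y \in [set z in D | connect r x z] by rewrite E inE yD connect0.
    by rewrite inE => /andP[].
  have xa : ~~ connect r' x a by apply/negP => xa; case/eqP: na; apply: eqc.
  have ya : ~~ connect r' y a by apply/negP => ya; case/eqP: nb; apply: eqc.
  case/orP: (connect_add xa xy) => [xy'|/andP[_ ay]]; first exact: eqc.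
  by move: ya; rewrite cs' ay.
rewrite -(card_in_imset inj); apply/subset_leq_card/subsetP => Y.
case/imsetP=> X /setD1P[_ /imsetP[x xD ->]] ->.
by rewrite hE //; apply/imsetP; exists x.
Qed.
End Components.

Section Pieces.
Variables (V : finType) (F : {set {set V}}).
Implicit Types (cut E : {set {set V}}) (e : {set V}).

Lemma fadj_sym cut : symmetric (fadj F cut).
Proof.
by move=> f g; rewrite /fadj /= setIC eq_sym; case: (f \in F); case: (g \in F).
Qed.

(** In the adjacency graph of the faces, [e] accounts for at most one link, between the at most two
    faces containing it. With fewer such faces [a] and [b] are dummies. *)
Lemma pieces_add_edge cut e : (#|[set f in F | e \subset f]| <= 2)%N ->
  (#|pieces F (e |: cut)| <= #|pieces F cut|.+1)%N.
Proof.
move=> He.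
have [a [b Hab]] : exists a b, [set f in F | e \subset f] \subset [set a; b].
  case: (set_0Vmem [set f in F | e \subset f]) => [->|[a Ha]]; first by exists set0, set0; rewrite sub0set.
  case: (set_0Vmem ([set f in F | e \subset f] :\ a)) => [E|[b Hb]].
    exists a, a; apply/subsetP => x Hx; rewrite setUid inE.
    by apply/negPn/negP => xa; have := in_set0 x; rewrite -E in_setD1 xa Hx.
  exists a, b; have -> // : [set f in F | e \subset f] = [set a; b].
  apply/esym/eqP; rewrite eqEcard cards2; case/setD1P: (Hb) => ba Hb'.
  by rewrite eq_sym ba He andbT; apply/subsetP => x /set2P[]->.
apply: (@card_comps_add _ F (fadj F cut) (fadj F (e |: cut)) a b).
- exact: fadj_sym.
- exact: fadj_sym.
- move=> f g /and5P[fF gF fg Hfg]; rewrite in_setU1 negb_or => /andP[_ nc].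
  by apply/and5P; split.
- move=> f g /and5P[fF gF fg Hfg nc].
  case: (eqVneq (f :&: g) e) => [E|ne]; last first.
    by apply/orP; left; apply/and5P; split=> //; rewrite in_setU1 negb_or ne.
  have fab : f \in [set a; b] by apply: (subsetP Hab); rewrite inE fF -E subsetIl.
  have gab : g \in [set a; b] by apply: (subsetP Hab); rewrite inE gF -E subsetIr.
  move: fg; case/set2P: fab => ->; case/set2P: gab => ->; rewrite !eqxx ?orbT //.
Qed.

Lemma pieces_add cut E : (forall e, e \in E -> #|[set f in F | e \subset f]| <= 2)%N ->
  (#|pieces F (E :|: cut)| <= #|pieces F cut| + #|E|)%N.
Proof.
move: {2}#|E| (erefl #|E|) => n; elim: n E cut => [|n IH] E cut En HE.
  by move/cards0_eq: En => ->; rewrite set0U cards0 addn0.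
have [e eE] : exists e, e \in E by apply/card_gt0P; rewrite En.
have E1 : #|E :\ e| = n by move: En; rewrite (cardsD1 e) eE add1n => -[].
rewrite -(setD1K eE) -setUA setUCA.
apply: leq_trans (IH (E :\ e) (e |: cut) E1 _) _; first by move=> x /setD1P[_ /HE].
rewrite setD1K // En E1 addnS -addSn leq_add2r.
exact/pieces_add_edge/HE.
Qed.
End Pieces.

Lemma inc_two (f g : lface) (x y z : lvert) : f != g -> x != y ->
  inc f x -> inc g x -> inc f y -> inc g y -> inc f z -> inc g z -> (z == x) || (z == y).
Proof.
have : all (fun f => all (fun g => (f != g) ==> all (fun x => inc f x && inc g x ==>
  all (fun y => [&& x != y, inc f y & inc g y] ==>
  all (fun z => inc f z && inc g z ==> (z == x) || (z == y)) lverts) lverts) lverts)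
  lfaces) lfaces by vm_compute.
move=> /allP/(_ f (mem_lfaces f))/allP/(_ g (mem_lfaces g)) H fg xy fx gx fy gy fz gz.
move: H; rewrite fg => /allP/(_ x (mem_lverts x)); rewrite fx gx => /allP/(_ y (mem_lverts y)).
by rewrite xy fy gy => /allP/(_ z (mem_lverts z)); rewrite fz gz.
Qed.

Lemma inc_sub_eq (f g : lface) : (forall x, inc f x -> inc g x) -> f = g.
Proof.
have : all (fun f => all (fun g => all (fun x => inc f x ==> inc g x) lverts ==> (f == g)) lfaces) lfaces.
  by vm_compute.
move=> /allP/(_ f (mem_lfaces f))/allP/(_ g (mem_lfaces g))/implyP H fg; apply/eqP/H.
by apply/allP => x _; apply/implyP/fg.
Qed.

Lemma inc_inner (f : lface) : exists o, inc f (inr o).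
Proof. by case: f => [[] []]; solve [by exists (Some t0) | by exists (Some t1) | by exists (Some t2)]. Qed.

Definition lverts_of (f : lface) : seq lvert := [seq x <- lverts | inc f x].
Lemma lverts_ofP f : exists x y z, [/\ uniq [:: x; y; z], forall v, inc f v = (v \in [:: x; y; z]) &
  okverts f x y z].
Proof.
case: f => [[] []].
all: pose s f := lverts_of f.
- by exists (Cor t1), (Cor t2), (Inn t0); split=> //; case=> [[]|[[]|]].
- by exists (Cor t0), (Cor t2), (Inn t1); split=> //; case=> [[]|[[]|]].
- by exists (Cor t0), (Cor t1), (Inn t2); split=> //; case=> [[]|[[]|]].
- by exists (Cor t0), (Inn t1), (Inn t2); split=> //; case=> [[]|[[]|]].
- by exists (Cor t1), (Inn t0), (Inn t2); split=> //; case=> [[]|[[]|]].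
- by exists (Cor t2), (Inn t0), (Inn t1); split=> //; case=> [[]|[[]|]].
- by exists Apex, (Inn t1), (Inn t2); split=> //; case=> [[]|[[]|]].
- by exists Apex, (Inn t0), (Inn t2); split=> //; case=> [[]|[[]|]].
- by exists Apex, (Inn t0), (Inn t1); split=> //; case=> [[]|[[]|]].
Qed.

(** * A triangulated surface with hats *)

Section Hatted.
Variables (V0 I C : finType) (corner : I + C -> tri -> V0).
Hypothesis corner_inj : forall r, injective (corner r).
Hypothesis cap_inj : forall c c',
  (forall k, exists l, corner (inr c) k = corner (inr c') l) -> c = c'.

(** [I] indexes the base triangles that carry a hat, [C] those that stay as faces. A base triangle
    under a hat is not a face of the surface. *)
Definition hvert := (V0 + I * option tri)%type.
Definition glob (i : I) (x : lvert) : hvert :=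
  match x with inl k => inl (corner (inl i) k) | inr o => inr (i, o) end.
Definition hface (r : I * lface + C) : {set hvert} :=
  match r with
  | inl (i, f) => [set glob i x | x in inc f]
  | inr c => [set inl (corner (inr c) k) | k : tri]
  end.
Definition hfaces : {set {set hvert}} := [set hface r | r : I * lface + C].

Lemma glob_inj i : injective (glob i).
Proof.
case=> [k|o] [l|o'] //=; first by case=> /corner_inj->.
by case=> ->.
Qed.

Lemma in_hat i f x : (glob i x \in hface (inl (i, f))) = inc f x.
Proof. by rewrite (mem_imset _ _ (@glob_inj i)). Qed.

Lemma hatP i f v : reflect (exists2 x, inc f x & v = glob i x) (v \in hface (inl (i, f))).
Proof. by apply: (iffP imsetP) => -[x fx ->]; exists x. Qed.

Lemma inner_hat i f j o : (inr (j, o) \in hface (inl (i, f))) = (j == i) && inc f (inr o).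
Proof.
apply/hatP/andP => [[[k|o'] // fo [-> ->]] //|[/eqP-> fo]]; by exists (inr o).
Qed.

Lemma inner_cap c jo : (inr jo \in hface (inr c)) = false.
Proof. by apply/imsetP => -[]. Qed.

Lemma hface_inj : injective hface.
Proof.
case=> [[i f]|c] [[j g]|c'] E.
- have [m fm] := inc_inner f.
  have : inr (i, m) \in hface (inl (j, g)) by rewrite -E inner_hat eqxx.
  rewrite inner_hat => /andP[/eqP ij _]; subst j; congr (inl (_, _)).
  by apply: inc_sub_eq => x; rewrite -(in_hat i) E in_hat.
- have [m fm] := inc_inner f.
  have : inr (i, m) \in hface (inr c') by rewrite -E inner_hat eqxx.
  by rewrite inner_cap.
- have [m fm] := inc_inner g.
  have : inr (j, m) \in hface (inr c) by rewrite E inner_hat eqxx.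
  by rewrite inner_cap.
- congr inr; apply: cap_inj => k.
  have : inl (corner (inr c) k) \in hface (inr c') by rewrite -E; apply/imsetP; exists k.
  by case/imsetP=> l _ [->]; exists l.
Qed.

Lemma card_hface r : #|hface r| = 3.
Proof.
case: r => [[i f]|c] /=.
  rewrite (card_imset _ (@glob_inj i)).
  have [x [y [z [U E _]]]] := lverts_ofP f.
  rewrite (eq_card (B := mem [:: x; y; z])) ?(card_uniqP U) // => v; exact: E.
rewrite card_imset; last by move=> k l [] /corner_inj.
by rewrite (eq_card (B := mem [:: t0; t1; t2])) ?(card_uniqP _) // => -[].
Qed.

Lemma hfacesP f : reflect (exists r, f = hface r) (f \in hfaces).
Proof. by apply: (iffP imsetP) => [[r _ ->]|[r ->]]; exists r. Qed.

Lemma edgesP (e : {set hvert}) : reflect (#|e| = 2 /\ exists r, e \subset hface r) (e \in edges hfaces).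
Proof.
rewrite inE; apply: (iffP andP) => -[/eqP He H]; split=> //.
  by case/exists_inP: H => _ /hfacesP[r ->] ?; exists r.
by case: H => r ?; apply/exists_inP; exists (hface r) => //; apply/hfacesP; exists r.
Qed.

Definition base_edges : {set {set hvert}} :=
  [set e in edges hfaces | [forall jo, inr jo \notin e]].

Section Unfolding.
Variables (R : realType) (pos : hvert -> 'rV[R]_3) (cut : {set {set hvert}}).
Hypothesis hat_dist : forall i x y f, inc f x -> inc f y -> x != y ->
  d2 (pos (glob i x)) (pos (glob i y)) = lenR R (lenk x y) ^+ 2.
Hypothesis valid : valid_unfolding pos hfaces cut.
Hypothesis base_two : forall e, e \in base_edges -> (#|[set f in hfaces | e \subset f]| <= 2)%N.

Definition uncut i x y := [set glob i x; glob i y] \notin cut.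

Lemma hat_inter i f g x y : f != g -> x != y -> inc f x -> inc g x -> inc f y -> inc g y ->
  hface (inl (i, f)) :&: hface (inl (i, g)) = [set glob i x; glob i y].
Proof.
move=> fg xy fx gx fy gy; apply/setP => v; rewrite inE; apply/andP/set2P.
  case=> /hatP[z fz ->]; rewrite in_hat => gz.
  by case/orP: (inc_two fg xy fx gx fy gy fz gz) => /eqP->; [left|right].
by case=> ->; rewrite !in_hat.
Qed.

Lemma hat_edge i f x y : x != y -> inc f x -> inc f y -> [set glob i x; glob i y] \in edges hfaces.
Proof.
move=> xy fx fy; apply/edgesP; split.
  by rewrite cards2 (inj_eq (@glob_inj i)) xy.
by exists (inl (i, f)); apply/subsetP => v /set2P[]->; rewrite in_hat.
Qed.

Lemma open_hull3 (L : hvert -> 'rV[R]_2) (u v w : hvert) (f : {set hvert}) p : uniq [:: u; v; w] ->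
  f = [set u; v; w] -> tri_int (L u) (L v) (L w) p -> open_hull L f p.
Proof.
move=> /= /and3P[]; rewrite !inE negb_or => /andP[uv uw] vw _ -> [a [b [c [a0 b0 c0 abc ->]]]].
exists (fun x => if x == u then a else if x == v then b else if x == w then c else 0); split; [|split; [|split]].
- by move=> x; rewrite !inE; do 2![case: eqP => //= _]; case: eqP.
- by move=> x; rewrite !inE; do 2![case: eqP => //= _]; case: eqP.
- rewrite (bigD1 u) //= eqxx (bigD1 v) ?(eq_sym v) //= (negbTE uv) eqxx /=.
  rewrite (bigD1 w) /=; last by rewrite !(eq_sym w) uw.
  rewrite !(eq_sym w) (negbTE uw) (negbTE vw) eqxx big1 ?addr0 ?addrA // => x.
  by case/andP=> /andP[/negbTE-> /negbTE->] /negbTE->.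
- rewrite (bigD1 u) //= eqxx (bigD1 v) ?(eq_sym v) //= (negbTE uv) eqxx /=.
  rewrite (bigD1 w) /=; last by rewrite !(eq_sym w) uw.
  rewrite !(eq_sym w) (negbTE uw) (negbTE vw) eqxx big1 ?addr0 ?addrA // => x.
  by case/andP=> /andP[/negbTE-> /negbTE->] /negbTE->; rewrite scale0r.
Qed.

(** Restricts a layout of the whole surface to one hat. Here [conn] means lying in the same piece,
    where the connection may run outside the hat. *)
Lemma hat_cut_splits i : exists S : lface -> bool, (exists f g, S f != S g) /\
  forall (f g : lface) (x y : lvert), f != g -> x != y -> inc f x -> inc g x -> inc f y -> inc g y ->
    uncut i x y -> S f = S g.
Proof.
case: valid => _ [L [Ld [Lg Lp]]].
pose Lf f x := L (hface (inl (i, f))) (glob i x).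
pose conn f g : Prop := connect (fadj hfaces cut) (hface (inl (i, f))) (hface (inl (i, g))).
have inF r : hface r \in hfaces by apply/hfacesP; exists r.
apply: (@hat_splits R Lf (uncut i) conn).
- by move=> x y; rewrite /uncut setUC.
- by move=> f g h; apply: connect_trans.
- by move=> f x y fx fy xy; rewrite -(hat_dist i fx fy xy); apply: Ld; rewrite ?inF ?in_hat.
- move=> f g x y fg xy fx gx fy gy Uxy.
  have A : fadj hfaces cut (hface (inl (i, f))) (hface (inl (i, g))).
    apply/and5P; split; rewrite ?inF // ?(hat_inter i fg xy fx gx fy gy) ?(hat_edge i xy fx fy) //.
    by apply: contra fg => /eqP/hface_inj[->].
  by split; [apply: (Lg _ _ A)|apply: (Lg _ _ A)|exact: connect1];
    rewrite (hat_inter i fg xy fx gx fy gy) !inE eqxx ?orbT.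
- move=> f g x y z x' y' z' fg fgc vf vg [p p1 p2].
  have P : [set h in hfaces | connect (fadj hfaces cut) (hface (inl (i, f))) h] \in pieces hfaces cut.
    by apply/imsetP; exists (hface (inl (i, f))).
  have [D _] := Lp _ P.
  have H f' u v w : okverts f' u v w -> uniq [:: glob i u; glob i v; glob i w] /\
     hface (inl (i, f')) = [set glob i u; glob i v; glob i w].
    case/and5P=> uv vw uw fu /andP[fv fw].
    have U : uniq [:: glob i u; glob i v; glob i w].
      by rewrite /= !inE !(inj_eq (@glob_inj i)) negb_or uv uw vw.
    split=> //; apply/esym/eqP; rewrite eqEcard card_hface; apply/andP; split.
      by apply/subsetP => t; rewrite !inE => /orP[/orP[]|] /eqP->; rewrite in_hat.
    rewrite (eq_card (B := mem [:: glob i u; glob i v; glob i w])) ?(card_uniqP U) //.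
    by move=> t; rewrite !inE orbA.
  have [U1 E1] := H _ _ _ _ vf; have [U2 E2] := H _ _ _ _ vg.
  have := D (hface (inl (i, f))) (hface (inl (i, g))).
  rewrite !inE !inF connect0 fgc /= => /(_ isT isT) E.
  have fg' : hface (inl (i, f)) != hface (inl (i, g)) by apply: contra fg => /eqP/hface_inj[->].
  have Ep := congr1 (fun A => A p) (E fg').
  by rewrite -[False]/(classical_sets.set0 p) -Ep; split; [exact: (open_hull3 U1 E1)|exact: (open_hull3 U2 E2)].
Qed.

Lemma card_pieces_hats : (2 * #|I| + #|C| <= #|pieces hfaces cut| + #|base_edges|)%N.
Proof.
have [S HS] := boolp.choice hat_cut_splits.
apply: leq_trans (pieces_add cut base_two).
pose cut' := base_edges :|: cut.
have inF r : hface r \in hfaces by apply/hfacesP; exists r.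
(* A face is tagged by its hat and its side of the split, or by its cap. With the base edges cut as
   well no gluing changes the tag, and every tag occurs, so there are at least as many pieces as
   tags. *)
pose tag (r : I * lface + C) : I * bool + C :=
  match r with inl (i, f) => inl (i, S i f) | inr c => inr c end.
have tagP r r' : fadj hfaces cut' (hface r) (hface r') -> tag r = tag r'.
  case/and5P=> _ _ ne He; rewrite in_setU negb_or => /andP[nb nc].
  have Hnb : exists jo, inr jo \in hface r :&: hface r'.
    move: nb; rewrite inE He /= negb_forall => /existsP[jo].
    by rewrite negbK; exists jo.
  case: Hnb => -[j o]; rewrite inE.
  case: r ne He nb nc => [[i f]|c] ne He nb nc; last by rewrite inner_cap.
  case: r' ne He nb nc => [[i' g]|c] ne He nb nc; last by rewrite inner_cap andbF.
  rewrite !inner_hat => /andP[/andP[/eqP ji fo] /andP[/eqP ji' go]]; subst j i'.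
  congr (inl (_, _)); have fg : f != g by apply: contra ne => /eqP->.
  have [/eqP C2 _] := edgesP _ He.
  have [u [v [uv Euv]]] := cards2P _ C2.
  have : u \in hface (inl (i, f)) :&: hface (inl (i, g)) by rewrite Euv !inE eqxx.
  have : v \in hface (inl (i, f)) :&: hface (inl (i, g)) by rewrite Euv !inE eqxx orbT.
  rewrite !inE => /andP[/hatP[y fy Ey]]; rewrite Ey in_hat => gy.
  move=> /andP[/hatP[x fx Ex]]; rewrite Ex in_hat => gx.
  have xy : x != y by apply: contra uv => /eqP xy; rewrite Ex Ey xy.
  apply: (proj2 (HS i)) xy fx gx fy gy _ => //.
  by rewrite /uncut -Ex -Ey -Euv.
have tag_conn r g : connect (fadj hfaces cut') (hface r) g -> exists2 r', g = hface r' & tag r = tag r'.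
  case/connectP=> p; elim/last_ind: p g => [|p h IH] g /=; first by move=> _ ->; exists r.
  rewrite rcons_path last_rcons => /andP[/IH/(_ erefl)[r' -> Er] hh] ->.
  have /hfacesP[r'' Eh] : h \in hfaces by case/and5P: hh.
  by exists r'' => //; rewrite Er; apply: tagP; rewrite -Eh.
pose piece r := [set g in hfaces | connect (fadj hfaces cut') (hface r) g].
have piece_tag r r' : piece r = piece r' -> tag r = tag r'.
  move=> E; have : hface r' \in piece r by rewrite E inE inF connect0.
  by rewrite inE => /andP[_ /tag_conn[r'' /hface_inj -> ->]].
have [w Hw] : exists w : I * bool + C -> I * lface + C, forall t, tag (w t) = t.
  suff H t : exists r, tag r = t by have [w Hw] := boolp.choice H; exists w.
  case: t => [[i b]|c]; last by exists (inr c).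
  have [[f [g Hfg]] _] := HS i.
  case: (eqVneq (S i f) b) => [<-|nb]; first by exists (inl (i, f)).
  exists (inl (i, g)) => /=; congr (inl (_, _)); move: Hfg nb.
  by case: (S i f) (S i g) b => [] [] [].
have -> : (2 * #|I| + #|C| = #|{: I * bool + C}|)%N by rewrite card_sum card_prod card_bool mulnC.
rewrite -cardsT -(card_imset (f := piece \o w)); last first.
  by move=> t t' /piece_tag; rewrite !Hw.
apply: subset_leq_card; apply/subsetP => _ /imsetP[t _ ->].
by apply/imsetP; exists (hface (w t)); first exact: inF.
Qed.
End Unfolding.
End Hatted.

Local Close Scope ring_scope.

Lemma inner_edge_two (x y : lvert) (f : lface) (o : option tri) : x = inr o -> x != y -> inc f x -> inc f y ->
  #|[set g : lface | inc g x && inc g y]| = 2.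
Proof.
move=> -> xy fx fy.
have : all (fun o => all (fun y => (inr o != y) && has (fun f => inc f (inr o) && inc f y) lfaces ==>
   (size [seq g <- lfaces | inc g (inr o) && inc g y] == 2)) lverts) [:: None; Some t0; Some t1; Some t2].
  by vm_compute.
move=> /allP/(_ o); rewrite !inE => H; have {}H := H (ltac:(by case: (o) => [[]|])).
move/allP: H => /(_ y (mem_lverts y)); rewrite xy.
have -> : has (fun f => inc f (inr o) && inc f y) lfaces.
  by apply/hasP; exists f; rewrite ?mem_lfaces ?fx.
move=> /eqP <-; rewrite -(card_uniqP _); last exact: filter_uniq.
by apply: eq_card => g; rewrite !inE mem_filter mem_lfaces andbT.
Qed.

(** * Edges of the hatted surface *)

Section HattedEdges.
Variables (V0 I C : finType) (corner : I + C -> tri -> V0).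
Hypothesis corner_inj : forall r, injective (corner r).
Hypothesis cap_inj : forall c c',
  (forall k, exists l, corner (inr c) k = corner (inr c') l) -> c = c'.

Notation hvert := (hvert V0 I).
Notation hface := (hface corner).
Notation hfaces := (hfaces corner).
Notation base_edges := (base_edges corner).

Definition cset r := [set corner r k | k : tri].

Hypothesis coarse_two : forall r u v, u != v -> u \in cset r -> v \in cset r ->
  #|[set r' | (u \in cset r') && (v \in cset r')]| = 2.

Lemma csetP r u : reflect (exists k, u = corner r k) (u \in cset r).
Proof. by apply: (iffP imsetP) => [[k _ ->]|[k ->]]; exists k. Qed.

Lemma in_cap c u : (inl u \in hface (inr c)) = (u \in cset (inr c)).
Proof.
apply/imsetP/csetP => [[k _ [->]]|[k ->]]; by exists k.
Qed.

Lemma base_hat i f u : inl u \in hface (inl (i, f)) -> exists2 k, u = corner (inl i) k & inc f (inl k).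
Proof. by case/hatP=> -[k|o] // fk [->]; exists k. Qed.

Lemma card_faces_containing (e : {set hvert}) :
  #|[set f in hfaces | e \subset f]| = #|[set r | e \subset hface r]|.
Proof.
rewrite -(card_imset (f := hface)); last exact: hface_inj.
apply: eq_card => f; rewrite inE; apply/andP/imsetP => [[/hfacesP[r ->] er]|[r]].
  by exists r; rewrite ?inE.
by rewrite inE => er ->; split=> //; apply/hfacesP; exists r.
Qed.

(** An edge with an inner endpoint is settled inside its hat. Over a base triangle with a hat, a
    base edge lies in exactly one face, the brim along it, so for a base edge the faces correspond
    through [reg] to the base triangles containing it. *)
Lemma edges_two e : e \in edges hfaces -> #|[set f in hfaces | e \subset f]| = 2.
Proof.
move=> He; rewrite card_faces_containing.
have [/eqP C2 [r0 er0]] := edgesP _ _ He.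
have [u [v [uv Ee]]] := cards2P _ C2; rewrite {}Ee in He C2 er0 *.
have sub2 (A : {set hvert}) a b : ([set a; b] \subset A) = (a \in A) && (b \in A).
  by rewrite subUset !sub1set.
have inner j o w : inr (j, o) != w -> [set inr (j, o); w] \subset hface r0 ->
    #|[set r | [set inr (j, o); w] \subset hface r]| = 2.
  rewrite sub2 => jow /andP[H1 H2].
  case: r0 H1 H2 {er0} => [[i f]|c]; last by rewrite inner_cap.
  rewrite inner_hat => /andP[/eqP ji fo]; subst i => /hatP[y fy Ew].
  have oy : inr o != y.
    by apply: contra jow => /eqP E; rewrite Ew -E.
  rewrite -(inner_edge_two erefl oy fo fy) -(card_imset (f := fun g => inl (j, g) : I * lface + C)).
    apply: eq_card => r; rewrite inE sub2; apply/andP/imsetP => [[]|[g]].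
      case: r => [[i g]|c]; last by rewrite inner_cap.
      rewrite inner_hat => /andP[/eqP ji go]; subst i; rewrite Ew in_hat // => gy.
      by exists g; rewrite ?inE ?go.
    rewrite inE => /andP[go gy] ->.
    by rewrite inner_hat eqxx go Ew in_hat.
  by move=> f' g' [].
case: u uv He C2 er0 => [u|[j o]] uv He C2 er0; last exact: inner.
case: v uv He C2 er0 => [v|[j o]] uv He C2 er0; last first.
  by rewrite setUC; apply: inner; rewrite 1?eq_sym // setUC.
have {}uv : u != v by apply: contra uv => /eqP->.
pose reg (r : I * lface + C) : I + C := match r with inl (i, _) => inl i | inr c => inr c end.
have regP r : [set inl u; inl v] \subset hface r -> (u \in cset (reg r)) && (v \in cset (reg r)).
  rewrite sub2; case: r => [[i f]|c] /=; last by rewrite !in_cap.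
  by move=> /andP[/base_hat[k -> _] /base_hat[l -> _]]; apply/andP; split; apply/csetP; [exists k|exists l].
have /andP[ur vr] := regP _ er0.
rewrite -(coarse_two uv ur vr).
pose opp (k l : tri) : tri := if (t0 != k) && (t0 != l) then t0 else if (t1 != k) && (t1 != l) then t1 else t2.
have oppP k l : k != l -> [&& opp k l != k, opp k l != l & true] by case: k l => [] [].
rewrite -(card_in_imset (f := reg)); last first.
  move=> r r'; rewrite !inE !sub2.
  case: r => [[i f]|c]; case: r' => [[i' f']|c'] //=; last by rewrite !in_cap => _ _ [->].
  move=> /andP[/base_hat[k Eu fk] /base_hat[l Ev fl]] /andP[/base_hat[k' Eu' fk'] /base_hat[l' Ev' fl']] [ii].
  subst i'; congr (inl (_, _)).
  have kk : k = k' by apply: (@corner_inj (inl i)); rewrite -Eu.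
  have ll : l = l' by apply: (@corner_inj (inl i)); rewrite -Ev.
  subst k' l'; have {uv Eu Ev Eu' Ev'} kl : k != l by apply: contra uv => /eqP kl; rewrite Eu Ev kl.
  by move: kl fk fl fk' fl'; case: f f' k l => [[] []] [[] []] [] [].
apply: eq_card => r; rewrite inE; apply/imsetP/andP => [[r']|[]].
  by rewrite inE => /regP/andP[? ?] ->.
case: r => [i|c] Hu Hv; last by exists (inr c); rewrite ?inE // sub2 !in_cap Hu.
case/csetP: (Hu) => k Ek; case/csetP: (Hv) => l El.
have kl : k != l by apply: contra uv => /eqP kl; rewrite Ek El kl.
have /and3P[ok ol _] := oppP k l kl.
exists (inl (i, (Brim, opp k l))) => //; rewrite inE sub2; apply/andP; split; apply/hatP.
- by exists (inl k); [rewrite /inc /= eq_sym|rewrite Ek].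
- by exists (inl l); [rewrite /inc /= eq_sym|rewrite El].
Qed.

(** Double counting of incidences: each base edge lies in two faces, each of the three brims of a
    hat has at most one base edge, its other faces have none, and a cap has at most three. *)
Lemma card_base_edges : 2 * #|base_edges| <= 3 * (#|I| + #|C|).
Proof.
pose B (f : {set hvert}) := [set v in f | if v is inl _ then true else false].
have E2 : \sum_(e in base_edges) #|[set r | e \subset hface r]| = \sum_(e in base_edges) 2.
  apply: eq_bigr => e; rewrite inE => /andP[He _].
  by rewrite -card_faces_containing edges_two.
rewrite mulnC -sum_nat_const -E2.
under eq_bigr => e _ do rewrite -sum1dep_card big_mkcond /=.
rewrite exchange_big /=.
have bnd r : \sum_(e in base_edges) (if e \subset hface r then 1 else 0) <= 'C(#|B (hface r)|, 2).
  rewrite -big_mkcondr /= sum1dep_card -cards_draws; apply: subset_leq_card.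
  apply/subsetP => e; rewrite !inE => /andP[/andP[/andP[He _] /forallP nb] er].
  rewrite He andbT; apply/subsetP => v ve; rewrite inE (subsetP er) //=.
  by case: v ve => [//|jo] ve; case/negP: (nb jo).
apply: (@leq_trans (\sum_(r : I * lface + C) 'C(#|B (hface r)|, 2))).
  by apply: leq_sum => r _; exact: bnd.
rewrite big_sumType /= (eq_bigr (fun r : I * lface => (r.2.1 == Brim) : nat)); last first.
  move=> [i f] _ /=; set n := #|_|.
  have -> : n = #|[set k | inc f (inl k)]|.
    rewrite /n -(card_imset (f := fun k => inl (corner (inl i) k) : hvert)); last first.
      by move=> k l [] /corner_inj.
    apply: eq_card => v; rewrite !inE; apply/andP/imsetP => [[/hatP[x fx ->]]|[k]].
      by case: x fx => [k fk _|//]; exists k; rewrite ?inE.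
    by rewrite inE => fk ->; split=> //; apply/hatP; exists (inl k).
  rewrite (eq_card (B := mem [seq k <- [:: t0; t1; t2] | inc f (inl k)])); last first.
    by move=> k; rewrite !inE mem_filter andbC; case: k; rewrite /= ?orbT.
  by rewrite (card_uniqP _) ?filter_uniq //; case: (f) => [[] []].
rewrite mulnDr; apply: leq_add.
  rewrite -(pair_big predT predT (fun (i : I) (f : lface) => (f.1 == Brim) : nat)) /=.
  rewrite (eq_bigr (fun=> 3)) ?sum_nat_const 1?mulnC // => i _.
  rewrite -(pair_big predT predT (fun (a : kind) (k : tri) => (a == Brim) : nat)) /=.
  rewrite (bigD1 Brim) //= [X in _ + X]big1 => [|a Ha]; last by rewrite (negbTE Ha) sum_nat_const muln0.
  rewrite addn0 sum_nat_const muln1.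
  by rewrite (eq_card (B := mem [:: t0; t1; t2])) ?(card_uniqP _) // => -[].
rewrite mulnC -sum_nat_const; apply: leq_sum => c _.
have H : #|B (hface (inr c))| <= 3.
  have <- : #|hface (inr c)| = 3 := card_hface corner_inj (inr c); apply: subset_leq_card.
  by apply/subsetP => v; rewrite inE => /andP[].
exact: (leq_bin2l 2 H).
Qed.
End HattedEdges.

Local Open Scope ring_scope.

(** * Flattened hats *)

Lemma big_tri (M : nmodType) (g : tri -> M) : \sum_k g k = g t0 + g t1 + g t2.
Proof.
rewrite (perm_big [:: t0; t1; t2]) /=; first by rewrite !big_cons big_nil addr0 addrA.
by apply: uniq_perm; rewrite ?index_enum_uniq // => -[]; rewrite mem_index_enum.
Qed.

Lemma big_lvert (M : nmodType) (g : lvert -> M) : \sum_x g x =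
  g (Cor t0) + g (Cor t1) + g (Cor t2) + g (Inn t0) + g (Inn t1) + g (Inn t2) + g Apex.
Proof.
rewrite (perm_big lverts) /=; first by rewrite !big_cons big_nil addr0 !addrA.
by apply: uniq_perm; rewrite ?index_enum_uniq // => v; rewrite mem_index_enum mem_lverts.
Qed.

Section LocalBary.
Variable R : realType.

(** The flattened inner vertices must span a triangle of side 34/145. This fixes the coordinates:
    they sum to 1 and differ by [39/100 - 11/50 = 17/100], and 17/100 of the base side 40/29 is
    34/145. *)
Definition beta (o : option tri) (k : tri) : R :=
  match o with Some l => if k == l then 11 / 50 else 39 / 100 | None => 1 / 3 end.
Definition lbary (x : lvert) (k : tri) : R :=
  match x with inl l => (l == k)%:R | inr o => beta o k end.

Lemma beta_gt0 o k : 0 < beta o k.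
Proof. by case: o => [l|]; rewrite /beta; [case: ifP => _|]; lra. Qed.

Lemma sum_beta o : \sum_k beta o k = 1.
Proof. by rewrite big_tri; case: o => [[]|]; rewrite /beta /=; field. Qed.

Lemma sum_lbary x : \sum_k lbary x k = 1.
Proof. by case: x => [[]|o]; rewrite ?sum_beta // big_tri /= ?addr0 ?add0r. Qed.

Lemma lbary_ge0 x k : 0 <= lbary x k.
Proof. by case: x => [l|o] /=; rewrite ?ler0n // ltW ?beta_gt0. Qed.

(* The nine triangles form the upper hull of the seven vertices lifted to the
   heights [lift]; [support f] is the plane carrying the face [f]. *)
Let lift (x : lvert) : R := match x with inl _ => 0 | inr (Some _) => 1 | inr None => 21 / 20 end.
Let support (f : lface) (k : tri) : R :=
  match f.1 with
  | Brim => if k == f.2 then 50 / 11 else 0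
  | Skirt => if k == f.2 then 0 else 100 / 61
  | Spike => if k == f.2 then 471 / 1020 else 457 / 340
  end.
Let gap f x : R := \sum_k lbary x k * support f k - lift x.

Lemma gap_sign f x : if inc f x then gap f x = 0 else 0 < gap f x.
Proof.
rewrite /gap big_tri; case: f x => [[] []] [[]|[[]|]];
  rewrite /support /lift /lbary /beta /inc /=; solve [lra | field].
Qed.

(** The difference between the sums of [w * gap h] and [w' * gap h] does not depend on [h]. It is at
    most 0 for [h = f] and at least 0 for [h = g], hence 0, so [w'] vanishes off [f] too. On a
    single triangle the coordinates determine the weights. *)
Lemma local_unique f g (w w' : lvert -> R) :
  (forall x, 0 <= w x) -> (forall x, 0 <= w' x) ->
  (forall x, ~~ inc f x -> w x = 0) -> (forall x, ~~ inc g x -> w' x = 0) ->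
  (forall k, \sum_x w x * lbary x k = \sum_x w' x * lbary x k) -> w =1 w'.
Proof.
move=> w0 w'0 wf w'g E.
have swap (u : lvert -> R) h : \sum_x u x * gap h x =
    \sum_k (\sum_x u x * lbary x k) * support h k - \sum_x u x * lift x.
  under eq_bigr do rewrite mulrBr mulr_sumr.
  rewrite sumrB; congr (_ - _); rewrite exchange_big /=; apply: eq_bigr => k _.
  by rewrite mulr_suml; apply: eq_bigr => x _; rewrite mulrA.
have z (u : lvert -> R) h : (forall x, ~~ inc h x -> u x = 0) -> \sum_x u x * gap h x = 0.
  move=> uh; rewrite big1 // => x _; have := gap_sign h x; case: ifP => [_ ->|/negbT/uh-> _].
    by rewrite mulr0.
  by rewrite mul0r.
have ge h (u : lvert -> R) : (forall x, 0 <= u x) -> forall x, 0 <= u x * gap h x.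
  by move=> u0 x; have := gap_sign h x; case: ifP => [_ ->|_ /ltW g0]; rewrite ?mulr0 // mulr_ge0.
have Ew (h : lface) : \sum_x w x * gap h x - \sum_x w' x * gap h x = \sum_x w' x * lift x - \sum_x w x * lift x.
  by rewrite !swap (eq_bigr _ (fun k _ => congr1 ( *%R^~ _) (E k))); ring.
have w'f x : ~~ inc f x -> w' x = 0.
  have S0 : \sum_x w' x * gap f x = 0.
    have /eqP := Ew f; rewrite (z _ _ wf) => /eqP E1.
    have E2 := Ew g; rewrite (z _ _ w'g) in E2.
    have P1 : 0 <= \sum_x w' x * gap f x by apply: sumr_ge0 => y _; apply: ge.
    have P2 : 0 <= \sum_x w x * gap g x by apply: sumr_ge0 => y _; apply: ge.
    lra.
  move=> nfx; move/eqP: S0; rewrite psumr_eq0 => [/allP/(_ x (mem_index_enum x))|y _]; last exact: ge.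
  rewrite mulf_eq0 => /orP[/eqP//|]; have := gap_sign f x; rewrite (negbTE nfx) => g0.
  by rewrite gt_eqF.
pose d x := w x - w' x.
have df x : ~~ inc f x -> d x = 0 by move=> nf; rewrite /d wf // w'f // subrr.
have dE k : \sum_x d x * lbary x k = 0.
  under eq_bigr do rewrite mulrBl.
  by rewrite sumrB E subrr.
suff d0 x : d x = 0 by move=> x; apply/eqP; rewrite -subr_eq0 -/(d x) d0.
have := (dE t0, dE t1, dE t2); rewrite !big_lvert /lbary /beta /=.
move: (df (Cor t0)) (df (Cor t1)) (df (Cor t2)) (df (Inn t0)) (df (Inn t1)) (df (Inn t2)) (df Apex).
have XP : [\/ x = Cor t0, x = Cor t1, x = Cor t2 | [\/ x = Inn t0, x = Inn t1, x = Inn t2 | x = Apex]].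
  by case: (x) => [[]|[[]|]]; by [constructor 1|constructor 2|constructor 3|constructor 4; constructor 1|
     constructor 4; constructor 2|constructor 4; constructor 3|constructor 4; constructor 4].
move: XP.
set a := d (Cor t0); set b := d (Cor t1); set c := d (Cor t2).
set a' := d (Inn t0); set b' := d (Inn t1); set c' := d (Inn t2); set e := d Apex.
have dx : [\/ d x = a, d x = b, d x = c | [\/ d x = a', d x = b', d x = c' | d x = e]] -> 
   (a = 0 /\ b = 0 /\ c = 0) /\ (a' = 0 /\ b' = 0 /\ c' = 0) /\ e = 0 -> d x = 0.
  by move=> H [[? [? ?]] [[? [? ?]] ?]]; case: H => [->|->|->|[->|->|->|->]].
move=> XP H1 H2 H3 H4 H5 H6 H7 [[F1 F2] F3]; apply: dx.
  by case: XP => [->|->|->|[->|->|->|->]]; by [constructor 1|constructor 2|constructor 3|constructor 4; constructor 1|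
     constructor 4; constructor 2|constructor 4; constructor 3|constructor 4; constructor 4].
move: H1 H2 H3 H4 H5 H6 H7 F1 F2 F3; clear.
case: f => [[] []] /= H1 H2 H3 H4 H5 H6 H7 F1 F2 F3;
  rewrite ?(H1 isT) ?(H2 isT) ?(H3 isT) ?(H4 isT) ?(H5 isT) ?(H6 isT) ?(H7 isT) in F1 F2 F3 *;
  repeat split=> //; lra.
Qed.
End LocalBary.

Section Flat.
Variables (R : realType) (V0 I C : finType) (corner : I + C -> tri -> V0).
Hypothesis corner_inj : forall r, injective (corner r).
Variable pos0 : V0 -> 'rV[R]_3.

Notation hvert := (hvert V0 I).
Notation hface := (hface corner).
Notation glob := (glob corner).
Notation cset := (cset corner).

Definition flat (v : hvert) : 'rV[R]_3 :=
  match v with inl u => pos0 u | inr (i, o) => \sum_k beta R o k *: pos0 (corner (inl i) k) end.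

Definition bary (v : hvert) (u : V0) : R :=
  match v with inl u' => (u' == u)%:R | inr (i, o) => \sum_k beta R o k * (corner (inl i) k == u)%:R end.

Definition weights (V : finType) (S : {set V}) (w : V -> R) :=
  [/\ forall v, 0 <= w v, forall v, v \notin S -> w v = 0 & \sum_v w v = 1].

Hypothesis coarse_unique : forall r r' (w w' : V0 -> R), weights (cset r) w -> weights (cset r') w' ->
  \sum_u w u *: pos0 u = \sum_u w' u *: pos0 u -> w =1 w'.

Lemma sum_glob (M : nmodType) i (g : hvert -> M) : (forall v, (forall x, v != glob i x) -> g v = 0) ->
  \sum_v g v = \sum_x g (glob i x).
Proof.
move=> g0; rewrite (bigID (mem [set glob i x | x : lvert])) /= [X in _ + X]big1 ?addr0; last first.
  move=> v nv; apply: g0 => x; apply: contra nv => /eqP->.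
  exact: imset_f.
by rewrite big_imset //= => x y _ _ /(glob_inj corner_inj).
Qed.

Lemma bary_flat v : flat v = \sum_u bary v u *: pos0 u.
Proof.
case: v => [u'|[i o]] /=.
  rewrite (bigD1 u') //= eqxx scale1r big1 ?addr0 // => u.
  by rewrite eq_sym => /negbTE->; rewrite scale0r.
under [RHS]eq_bigr do rewrite scaler_suml.
rewrite exchange_big /=; apply: eq_bigr => k _.
rewrite (bigD1 (corner (inl i) k)) //= eqxx mulr1 big1 ?addr0 // => u.
by rewrite eq_sym => /negbTE->; rewrite mulr0 scale0r.
Qed.

Lemma bary_ge0 v u : 0 <= bary v u.
Proof.
case: v => [u'|[i o]] /=; rewrite ?ler0n // sumr_ge0 // => k _.
by rewrite mulr_ge0 ?ler0n // ltW ?beta_gt0.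
Qed.

Lemma sum_bary v : \sum_u bary v u = 1.
Proof.
case: v => [u'|[i o]] /=.
  by rewrite (bigD1 u') //= eqxx big1 ?addr0 // => u; rewrite eq_sym => /negbTE->.
rewrite exchange_big /= -[RHS](sum_beta R o); apply: eq_bigr => k _.
rewrite (bigD1 (corner (inl i) k)) //= eqxx mulr1 big1 ?addr0 // => u.
by rewrite eq_sym => /negbTE->; rewrite mulr0.
Qed.

Lemma bary_glob i x k : bary (glob i x) (corner (inl i) k) = lbary R x k.
Proof.
case: x => [l|o] /=; first by rewrite (inj_eq (@corner_inj (inl i))).
rewrite (bigD1 k) //= eqxx mulr1 big1 ?addr0 // => l lk.
by rewrite (inj_eq (@corner_inj (inl i))) (negbTE lk) mulr0.
Qed.

Lemma bary_glob0 i x u : u \notin cset (inl i) -> bary (glob i x) u = 0.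
Proof.
move=> nu; have nk k : corner (inl i) k == u = false.
  by apply: contraNF nu => /eqP<-; apply/csetP; exists k.
by case: x => [k|o] /=; rewrite ?nk // big1 // => k _; rewrite nk mulr0.
Qed.

Definition region (r : I * lface + C) : I + C := match r with inl (i, _) => inl i | inr c => inr c end.

Definition coarse (w : hvert -> R) u := \sum_v w v * bary v u.

Lemma coarse_weights r w : weights (hface r) w -> weights (cset (region r)) (coarse w).
Proof.
case=> w0 wr w1; split.
- by move=> u; apply: sumr_ge0 => v _; rewrite mulr_ge0 ?bary_ge0.
- move=> u nu; rewrite /coarse big1 // => v _.
  case vr : (v \in hface r); last by rewrite wr ?mul0r // vr.
  case: r vr nu {wr} => [[i f]|c] vr nu.
    by case/hatP: vr => x _ ->; rewrite bary_glob0 ?mulr0.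
  case: v vr => [u'|jo]; last by rewrite inner_cap.
  rewrite in_cap /= => u'c; case: eqP => [E|_]; last by rewrite mulr0.
  by rewrite E (negbTE nu) in u'c.
- rewrite exchange_big /= -[RHS]w1; apply: eq_bigr => v _.
  by rewrite -mulr_sumr sum_bary mulr1.
Qed.

Lemma coarse_sum w : \sum_v w v *: flat v = \sum_u coarse w u *: pos0 u.
Proof.
under eq_bigr do rewrite bary_flat scaler_sumr.
rewrite exchange_big /=; apply: eq_bigr => u _; rewrite scaler_suml.
by apply: eq_bigr => v _; rewrite scalerA.
Qed.

Lemma coarse_hat i f w k : weights (hface (inl (i, f))) w ->
  coarse w (corner (inl i) k) = \sum_x w (glob i x) * lbary R x k.
Proof.
case=> _ wf _; rewrite /coarse (@sum_glob _ i).
  by apply: eq_bigr => x _; rewrite bary_glob.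
move=> v nv; rewrite wf ?mul0r //; apply/negP => /hatP[x _ E].
by have := nv x; rewrite E eqxx.
Qed.

(** Inner vertices lie strictly inside their base triangle, so a positive weight on one of them
    makes the weights of all three corners positive. *)
Lemma coarse_no_inner r w u : weights (hface r) w -> u \in cset (region r) -> coarse w u = 0 ->
  forall jo, w (inr jo) = 0.
Proof.
move=> W ur cu0 [j o].
case: (W) => w0 wr _; case jr : (inr (j, o) \in hface r); last by rewrite wr ?jr.
case: r jr ur W wr => [[i f]|c] jr ur W wr; last by rewrite inner_cap in jr.
move: jr; rewrite inner_hat => /andP[/eqP ji fo]; subst j.
case/csetP: ur => k E; move: cu0; rewrite E (coarse_hat _ W) => /eqP.
rewrite psumr_eq0 => [/allP/(_ (inr o) (mem_index_enum _))|x _]; last by rewrite mulr_ge0 ?lbary_ge0.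
by rewrite mulf_eq0 /= (gt_eqF (beta_gt0 R o k)) orbF => /eqP.
Qed.

Lemma coarse_inl w u : (forall jo, w (inr jo) = 0) -> coarse w u = w (inl u).
Proof.
move=> w0; rewrite /coarse big_sumType /= [X in _ + X]big1 ?addr0 => [|jo _]; last by rewrite w0 mul0r.
rewrite (bigD1 u) //= eqxx mulr1 big1 ?addr0 // => u' /negbTE->.
by rewrite mulr0.
Qed.

Hypothesis cset_inj : forall r r', cset r \subset cset r' -> r = r'.

(** The weights on the base triangulation agree by [coarse_unique]. Within one hat [local_unique]
    recovers the full weights from them. Over different base triangles some corner weight vanishes
    on either side, so inner vertices carry no weight and the base weights are already the full
    ones. *)
Lemma flat_unique r r' w w' : weights (hface r) w -> weights (hface r') w' ->
  \sum_v w v *: flat v = \sum_v w' v *: flat v -> w =1 w'.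
Proof.
move=> W W'; rewrite !coarse_sum => E.
have {}E := coarse_unique (coarse_weights W) (coarse_weights W') E.
have no_inner q q' (x x' : hvert -> R) : weights (hface q) x -> weights (hface q') x' ->
    coarse x =1 coarse x' -> region q != region q' -> forall jo, x (inr jo) = 0.
  move=> X X' Ex qq.
  have [u uq uq'] : exists2 u, u \in cset (region q) & u \notin cset (region q').
    by apply/subsetPn; apply: contra qq => /cset_inj->.
  apply: (coarse_no_inner X uq); rewrite Ex.
  by case: (coarse_weights X') => _ ->.
case: (eqVneq (region r) (region r')) => [rr|rr]; last first.
  have w0 := no_inner _ _ _ _ W W' E rr.
  have w'0 := no_inner _ _ _ _ W' W (fsym E) (introN eqP (fun e => elimN eqP rr (esym e))).
  by case=> [u|jo]; rewrite ?w0 ?w'0 // -(coarse_inl u w0) -(coarse_inl u w'0) E.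
case: r r' rr W W' => [[i f]|c] [[i' f']|c'] //= [].
  move=> ii W W'; subst i'.
  have L : (fun x => w (glob i x)) =1 (fun x => w' (glob i x)).
    apply: (@local_unique R f f').
    - by case: W.
    - by case: W'.
    - by move=> x nx; case: W => _ -> //; rewrite in_hat.
    - by move=> x nx; case: W' => _ -> //; rewrite in_hat.
    - by move=> k; rewrite -(coarse_hat _ W) -(coarse_hat _ W') E.
  move=> v; case: (boolP (v \in [set glob i x | x : lvert])) => [/imsetP[x _ ->]|nv]; first exact: L.
  have N g : v \notin hface (inl (i, g)).
    by apply: contra nv => /hatP[x _ ->]; apply: imset_f.
  by case: W W' => _ z _ [_ z' _]; rewrite (z v (N f)) (z' v (N f')).
move=> cc W W'; subst c'.
have cap0 (x : hvert -> R) : weights (hface (inr c)) x -> forall jo, x (inr jo) = 0.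
  by case=> _ xc _ jo; rewrite xc // inner_cap.
by case=> [u|jo]; rewrite ?(cap0 _ W) ?(cap0 _ W') // -(coarse_inl u (cap0 _ W)) -(coarse_inl u (cap0 _ W')) E.
Qed.
End Flat.

(** * Affine independence of acute triangles *)

Section Acute.
Variables (R : realType) (n : nat) (V : finType) (p : V -> 'rV[R]_n).

Lemma sum_three (M : nmodType) (a b c : V) (g : V -> M) : a != b -> b != c -> a != c ->
  (forall v, v \notin [set a; b; c] -> g v = 0) -> \sum_v g v = g a + g b + g c.
Proof.
move=> ab bc ac g0; rewrite (bigD1 a) //= (bigD1 b) 1?eq_sym //= (bigD1 c) /=; last by rewrite !(eq_sym c) ac bc.
rewrite big1 ?addr0 ?addrA // => v /andP[/andP[va vb] vc].
by apply: g0; rewrite !inE (negbTE va) (negbTE vb) (negbTE vc).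
Qed.

(** As the coefficients sum to 0, the sum of the products [d u * d v] times squared distances over
    the three sides is minus the squared norm of the vanishing combination. Eliminating [d a] turns
    it into a combination of squares whose coefficients are the positive gaps in the acuteness
    inequalities. *)
Lemma acute_free (a b c : V) (d : V -> R) : a != b -> b != c -> a != c ->
  d2 (p b) (p c) < d2 (p a) (p b) + d2 (p a) (p c) ->
  d2 (p a) (p c) < d2 (p b) (p a) + d2 (p b) (p c) ->
  d2 (p a) (p b) < d2 (p c) (p a) + d2 (p c) (p b) ->
  (forall v, v \notin [set a; b; c] -> d v = 0) -> \sum_v d v = 0 -> \sum_v d v *: p v = 0 -> d =1 fun=> 0.
Proof.
move=> ab bc ac.
have d2C (x y : 'rV[R]_n) : d2 x y = d2 y x by apply: eq_bigr => i _; ring.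
rewrite (d2C (p b) (p a)) (d2C (p c) (p a)) (d2C (p c) (p b)).
set A := d2 (p a) (p b); set B := d2 (p a) (p c); set D := d2 (p b) (p c) => H1 H2 H3 d0.
rewrite (sum_three ab bc ac d0) (sum_three ab bc ac) => [|v /d0->]; last by rewrite scale0r.
move=> S P.
have Q : d a * d b * A + d a * d c * B + d b * d c * D = 0.
  have E (i : 'I_n) : d a * d b * (p a 0 i - p b 0 i) ^+ 2 + d a * d c * (p a 0 i - p c 0 i) ^+ 2 +
      d b * d c * (p b 0 i - p c 0 i) ^+ 2 = 0.
    have := congr1 (fun x : 'rV_n => x 0 i) P; rewrite !mxE => Pi.
    have -> : d a = - (d b + d c) by move: S; lra.
    have {}Pi : - (d b + d c) * p a 0 i + d b * p b 0 i + d c * p c 0 i = 0.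
      by rewrite -Pi; have -> : d a = - (d b + d c) by move: S; lra.
    transitivity (- (- (d b + d c) * p a 0 i + d b * p b 0 i + d c * p c 0 i) ^+ 2); first by ring.
    by rewrite Pi expr0n oppr0.
  rewrite /A /B /D /d2 !mulr_sumr -!big_split /=; apply: big1 => i _; exact: E.
have Q' : (A + B - D) * (d b + d c) ^+ 2 + (A + D - B) * d b ^+ 2 + (B + D - A) * d c ^+ 2 = 0.
  have Ea : d a = - (d b + d c) by move: S; lra.
  rewrite Ea in Q.
  transitivity (- 2 * (- (d b + d c) * d b * A + - (d b + d c) * d c * B + d b * d c * D)); first by ring.
  by rewrite Q mulr0.
have [db dc] : d b = 0 /\ d c = 0.
  have P1 : 0 <= (A + B - D) * (d b + d c) ^+ 2 by rewrite mulr_ge0 ?sqr_ge0 //; lra.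
  have P2 : 0 <= (A + D - B) * d b ^+ 2 by rewrite mulr_ge0 ?sqr_ge0 //; lra.
  have P3 : 0 <= (B + D - A) * d c ^+ 2 by rewrite mulr_ge0 ?sqr_ge0 //; lra.
  have Z2 : (A + D - B) * d b ^+ 2 = 0 by lra.
  have Z3 : (B + D - A) * d c ^+ 2 = 0 by lra.
  split; apply/eqP; rewrite -sqrf_eq0.
  - by move/eqP: Z2; rewrite mulf_eq0 => /orP[/eqP ?|//]; lra.
  - by move/eqP: Z3; rewrite mulf_eq0 => /orP[/eqP ?|//]; lra.
have da : d a = 0 by move: S; rewrite db dc; lra.
move=> v; case: (boolP (v \in [set a; b; c])) => [|/d0//].
by rewrite !inE => /orP[/orP[]|] /eqP->.
Qed.
End Acute.

Section AcuteIso.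
Variables (R : realType) (V : finType) (p : V -> 'rV[R]_3).

Lemma acute_isosceles_free f (d : V -> R) : acute_isosceles p f ->
  (forall v, v \notin f -> d v = 0) -> \sum_v d v = 0 -> \sum_v d v *: p v = 0 -> d =1 fun=> 0.
Proof. by case=> a [b [c [-> [ab [bc [ac [_ [H1 [H2 H3]]]]]]]]]; apply: acute_free. Qed.

Lemma acute_isosceles_nondegenerate f v : acute_isosceles p f -> v \in f -> ~ aff_hull p (f :\ v) (p v).
Proof.
move=> Hf vf [w [wf [w1 E]]].
have wv : w v = 0 by apply: wf; rewrite !inE eqxx.
have H : (fun u => w u - (u == v)%:R) =1 fun=> 0.
  apply: (acute_isosceles_free Hf).
  - move=> u uf; rewrite wf ?inE ?(negbTE uf) ?andbF // sub0r.
    by case: eqP uf => [->|_ _]; rewrite ?vf // oppr0.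
  - by rewrite sumrB w1 (bigD1 v) //= eqxx big1 ?addr0 ?subrr // => u /negbTE->.
  - under eq_bigr do rewrite scalerBl.
    rewrite sumrB -E [X in _ - X](bigD1 v) //= eqxx scale1r big1 ?addr0 ?subrr // => u /negbTE->.
    by rewrite scale0r.
by have /eqP := H v; rewrite /= wv eqxx sub0r oppr_eq0 oner_eq0.
Qed.
End AcuteIso.

Lemma iso_triple f : exists x y z, [/\ okverts f x y z, forall v, inc f v -> v \in [:: x; y; z],
  lenk x y = LLeg, lenk x z = LLeg & lenk y z <> LLeg].
Proof.
case: f => [[] []].
- by exists (Inn t0), (Cor t1), (Cor t2); split=> //; case=> [[]|[[]|]].
- by exists (Inn t1), (Cor t0), (Cor t2); split=> //; case=> [[]|[[]|]].
- by exists (Inn t2), (Cor t0), (Cor t1); split=> //; case=> [[]|[[]|]].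
- by exists (Cor t0), (Inn t1), (Inn t2); split=> //; case=> [[]|[[]|]].
- by exists (Cor t1), (Inn t0), (Inn t2); split=> //; case=> [[]|[[]|]].
- by exists (Cor t2), (Inn t0), (Inn t1); split=> //; case=> [[]|[[]|]].
- by exists Apex, (Inn t1), (Inn t2); split=> //; case=> [[]|[[]|]].
- by exists Apex, (Inn t0), (Inn t2); split=> //; case=> [[]|[[]|]].
- by exists Apex, (Inn t0), (Inn t1); split=> //; case=> [[]|[[]|]].
Qed.

(** * The hatted surface as a polyhedron *)

Section Polyhedron.
Variables (R : realType) (V0 I C : finType) (corner : I + C -> tri -> V0).
Hypothesis corner_inj : forall r, injective (corner r).
Hypothesis cset_inj : forall r r', cset corner r \subset cset corner r' -> r = r'.
Variables (pos0 : V0 -> 'rV[R]_3) (pos : hvert V0 I -> 'rV[R]_3) (proj : 'rV[R]_3 -> 'rV[R]_3).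

Notation hvert := (hvert V0 I).
Notation hface := (hface corner).
Notation hfaces := (hfaces corner).
Notation glob := (glob corner).
Notation cset := (cset corner).
Notation flat := (flat corner pos0).

Hypothesis coarse_unique : forall r r' (w w' : V0 -> R), weights (cset r) w -> weights (cset r') w' ->
  \sum_u w u *: pos0 u = \sum_u w' u *: pos0 u -> w =1 w'.
Hypothesis coarse_two : forall r u v, u != v -> u \in cset r -> v \in cset r ->
  #|[set r' | (u \in cset r') && (v \in cset r')]| = 2.
Hypothesis coarse_cover : forall u, exists r, u \in cset r.
Hypothesis proj_flat : forall r w, weights (hface r) w -> proj (\sum_v w v *: pos v) = \sum_v w v *: flat v.
Hypothesis hat_dist : forall i x y f, inc f x -> inc f y -> x != y ->
  d2 (pos (glob i x)) (pos (glob i y)) = lenR R (lenk x y) ^+ 2.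
Hypothesis cap_acute : forall c, acute_isosceles pos (hface (inr c)).

Lemma cap_inj c c' : (forall k, exists l, corner (inr c) k = corner (inr c') l) -> c = c'.
Proof.
move=> H; suff [] : inr c = inr c' :> I + C by [].
by apply: cset_inj; apply/subsetP => u /csetP[k ->]; have [l ->] := H k; apply/csetP; exists l.
Qed.

Lemma proj_unique r r' w w' : weights (hface r) w -> weights (hface r') w' ->
  proj (\sum_v w v *: pos v) = proj (\sum_v w' v *: pos v) -> w =1 w'.
Proof.
by move=> W W'; rewrite (proj_flat W) (proj_flat W') => /(flat_unique corner_inj coarse_unique cset_inj W W').
Qed.

Lemma hfaces_acute f : f \in hfaces -> acute_isosceles pos f.
Proof.
move=> /hfacesP[[[i g]|c] ->]; last exact: cap_acute.
have [x [y [z [/and5P[xy yz xz gx /andP[gy gz]] gE Lxy Lxz Lyz]]]] := iso_triple g.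
have d2C (u v : 'rV[R]_3) : d2 u v = d2 v u by apply: eq_bigr => k _; ring.
have Dxy := hat_dist i gx gy xy; have Dxz := hat_dist i gx gz xz; have Dyz := hat_dist i gy gz yz.
exists (glob i x), (glob i y), (glob i z).
rewrite !(inj_eq (glob_inj corner_inj (i := i))); split; last first.
  do 3 split=> //; rewrite !(d2C (pos (glob i y)) (pos (glob i x))) !(d2C (pos (glob i z))) Dxy Dxz Dyz Lxy Lxz.
  by case: (lenk y z) Lyz => // _; rewrite /lenR /sl; split; lra.
apply/setP => v; apply/hatP/idP => [[t gt ->]|].
  by have := gE t gt; rewrite !inE !(inj_eq (glob_inj corner_inj (i := i))) orbA.
by rewrite !inE => /orP[/orP[]|] /eqP->; eexists; try reflexivity.
Qed.

Lemma every_vertex_in_face v : exists r, v \in hface r.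
Proof.
case: v => [u|[i o]].
  have [[i|c] ur] := coarse_cover u; last by exists (inr c); rewrite in_cap.
  case/csetP: ur => k ->; exists (inl (i, (Skirt, k))).
  by apply/hatP; exists (inl k); rewrite // /inc /= eqxx.
have [f fo] : exists f, inc f (inr o).
  by case: o => [k|]; [exists (Brim, k); rewrite /inc /= eqxx|exists (Spike, t0)].
by exists (inl (i, f)); rewrite inner_hat eqxx.
Qed.

Lemma weights1 r v : v \in hface r -> weights (hface r) (fun u => (u == v)%:R : R).
Proof.
move=> vr; split=> [u|u|]; first exact: ler0n.
  by case: eqP => // ->; rewrite vr.
by rewrite (bigD1 v) //= eqxx big1 ?addr0 // => u /negbTE->.
Qed.

Lemma sum_indicator (p : hvert -> 'rV[R]_3) v : \sum_u (u == v)%:R *: p u = p v.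
Proof.
by rewrite (bigD1 v) //= eqxx scale1r big1 ?addr0 // => u /negbTE->; rewrite scale0r.
Qed.

Lemma pos_inj : injective pos.
Proof.
move=> u v E.
have [r ur] := every_vertex_in_face u; have [r' vr'] := every_vertex_in_face v.
have := proj_unique (weights1 ur) (weights1 vr').
rewrite !sum_indicator E => /(_ erefl)/(_ u)/eqP; rewrite eqxx; case: (u =P v) => // _.
by rewrite oner_eq0.
Qed.

Lemma hullE (S : {set hvert}) x : hull pos S x <-> exists2 w, weights S w & x = \sum_v w v *: pos v.
Proof.
split=> [[w [w0 [wS [w1 ->]]]]|[w [w0 wS w1] ->]]; first by exists w.
by exists w.
Qed.

Lemma hull_inter f g : f \in hfaces -> g \in hfaces ->
  classical_sets.setI (hull pos f) (hull pos g) = hull pos (f :&: g).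
Proof.
move=> /hfacesP[r ->] /hfacesP[r' ->]; apply: boolp.funext => x; apply: boolp.propext; split.
  move=> [/hullE[w W ->] /hullE[w' W' E]]; apply/hullE; exists w => //.
  have ww := proj_unique W W' (congr1 proj E).
  case: W W' => w0 wr w1 [_ w'r' _]; split=> // v.
  by rewrite inE negb_and => /orP[/wr//|/w'r']; rewrite -ww.
have sub (S T : {set hvert}) : S \subset T -> hull pos S x -> hull pos T x.
  move=> ST /hullE[w [w0 wS w1] ->]; apply/hullE; exists w => //; split=> // v vT.
  by apply: wS; apply: contra vT; apply: (subsetP ST).
by move=> H; split; apply: sub H; rewrite ?subsetIl ?subsetIr.
Qed.

Hypothesis noncoplanar : forall f g, f \in hfaces -> g \in hfaces -> #|f :&: g| = 2 ->
  forall v, v \in g :\: f -> ~ aff_hull pos f (pos v).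

Lemma hatted_polyhedron : triangulated_polyhedron pos hfaces.
Proof.
split; first exact: pos_inj.
split; first by move=> _ /hfacesP[r ->]; apply: card_hface.
split.
  by move=> v; have [r vr] := every_vertex_in_face v; exists (hface r) => //; apply/hfacesP; exists r.
split; first by move=> f fF v; apply: acute_isosceles_nondegenerate; apply: hfaces_acute.
split; first by move=> e; apply: (edges_two corner_inj cap_inj coarse_two).
split; last exact: noncoplanar.
by move=> f g fF gF _; apply: hull_inter.
Qed.
End Polyhedron.

Local Close Scope ring_scope.

(** * Three-connectedness of the hatted graph *)

Section Connected.
Variables (V0 I C : finType) (corner : I + C -> tri -> V0).
Hypothesis corner_inj : forall r, injective (corner r).

Notation hvert := (hvert V0 I).
Notation hface := (hface corner).
Notation hfaces := (hfaces corner).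
Notation glob := (glob corner).
Notation cset := (cset corner).

Definition coarse_adj (u v : V0) := (u != v) && [exists r, (u \in cset r) && (v \in cset r)].

Hypothesis card_coarse : 4 <= #|V0|.
Hypothesis coarse_connected : forall S : {set V0}, #|S| <= 2 -> forall u v, u \notin S -> v \notin S ->
  connect [rel x y | [&& x \notin S, y \notin S & coarse_adj x y]] u v.

Lemma adjv_face r u v : u \in hface r -> v \in hface r -> u != v -> adjv hfaces u v.
Proof.
move=> ur vr uv; rewrite /adjv uv; apply/edgesP; split; first by rewrite cards2 uv.
by exists r; apply/subsetP => w /set2P[]->.
Qed.

Lemma coarse_adj_adjv u v : coarse_adj u v -> adjv hfaces (inl u) (inl v).
Proof.
case/andP=> uv /existsP[r /andP[ur vr]].
have inl_neq : inl u != inl v :> hvert by apply: contra uv => /eqP[->].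
case: r ur vr => [i|c] ur vr; last first.
  by apply: (@adjv_face (inr c)); rewrite ?in_cap.
case/csetP: ur uv inl_neq => k ->; case/csetP: vr => l -> kl' inl_neq.
have kl : k != l by apply: contra kl' => /eqP->.
have [m /andP[mk ml]] : exists m, (k != m) && (l != m).
  by case: k l kl {kl' inl_neq} => [] [] // _; solve [by exists t0|by exists t1|by exists t2].
by apply: (@adjv_face (inl (i, (Brim, m)))) => //; apply/hatP; [exists (inl k)|exists (inl l)].
Qed.

(** Deleting two vertices leaves the base graph connected, so it suffices to lead every remaining
    inner vertex to a remaining base vertex. *)
Lemma three_connected_hats : three_connected hfaces.
Proof.
split.
  apply: leq_trans card_coarse _; rewrite -(card_imset predT (inl_inj : injective (inl : V0 -> hvert))).
  exact: max_card.
move=> S S2.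
set e := (X in connect X); pose S0 := [set u | inl u \in S].
have e_sym : connect_sym e.
  apply: sym_connect_sym => x y; rewrite /e /= /adjv setUC eq_sym.
  by case: (x \notin S); case: (y \notin S).
have S02 : #|S0| <= 2.
  rewrite -(card_imset _ (inl_inj : injective (inl : V0 -> hvert))).
  apply: leq_trans S2; apply: subset_leq_card; apply/subsetP => _ /imsetP[u uS ->].
  by rewrite inE in uS.
have coarse u v : inl u \notin S -> inl v \notin S -> connect e (inl u) (inl v).
  move=> uS vS; have := @coarse_connected S0 S02 u v; rewrite !inE => /(_ uS vS)/connectP[p].
  elim/last_ind: p v {vS} => [|p w IH] v /=; first by move=> _ ->; rewrite connect0.
  rewrite rcons_path last_rcons => /andP[/IH/(_ erefl) up /and3P[]]; rewrite !inE => aS bS ab ->.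
  apply: connect_trans up (connect1 _).
  by rewrite /e /= aS bS coarse_adj_adjv.
have step i f x y : inc f x -> inc f y -> x != y -> glob i x \notin S -> glob i y \notin S ->
    connect e (glob i x) (glob i y).
  move=> fx fy xy xS yS; apply: connect1; rewrite /e /= xS yS.
  by apply: (@adjv_face (inl (i, f))); rewrite ?in_hat // (inj_eq (glob_inj corner_inj (i := i))).
have three a b c : a != b -> b != c -> a != c -> a \in S -> b \in S -> c \in S -> False.
  move=> ab bc ac aS bS cS.
  suff : 2 < #|S| by rewrite ltnNge S2.
  have <- : #|[set a; b; c]| = 3.
    by rewrite -setUA cardsU1 cards2 !inE negb_or ab ac bc.
  by apply: subset_leq_card; apply/subsetP => t; rewrite !inE => /orP[/orP[]|] /eqP->.
have gneq i x y : x != y -> glob i x != glob i y by rewrite (inj_eq (glob_inj corner_inj (i := i))).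
have inner i k : glob i (Inn k) \notin S -> exists u, (inl u \notin S) && connect e (glob i (Inn k)) (inl u).
  move=> kS.
  case A : (glob i (Cor (nxt k)) \in S); last first.
    exists (corner (inl i) (nxt k)); apply/andP; split; first by rewrite -[inl _]/(glob i (Cor _)) A.
    by apply: (step i (Brim, k) (Inn k) (Cor (nxt k))); rewrite ?A //; case: (k).
  case B : (glob i (Cor (nxt (nxt k))) \in S); last first.
    exists (corner (inl i) (nxt (nxt k))); apply/andP; split; first by rewrite -[inl _]/(glob i (Cor _)) B.
    by apply: (step i (Brim, k) (Inn k) (Cor (nxt (nxt k)))); rewrite ?B //; case: (k).
  (* The deletion of both corners next to [Inn k] exhausts [S], so the detour over [Inn (nxt k)] to
     [Cor k] is free. *)
  have D x : x != Cor (nxt k) -> x != Cor (nxt (nxt k)) -> glob i x \notin S.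
    move=> xa xb; apply/negP => xS; apply: (three (glob i x) _ _ _ _ _ xS A B); rewrite gneq //.
    by case: (k).
  exists (corner (inl i) k); apply/andP; split; first by apply: (D (Cor k)); case: (k).
  apply: (@connect_trans _ _ (glob i (Inn (nxt k)))).
    apply: (step i (Spike, nxt (nxt k)) (Inn k) (Inn (nxt k))) => //; try by case: (k).
    by apply: D; case: (k).
  by apply: (step i (Brim, nxt k) (Inn (nxt k)) (Cor k)); try (by apply: D; case: (k)); by case: (k).
have to_coarse v : v \notin S -> exists u, (inl u \notin S) && connect e v (inl u).
  case: v => [u|[i [k|]]] vS; [by exists u; rewrite vS connect0|exact: inner|].
  have [k kS] : exists k, glob i (Inn k) \notin S.
    case A : (glob i (Inn t0) \in S); last by exists t0; rewrite A.
    case B : (glob i (Inn t1) \in S); last by exists t1; rewrite B.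
    case D : (glob i (Inn t2) \in S); last by exists t2; rewrite D.
    by exfalso; apply: (three _ _ _ _ _ _ A B D); apply: gneq.
  have [u /andP[uS ku]] := inner _ _ kS.
  exists u; rewrite uS; apply: connect_trans ku.
  by apply: (step i (Spike, nxt k) Apex (Inn k)) => //; case: (k).
move=> u v uS vS.
have [a /andP[aS ua]] := to_coarse u uS; have [b /andP[bS vb]] := to_coarse v vS.
by apply: connect_trans ua (connect_trans (coarse _ _ aS bS) _); rewrite e_sym.
Qed.
End Connected.

(** * The tube *)

Section Tube.
Variable K : nat.
Hypothesis K_gt1 : 1 < K.

Definition tvert := (bool * 'I_K.+2)%type.
(** The hat [(s, s', j)] stands on the triangle over the levels [j], [j + 1], [j + 2] of the strip
    that uses the side [s] at even and [s'] at odd levels. The cap [(top, b)] joins both vertices of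
    an end level to the vertex [b] of the adjacent level. *)
Definition thats := (bool * bool * 'I_K)%type.
Definition tcaps := (bool * bool)%type.

Implicit Types (u v w : tvert).
Definition lev u : nat := u.2.
Definition at_level (t : bool) (l : nat) : tvert := (t, inord l).

Definition step (k : tri) := match k with t0 => 0 | t1 => 1 | t2 => 2 end.
Definition side (s s' : bool) (l : nat) := if odd l then s' else s.

Definition tcorner (r : thats + tcaps) (k : tri) : tvert :=
  match r with
  | inl (s, s', j) => at_level (side s s' (j + step k)) (j + step k)
  | inr (top, b) =>
    match k with
    | t0 => at_level b (if top then K else 1)
    | t1 => at_level true (if top then K.+1 else 0)
    | t2 => at_level false (if top then K.+1 else 0)
    end
  end.

Definition tin (r : thats + tcaps) u : bool :=
  match r with
  | inl (s, s', j) => (j <= lev u <= j + 2) && (u.1 == side s s' (lev u))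
  | inr (true, b) => (lev u == K.+1) || (lev u == K) && (u.1 == b)
  | inr (false, b) => (lev u == 0) || (lev u == 1) && (u.1 == b)
  end.

Lemma lev_at t l : l < K.+2 -> lev (at_level t l) = l.
Proof. by move=> lK; rewrite /lev /= inordK. Qed.

Lemma tvertP u v : lev u = lev v -> u.1 = v.1 -> u = v.
Proof. by case: u v => [t l] [t' l'] /= H ->; congr (_, _); apply: val_inj. Qed.

Lemma at_levE u : u = at_level u.1 (lev u).
Proof. by apply: tvertP => //; rewrite lev_at // ltn_ord. Qed.

Lemma lev_bound u : lev u < K.+2. Proof. exact: ltn_ord. Qed.

Lemma tcset r u : (u \in cset tcorner r) = tin r u.
Proof.
apply/csetP/idP => [[k ->]|].
  case: r => [[[s s'] j]|[[] b]] /=.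
  - have jk : j + step k < K.+2 by have := ltn_ord j; case: k => /=; lia.
    rewrite !lev_at // eqxx andbT; case: k {jk} => /=; lia.
  - by case: k => /=; rewrite lev_at // !eqxx ?orbT.
  - by case: k => /=; rewrite lev_at // !eqxx ?orbT.
case: r => [[[s s'] j]|[[] b]] /=.
- case/andP=> H /eqP E; have [k Ek] : exists k, lev u = j + step k.
    have [L|[L|L]] : lev u = j + 0 \/ lev u = j + 1 \/ lev u = j + 2 by lia.
    + by exists t0. + by exists t1. + by exists t2.
  by exists k; rewrite -Ek -E -at_levE.
- case/orP => [/eqP L|/andP[/eqP L /eqP B]].
    by case E : (u.1); [exists t1|exists t2]; rewrite [LHS]at_levE L E.
  by exists t0; rewrite [LHS]at_levE L B.
- case/orP => [/eqP L|/andP[/eqP L /eqP B]].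
    by case E : (u.1); [exists t1|exists t2]; rewrite [LHS]at_levE L E.
  by exists t0; rewrite [LHS]at_levE L B.
Qed.

Lemma tcorner_inj r : injective (tcorner r).
Proof.
have L t t' l l' : l < K.+2 -> l' < K.+2 -> at_level t l = at_level t' l' -> l = l'.
  by move=> lK lK' /(congr1 lev); rewrite !lev_at.
case: r => [[[s s'] j]|[top b]] k l.
  have jk i : j + step i < K.+2 by have := ltn_ord j; case: i => /=; lia.
  by move=> /(L _ _ _ _ (jk k) (jk l)); case: k l => [] [] //= H; exfalso; lia.
case: top; case: k l => [] [] //= E; have H := L _ _ _ _ _ _ E; exfalso; move: E => [] //.
all: by have := H (ltac:(lia)) (ltac:(lia)); lia.
Qed.

Lemma tcset_inj r r' : cset tcorner r \subset cset tcorner r' -> r = r'.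
Proof.
move=> /subsetP H; have {}H u : tin r u -> tin r' u by rewrite -!tcset; apply: H.
have A (t : bool) l : l < K.+2 -> tin r (at_level t l) -> tin r' (at_level t l) by move=> _; apply: H.
case: r {H} A => [[[s s'] j]|[top b]] A.
  have jK := ltn_ord j.
  have A0 i : i <= 2 -> tin r' (at_level (side s s' (j + i)) (j + i)).
    move=> i2; have L : j + i < K.+2 by lia.
    by apply: A => //; rewrite /tin lev_at //= eqxx andbT; lia.
  have := A0 0 isT; have := A0 1 isT; have := A0 2 isT.
  case: r' {A A0} => [[[z z'] j']|[[] b']]; rewrite /tin !lev_at; try lia.
  move=> /andP[h2 _] /andP[h1 /eqP /= e1] /andP[h0 /eqP /= e0].
  have Ej : j = j' by apply: ord_inj; lia.
  subst j'; congr (inl (_, _, _)); move: e0 e1; rewrite /side addn0 addn1 /=; by case: (odd j).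
have lvl : tin (inr (top, b)) (at_level true (if top then K.+1 else 0)) /\
    tin (inr (top, b)) (at_level false (if top then K.+1 else 0)) /\
    tin (inr (top, b)) (at_level b (if top then K else 1)).
  by case: (top); rewrite /tin !lev_at // !eqxx ?orbT.
case: lvl => [l1 [l2 l3]].
have := A _ _ _ l1; have := A _ _ _ l2; have := A _ _ _ l3; move=> {A l1 l2 l3}.
case: r' => [[[z z'] j]|[top' b']].
  by case: top => _ H1 H2; have := H1 (ltac:(lia)); have := H2 (ltac:(lia)); rewrite /tin !lev_at //=;
     case: (side _ _ _); rewrite /= andbF.
have K2 := K_gt1.
case: top; case: top' => H1 H2 H3; have := H1 (ltac:(lia)); have := H2 (ltac:(lia)); have := H3 (ltac:(lia)); 
  rewrite /tin !lev_at //= ?eqxx ?orbT; try lia.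
- by move=> _ _ H; congr (inr (_, _)); apply/eqP; move: H; case: (b == b') => //; lia.
- by move=> _ _ H; congr (inr (_, _)); apply/eqP; move: H; case: (b == b') => //; lia.
Qed.

Lemma tcover u : exists r, u \in cset tcorner r.
Proof.
have uK := lev_bound u; have K2 := K_gt1.
have jK : minn (lev u) K.-1 < K by lia.
exists (inl (u.1, u.1, Ordinal jK)); rewrite tcset /tin /= /side if_same eqxx andbT; lia.
Qed.

Lemma card_eq2 (T : finType) (A : {set T}) (a b : T) : a != b -> (forall x, (x \in A) = (x == a) || (x == b)) -> #|A| = 2.
Proof.
move=> ab H; have -> : A = [set a; b] by apply/setP => x; rewrite H !inE.
by rewrite cards2 ab.
Qed.

(** By the difference of levels. Difference 0 occurs only at an end, in the two caps there.
    Difference 2 is a vertical edge between two strips. Difference 1 is a slanted edge: it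
    determines its strip and lies in two successive triangles of it, or at an end in one triangle
    and one cap. *)
Lemma ttwo_le r u v : lev u <= lev v -> u != v -> tin r u -> tin r v ->
  #|[set r' | tin r' u && tin r' v]| = 2.
Proof.
move=> uv neq ur vr; have K2 := K_gt1; have uK := lev_bound u; have vK := lev_bound v.
case: (ltngtP (lev v) (lev u).+1) => [vu|vu|vu].
- have E : lev v = lev u by lia.
  have nside : u.1 != v.1 by apply: contra neq => /eqP S; apply/eqP/tvertP.
  have [t [ends others]] : exists t, (forall b, tin (inr (t, b)) u /\ tin (inr (t, b)) v) /\
      (forall b, tin (inr (~~ t, b)) u = false).
    case: r ur vr => [[[s s'] j]|[top b]].
      by rewrite /tin E => /andP[_ /eqP eu] /andP[_ /eqP ev]; rewrite eu ev eqxx in nside.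
    exists top; move: ur vr; case: top; rewrite /tin E;
      case: eqP => [L|_]; rewrite ?L //= => H1 H2; try (by split=> // b'; case: eqP; lia);
      move: H1 H2 => /andP[_ /eqP H1] /andP[_ /eqP H2]; by rewrite H1 H2 eqxx in nside.
  apply: (@card_eq2 _ _ (inr (t, true)) (inr (t, false))) => [|r'].
    by rewrite (inj_eq inr_inj) xpair_eqE andbF.
  rewrite inE.
  case: r' => [[[s s'] j]|[t' b]].
    rewrite /tin E; case: (j <= lev u <= j + 2) => //=; apply/negbTE; apply: contra nside.
    by case/andP=> /eqP-> /eqP->.
  case: (eqVneq t' t) => [->|tt].
    by have [-> ->] := ends b; case: b; rewrite eqxx ?orbT.
  have -> : t' = ~~ t by case: t' t tt {ends others} => [] [].
  by rewrite others; case: (t); case: (b).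
- have E : lev v = lev u + 2.
    case: r ur vr => [[[s s'] j]|[[] b]]; rewrite /tin; lia.
  case: r ur vr => [[[s s'] j]|[[] b]]; [|rewrite /tin; lia|rewrite /tin; lia].
  rewrite /tin => /andP[hu /eqP su] /andP[hv /eqP sv].
  have Ej : lev u = j by lia.
  have suv : u.1 = v.1 by rewrite su sv /side E oddD addbF.
  pose mk b : thats := if odd (lev u) then (b, u.1, j) else (u.1, b, j).
  apply: (@card_eq2 _ _ (inl (mk true)) (inl (mk false))).
    by rewrite /mk (inj_eq inl_inj); case: (odd _); rewrite !xpair_eqE ?andbF.
  case=> [[[z z'] j']|[[] b]]; rewrite inE /tin /mk; try (transitivity false; [lia|by []]).
  have -> : (j' <= lev u <= j' + 2) && (u.1 == side z z' (lev u)) && ((j' <= lev v <= j' + 2) && (v.1 == side z z' (lev v)))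
    = (j' == j) && (u.1 == side z z' (lev u)).
    rewrite /side E oddD addbF -suv.
    case: (eqVneq j' j) => [->|jj]; last first.
      have : j' != j :> nat by []. 
      case: (u.1 == _); lia.
    case: (u.1 == _); lia.
  rewrite /side; case: (odd (lev u)); rewrite !(inj_eq inl_inj) !xpair_eqE (eq_sym u.1).
    by case: (z); rewrite /= ?orbF andbC.
  by case: (z'); rewrite /= ?andbT ?andbF ?orbF andbC.
- have lr a b : (inl a == inr b :> thats + tcaps) = false by [].
  have rl a b : (inr b == inl a :> thats + tcaps) = false by [].
  pose s0 := if odd (lev u) then v.1 else u.1; pose s1 := if odd (lev u) then u.1 else v.1.
  have sideE z z' : (u.1 == side z z' (lev u)) && (v.1 == side z z' (lev v)) = (z == s0) && (z' == s1).
    rewrite /side vu /= /s0 /s1; case: (odd (lev u)) => /=; by rewrite ![_.1 == _]eq_sym // andbC.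
  have hatE z z' (j : 'I_K) : tin (inl (z, z', j)) u && tin (inl (z, z', j)) v =
      [&& z == s0, z' == s1 & (j == lev u :> nat) || (j.+1 == lev u)].
    rewrite /tin; transitivity ((j <= lev u <= j + 2) && (j <= lev v <= j + 2) &&
       ((u.1 == side z z' (lev u)) && (v.1 == side z z' (lev v)))).
      by do 2 case: (_ <= _ <= _); rewrite /= ?andbF.
    by rewrite sideE andbC -andbA; do 2 case: (_ == _) => //=; lia.
  have capE t b : tin (inr (t, b)) u && tin (inr (t, b)) v =
      (if t then (lev u == K) && (u.1 == b) else (lev u == 0) && (v.1 == b)).
    have uK1 : lev u < K.+1 by lia.
    case: t; rewrite /tin vu eqSS.
      by rewrite (ltn_eqF uK1) /=; case: (lev u == K) => //=; rewrite ?andbT.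
    by case: (lev u) => [|n] //=; rewrite !eqSS andbF.
  case: (posnP (lev u)) => [u0|u0].
    have j0 : 0 < K by lia.
    apply: (@card_eq2 _ _ (inl (s0, s1, Ordinal j0)) (inr (false, v.1))) => //.
    case=> [[[z z'] j]|[t b]]; rewrite inE ?hatE ?capE u0.
      rewrite lr orbF (inj_eq inl_inj) !xpair_eqE -val_eqE /=.
      by case: (z == s0); case: (z' == s1) => //=; lia.
    by rewrite rl (inj_eq inr_inj) xpair_eqE (eq_sym b) (ltn_eqF j0); case: t.
  case: (eqVneq (lev u) K) => [uk|uk].
    have jK : K.-1 < K by lia.
    apply: (@card_eq2 _ _ (inl (s0, s1, Ordinal jK)) (inr (true, u.1))) => //.
    case=> [[[z z'] j]|[t b]]; rewrite inE ?hatE ?capE uk.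
      rewrite lr orbF (inj_eq inl_inj) !xpair_eqE -val_eqE /=.
      by have := ltn_ord j; case: (z == s0); case: (z' == s1) => //=; lia.
    by rewrite rl (inj_eq inr_inj) xpair_eqE (eq_sym b) eqxx (gtn_eqF (ltnW K2)); case: t.
  have jK : lev u < K by lia. have jK' : (lev u).-1 < K by lia.
  apply: (@card_eq2 _ _ (inl (s0, s1, Ordinal jK)) (inl (s0, s1, Ordinal jK'))).
    by rewrite (inj_eq inl_inj) !xpair_eqE -val_eqE /= !eqxx /=; lia.
  case=> [[[z z'] j]|[t b]]; rewrite inE ?hatE ?capE.
    by rewrite !(inj_eq inl_inj) !xpair_eqE -!val_eqE /=; case: (z == s0); case: (z' == s1) => //=; lia.
  by rewrite !rl (negbTE uk); case: t => //; rewrite (gtn_eqF u0).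
Qed.

Lemma ttwo r u v : u != v -> u \in cset tcorner r -> v \in cset tcorner r ->
  #|[set r' | (u \in cset tcorner r') && (v \in cset tcorner r')]| = 2.
Proof.
rewrite !tcset => uv ur vr.
have -> : [set r' | (u \in cset tcorner r') && (v \in cset tcorner r')] = [set r' | tin r' u && tin r' v].
  by apply/setP => r'; rewrite !inE !tcset.
case: (leqP (lev u) (lev v)) => [le|/ltnW le]; first exact: ttwo_le le uv ur vr.
rewrite -(ttwo_le le _ vr ur) 1?eq_sym //; apply: eq_card => r'.
by rewrite !inE andbC.
Qed.

Lemma tadj_next u v : lev v = (lev u).+1 -> coarse_adj tcorner u v.
Proof.
move=> E; have uK := lev_bound u; have vK := lev_bound v; have K2 := K_gt1.
rewrite /coarse_adj; apply/andP; split; first by apply/eqP => uv; move: E; rewrite uv; lia.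
have jK : minn (lev u) K.-1 < K by lia.
apply/existsP; exists (inl (side u.1 v.1 (lev u), side v.1 u.1 (lev u), Ordinal jK)).
rewrite !tcset /tin /side E /=; case: (odd _); rewrite /= !eqxx !andbT; lia.
Qed.

Lemma tadj_skip u v : lev v = (lev u).+2 -> u.1 = v.1 -> coarse_adj tcorner u v.
Proof.
move=> E S; have uK := lev_bound u; have vK := lev_bound v; have K2 := K_gt1.
rewrite /coarse_adj; apply/andP; split; first by apply/eqP => uv; move: E; rewrite uv; lia.
have jK : lev u < K by lia.
apply/existsP; exists (inl (u.1, u.1, Ordinal jK)).
rewrite !tcset /tin /side E S !if_same eqxx !andbT /=; lia.
Qed.

Lemma tadj_end u v : lev u = lev v -> (lev u == 0) || (lev u == K.+1) -> u != v -> coarse_adj tcorner u v.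
Proof.
move=> E H uv; rewrite /coarse_adj uv /=; apply/existsP; exists (inr (lev u == K.+1, true)).
by rewrite !tcset /tin -E; move: H; case: (lev u == K.+1) => //=; rewrite orbF => ->.
Qed.

Lemma card_tvert : 4 <= #|{: tvert}|.
Proof. by rewrite card_prod card_bool card_ord; have := K_gt1; lia. Qed.

(** Induction on the difference of levels. A level blocks the way only if both its vertices are
    deleted; then [S] is exhausted, and the vertical edges jump over that level. Two vertices of one
    level meet through a level above or below. *)
Lemma tconnected (S : {set tvert}) : #|S| <= 2 -> forall u v, u \notin S -> v \notin S ->
  connect [rel x y | [&& x \notin S, y \notin S & coarse_adj tcorner x y]] u v.
Proof.
move=> S2; set e := (X in connect X).
have K2 := K_gt1.
have e_sym : connect_sym e.
  apply: sym_connect_sym => x y; rewrite /e /= /coarse_adj eq_sym.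
  under eq_existsb => r do rewrite andbC.
  by case: (x \notin S); case: (y \notin S).
have edge x y : x \notin S -> y \notin S -> coarse_adj tcorner x y -> connect e x y.
  by move=> xS yS xy; apply: connect1; rewrite /e /= xS yS.
have three a b c : a != b -> b != c -> a != c -> a \in S -> b \in S -> c \in S -> False.
  move=> ab bc ac aS bS cS.
  suff : 2 < #|S| by rewrite ltnNge S2.
  have <- : #|[set a; b; c]| = 3.
    by rewrite -setUA cardsU1 cards2 !inE negb_or ab ac bc.
  by apply: subset_leq_card; apply/subsetP => t; rewrite !inE => /orP[/orP[]|] /eqP->.
have lvl l : l < K.+2 -> (exists2 w, w \notin S & lev w = l) \/
    (at_level true l \in S /\ at_level false l \in S).
  move=> lK; case A : (at_level true l \in S); last by left; exists (at_level true l); rewrite ?A ?lev_at.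
  case B : (at_level false l \in S); last by left; exists (at_level false l); rewrite ?B ?lev_at.
  by right.
have full l w : l < K.+2 -> at_level true l \in S -> at_level false l \in S -> lev w <> l -> w \notin S.
  move=> lK A B wl; apply/negP => wS; apply: (three _ _ _ _ _ _ A B wS); apply/eqP => H.
  - by case: H.
  - by apply: wl; rewrite -H lev_at.
  - by apply: wl; rewrite -H lev_at.
suff H d u v : u \notin S -> v \notin S -> lev v = lev u + d -> connect e u v.
  move=> u v uS vS; case: (leqP (lev u) (lev v)) => [le|/ltnW le].
    by apply: (H (lev v - lev u)); rewrite ?subnKC.
  by rewrite e_sym; apply: (H (lev u - lev v)); rewrite ?subnKC.
elim/ltn_ind: d u => d IH u uS vS E; have uK := lev_bound u; have vK := lev_bound v.
case: d IH E => [|[|d]] IH E.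
- case: (eqVneq u v) => [->|uv]; first exact: connect0.
  case: (boolP ((lev u == 0) || (lev u == K.+1))) => Hend; first by apply: edge => //; apply: tadj_end; lia.
  have up : (lev u).+1 < K.+2 by lia.
  have [[w wS wl]|[A B]] := lvl _ up.
    apply: (@connect_trans _ _ w); first by apply: edge => //; apply: tadj_next; lia.
    by rewrite e_sym; apply: edge => //; apply: tadj_next; lia.
  have down : (lev u).-1 < K.+2 by lia.
  pose w := at_level true (lev u).-1.
  have wl : lev w = (lev u).-1 by rewrite lev_at.
  have wS : w \notin S by apply: (full _ _ up A B); lia.
  apply: (@connect_trans _ _ w); last by apply: edge => //; apply: tadj_next; lia.
  by rewrite e_sym; apply: edge => //; apply: tadj_next; lia.
- by apply: edge => //; apply: tadj_next; lia.
- have up : (lev u).+1 < K.+2 by lia.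
  have [[w wS wl]|[A B]] := lvl _ up.
    apply: (@connect_trans _ _ w); first by apply: edge => //; apply: tadj_next; lia.
    by apply: (IH d.+1) => //; lia.
  pose w := at_level u.1 (lev u).+2.
  have wl : lev w = (lev u).+2 by rewrite lev_at //; lia.
  have wS : w \notin S by apply: (full _ _ up A B); lia.
  apply: (@connect_trans _ _ w); first by apply: edge => //; apply: tadj_skip.
  by apply: (IH d) => //; lia.
Qed.
End Tube.

Local Open Scope ring_scope.

Section Row3.
Variable R : comRingType.
Definition mk3 (x y z : R) : 'rV[R]_3 := \row_j (if j == 0 then x else if j == 1 then y else z).
Lemma mk3E0 x y z : mk3 x y z 0 0 = x. Proof. by rewrite mxE. Qed.
Lemma mk3E1 x y z : mk3 x y z 0 1 = y. Proof. by rewrite mxE. Qed.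
Lemma mk3E2 x y z : mk3 x y z 0 2 = z. Proof. by rewrite mxE. Qed.
Definition mk3E := (mk3E0, mk3E1, mk3E2).
Lemma row3P (p q : 'rV[R]_3) : p 0 0 = q 0 0 -> p 0 1 = q 0 1 -> p 0 2 = q 0 2 -> p = q.
Proof.
move=> e0 e1 e2; apply/rowP => -[[|[|[|//]]] H].
- by have -> : Ordinal H = 0 by apply: val_inj.
- by have -> : Ordinal H = 1 by apply: val_inj.
- by have -> : Ordinal H = 2 by apply: val_inj.
Qed.
End Row3.

Section Coordinates.
Variable R : realType.
Lemma d2_3E (p q : 'rV[R]_3) :
  d2 p q = (p 0 0 - q 0 0) ^+ 2 + (p 0 1 - q 0 1) ^+ 2 + (p 0 2 - q 0 2) ^+ 2.
Proof.
rewrite /d2 !big_ord_recl big_ord0 addr0 addrA.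
by congr ((p 0 _ - q 0 _) ^+ 2 + (p 0 _ - q 0 _) ^+ 2 + (p 0 _ - q 0 _) ^+ 2); apply: val_inj.
Qed.

Lemma sum_coord (T : finType) (w : T -> R) (p : T -> 'rV[R]_3) j :
  (\sum_v w v *: p v) 0 j = \sum_v w v * p v 0 j.
Proof. by rewrite summxE; apply: eq_bigr => v _; rewrite mxE. Qed.

(* The points [p] lifted to the heights [H] lie above the planes [(a, b, c, d)] and
   [(a', b', c', d')] and touch them on [S] and [S']: faces of a lower convex hull. *)
Lemma supporting_weights (T : finType) (p : T -> 'rV[R]_3) (H : T -> R) (S S' : {set T})
    (a a' b b' c c' d d' : R) (w w' : T -> R) :
  let k v := H v - (a * p v 0 0 + b * p v 0 1 + c * p v 0 2 + d) in
  let k' v := H v - (a' * p v 0 0 + b' * p v 0 1 + c' * p v 0 2 + d') in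
  (forall v, if v \in S then k v = 0 else 0 < k v) ->
  (forall v, if v \in S' then k' v = 0 else 0 < k' v) ->
  weights S w -> weights S' w' -> \sum_v w v *: p v = \sum_v w' v *: p v ->
  forall v, v \notin S -> w' v = 0.
Proof.
move=> k k' kS kS' [w0 wS w1] [w'0 w'S' w'1] E.
have sumk (u : T -> R) a0 b0 c0 d0 : \sum_v u v = 1 ->
    \sum_v u v * (H v - (a0 * p v 0 0 + b0 * p v 0 1 + c0 * p v 0 2 + d0)) =
    \sum_v u v * H v - (a0 * (\sum_v u v *: p v) 0 0 + b0 * (\sum_v u v *: p v) 0 1 +
       c0 * (\sum_v u v *: p v) 0 2 + d0).
  move=> u1; rewrite !sum_coord !mulr_sumr -[d0 in RHS]mul1r -u1 mulr_suml -!big_split /= -sumrB.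
  by apply: eq_bigr => v _; ring.
have zero (Q : {set T}) (u h : T -> R) : (forall v, v \notin Q -> u v = 0) ->
    (forall v, if v \in Q then h v = 0 else 0 < h v) -> \sum_v u v * h v = 0.
  move=> uQ hQ; apply: big1 => v _; have := hQ v; case: ifP => [_ ->|/negbT/uQ-> _]; first by rewrite mulr0.
  by rewrite mul0r.
have ge (Q : {set T}) (u h : T -> R) v : (forall v, 0 <= u v) ->
    (forall v, if v \in Q then h v = 0 else 0 < h v) -> 0 <= u v * h v.
  by move=> u0 /(_ v); case: ifP => [_ ->|_ /ltW h0]; rewrite ?mulr0 ?mulr_ge0.
have Z1 := zero _ _ _ wS kS; have Z2 := zero _ _ _ w'S' kS'.
have P1 : 0 <= \sum_v w' v * k v by apply: sumr_ge0 => v _; apply: ge kS.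
have P2 : 0 <= \sum_v w v * k' v by apply: sumr_ge0 => v _; apply: ge kS'.
rewrite sumk // E in Z1; rewrite sumk // in Z2; rewrite sumk // E in P2.
have Z : \sum_v w' v * k v = 0 by apply/eqP; rewrite eq_le P1 andbT sumk //; lra.
move=> v vS; move/eqP: Z; rewrite psumr_eq0 => [/allP/(_ v (mem_index_enum v))|u _]; last exact: ge kS.
by have := kS v; rewrite (negbTE vS) mulf_eq0 => kv /orP[/eqP//|]; rewrite gt_eqF.
Qed.
End Coordinates.

(** * The tube in space and its convex lift *)

Section TubeGeometry.
Variables (R : realType) (K : nat).
Hypothesis K_even : ~~ odd K.
Hypothesis K_gt1 : (1 < K)%N.

Notation tvert := (tvert K).
Notation tin := (@tin K).

(* The base is a tube around the z-axis: level [l] lies at height [l * rise] and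
   carries the two opposite corners [(x, y) = (+-wid, +-wid)] of a square with
   [x = y] for [l] even and [x = -y] for [l] odd; the strip [(s, s')] alternates
   between two adjacent vertical lines, and two cap triangles close each end. *)
Definition wid : R := 10 / 29 * Num.sqrt 3.
Definition rise : R := 20 / 29.
Definition sg (t : bool) : R := if t then 1 else -1.
Definition par (l : nat) : R := if odd l then -1 else 1.

Lemma wid_gt0 : 0 < wid. Proof. by rewrite /wid mulr_gt0 ?sqrtr_gt0 //; lra. Qed.
Lemma wid_sqr : wid ^+ 2 = 300 / 841.
Proof. by rewrite /wid exprMn sqr_sqrtr ?ler0n //; field. Qed.
Lemma sg_sqr t : sg t ^+ 2 = 1. Proof. by case: t; rewrite /sg; ring. Qed.

Definition pos0 (u : tvert) : 'rV[R]_3 :=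
  mk3 (sg u.1 * wid) (sg u.1 * par (lev u) * wid) ((lev u)%:R * rise).

Definition nrm (i : thats K) : 'rV[R]_3 :=
  mk3 ((sg i.1.1 + sg i.1.2) / 2) ((sg i.1.1 - sg i.1.2) / 2) 0.

(* Signed coordinates of a base vertex in the frame of the strip [(s, s')]:
   along the outward normal, and across the strip, in units of [wid]. *)
Definition ncoord (s s' : bool) (u : tvert) : R :=
  sg u.1 * ((sg s + sg s') / 2 + par (lev u) * ((sg s - sg s') / 2)).
Definition xcoord (s s' : bool) (u : tvert) : R :=
  sg u.1 * ((sg s - sg s') / 2 + par (lev u) * ((sg s + sg s') / 2)).

(* The convex lift [level ^ 2] minus the affine function supporting it at the
   triangle [r]; see [kap_affine] and [kap_sign]. *)
Definition kap (r : thats K + tcaps) (u : tvert) : R :=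
  match r with
  | inl (s, s', j) => ((lev u)%:R - (j : nat)%:R - 1) ^+ 2 - (1 + par j * xcoord s s' u) / 2 + (1 - ncoord s s' u)
  | inr (true, b) => (K.+1%:R - (lev u)%:R) ^+ 2 - sg b * sg u.1 * ((1 + par (lev u)) / 2)
  | inr (false, b) => (lev u)%:R ^+ 2 - sg b * sg u.1 * ((1 - par (lev u)) / 2)
  end.

Lemma kap_affine r : exists a b c d, forall u,
  kap r u = (lev u)%:R ^+ 2 - (a * pos0 u 0 0 + b * pos0 u 0 1 + c * pos0 u 0 2 + d).
Proof.
have w0 : wid != 0 by rewrite gt_eqF ?wid_gt0.
case: r => [[[s s'] j]|[[] b]].
- exists (((sg s + sg s') / 2 + par j * ((sg s - sg s') / 2) / 2) / wid),
    (((sg s - sg s') / 2 + par j * ((sg s + sg s') / 2) / 2) / wid),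
    (2 * ((j : nat)%:R + 1) / rise), (- ((j : nat)%:R + 1) ^+ 2 - 1 / 2) => u.
  by rewrite /kap /xcoord /ncoord /pos0 !mk3E /rise; field.
- exists (sg b / 2 / wid), (sg b / 2 / wid), (2 * K.+1%:R / rise), (- K.+1%:R ^+ 2) => u.
  by rewrite /kap /pos0 !mk3E /rise; field.
- exists (sg b / 2 / wid), (- sg b / 2 / wid), 0, 0 => u.
  by rewrite /kap /pos0 !mk3E /rise; field.
Qed.

Lemma kap_sign r u : if tin r u then kap r u = 0 else 0 < kap r u.
Proof.
have natlt (a b : nat) : (a < b)%N -> a%:R + 1 <= b%:R :> R by rewrite natr1 ler_nat.
case: r => [[[s s'] j]|[[] b]]; rewrite /kap /tin; set l := lev u.
- rewrite /xcoord /ncoord -/l /side.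
  (* [A] is 1 or 0 according to the position across the strip, [B] is 0 on the strip and 2 off it.
     Beyond the levels [j] to [j + 2] the square is at least 4 and outweighs [A]. *)
  set A := (X in _ - X + _); set B := (X in _ + X).
  have H : [/\ 0 <= B <= 2, 0 <= A <= 1 & A <= B + 1] /\ 
     (if u.1 == (if odd l then s' else s) then B = 0 /\ A = (if odd l == odd j then 1 else 0) else B = 2).
    rewrite /A /B /par; clear A B; case: s s' (u.1) => [] [] []; rewrite /sg; case: (odd l); case: (odd j); rewrite /=; repeat split; lra.
  case: H => [[/andP[B0 B2] /andP[A0 A1] AB] HA].
  case: (ltngtP l j) => [lj|lj|lj].
  + by have := natlt _ _ lj => ? /=; nra.
  + case: (ltngtP l (j + 2)%N) => [lj2|lj2|lj2].
    * have El : l = j.+1 by lia.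
      move: HA; rewrite El /= -natr1; case: eqP => [_ [-> ->]|_ -> /=].
        by case: (odd j); rewrite /=; ring.
      by rewrite (_ : _ - _ - 1 = 0) ?expr0n /=; [lra|ring].
    * by have := natlt _ _ lj2; rewrite natrD => ? /=; nra.
    * move: HA; rewrite lj2 oddD addbF /= natrD; case: eqP => [_ [-> ->]|_ -> /=].
        by rewrite eqxx; ring.
      by rewrite (_ : _ - _ - 1 = 1) ?expr1n /=; [lra|ring].
  + have jj : (l <= j + 2)%N by lia.
    move: HA; rewrite jj lj /=; case: eqP => [_ [-> ->]|_ -> /=].
      by rewrite eqxx; ring.
    by rewrite (_ : _ - _ - 1 = -1) ?sqrrN ?expr1n /=; [lra|ring].
- have lK := lev_bound u; rewrite -/l in lK.
  case: (eqVneq l K.+1) => [->|l1] /=.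
    by rewrite /par /= K_even subrr expr0n /= subrr mul0r mulr0 subr0.
  case: (eqVneq l K) => [->|l2] /=.
    rewrite /par (negbTE K_even) -natr1 (_ : _ - K%:R = 1); last by ring.
    rewrite expr1n; case: eqP => [->|/eqP ub].
      by case: b; rewrite /sg; field.
    by case: b (u.1) ub => [] [] //= _; rewrite /sg; lra.
  have H : (l < K)%N by lia.
  have := natlt _ _ H; rewrite -natr1 => ?.
  have : sg b * sg u.1 * ((1 + par l) / 2) <= 1.
    by rewrite /par; case: b (u.1) (odd l) => [] [] []; rewrite /sg; lra.
  nra.
- case: (posnP l) => [->|l0] /=.
    by rewrite /par /= expr0n /= subrr mul0r mulr0 subr0.
  case: (eqVneq l 1%N) => [->|l2] /=.
    rewrite /par /= expr1n; case: eqP => [->|/eqP ub].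
      by case: b; rewrite /sg; field.
    by case: b (u.1) ub => [] [] //= _; rewrite /sg; lra.
  have H : (1 < l)%N by lia.
  have := natlt _ _ H => ?.
  have : sg b * sg u.1 * ((1 - par l) / 2) <= 1.
    by rewrite /par; case: b (u.1) (odd l) => [] [] []; rewrite /sg; lra.
  nra.
Qed.
End TubeGeometry.

Section Prism.
Variable R : realType.
Definition dot3 (p q : 'rV[R]_3) : R := p 0 0 * q 0 0 + p 0 1 * q 0 1 + p 0 2 * q 0 2.

(** In barycentric coordinates of an equilateral triangle with squared side [L], a difference has
    squared length [L / 2] times its sum of squares; Pythagoras adds the part along the normal. *)
Lemma prism_dist (c : tri -> 'rV[R]_3) (n : 'rV[R]_3) (L : R) (a b : tri -> R) (p q : R) :
  (forall k l, k != l -> d2 (c k) (c l) = L) -> dot3 n n = 1 -> (forall k l, dot3 n (c k) = dot3 n (c l)) ->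
  \sum_k a k = \sum_k b k ->
  d2 (\sum_k a k *: c k + p *: n) (\sum_k b k *: c k + q *: n) =
  L / 2 * \sum_k (a k - b k) ^+ 2 + (p - q) ^+ 2.
Proof.
move=> HL Hn Ho; rewrite !big_tri d2_3E !mxE.
have := HL t0 t1 isT; have := HL t0 t2 isT; have := HL t1 t2 isT; rewrite !d2_3E.
have := Ho t1 t0; have := Ho t2 t0; move: Hn; rewrite /dot3.
move: (c t0 0 0) (c t0 0 1) (c t0 0 2) (c t1 0 0) (c t1 0 1) (c t1 0 2) (c t2 0 0) (c t2 0 1) (c t2 0 2).
move: (n 0 0) (n 0 1) (n 0 2) (a t0) (a t1) (a t2) (b t0) (b t1) (b t2).
move=> n0 n1 n2 a0 a1 a2 b0 b1 b2 x0 y0 z0 x1 y1 z1 x2 y2 z2 Hn O2 O1 H12 H02 H01 S.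
have -> : a0 = b0 - (a1 - b1) - (a2 - b2) by move: S; lra.
have [d1 E1] : exists d, a1 - b1 = d by exists (a1 - b1).
have [d2 E2] : exists d, a2 - b2 = d by exists (a2 - b2).
rewrite E1 E2.
have -> : a1 = b1 + d1 by rewrite -E1; ring.
have -> : a2 = b2 + d2 by rewrite -E2; ring.
pose u0 := x1 - x0; pose u1 := y1 - y0; pose u2 := z1 - z0.
pose v0 := x2 - x0; pose v1 := y2 - y0; pose v2 := z2 - z0.
have U : u0 ^+ 2 + u1 ^+ 2 + u2 ^+ 2 = L by rewrite -H01 /u0 /u1 /u2; ring.
have V : v0 ^+ 2 + v1 ^+ 2 + v2 ^+ 2 = L by rewrite -H02 /v0 /v1 /v2; ring.
have UV : u0 * v0 + u1 * v1 + u2 * v2 = L / 2.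
  have : 2 * (u0 * v0 + u1 * v1 + u2 * v2) = L + L - L by rewrite -{1}U -{1}V -H12 /u0 /u1 /u2 /v0 /v1 /v2; ring.
  lra.
have NU : n0 * u0 + n1 * u1 + n2 * u2 = 0 by rewrite /u0 /u1 /u2; move: O1; lra.
have NV : n0 * v0 + n1 * v1 + n2 * v2 = 0 by rewrite /v0 /v1 /v2; move: O2; lra.
transitivity (d1 ^+ 2 * (u0 ^+ 2 + u1 ^+ 2 + u2 ^+ 2) + d2 ^+ 2 * (v0 ^+ 2 + v1 ^+ 2 + v2 ^+ 2) +
  2 * d1 * d2 * (u0 * v0 + u1 * v1 + u2 * v2) + 2 * d1 * (p - q) * (n0 * u0 + n1 * u1 + n2 * u2) +
  2 * d2 * (p - q) * (n0 * v0 + n1 * v1 + n2 * v2) + (p - q) ^+ 2 * (n0 * n0 + n1 * n1 + n2 * n2)).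
  by rewrite /u0 /u1 /u2 /v0 /v1 /v2; ring.
by rewrite U V UV NU NV Hn; field.
Qed.
End Prism.

(** * Edge lengths of hats and caps *)

Section TubeMetric.
Variables (R : realType) (K : nat).
Hypothesis K_even : ~~ odd K.
Hypothesis K_gt1 : (1 < K)%N.

Notation tvert := (tvert K).
Notation tcorner := (@tcorner K).
Notation pos0 := (@pos0 R K).
Notation nrm := (@nrm R K).
Notation wid := (wid R).
Notation rise := (rise R).
Notation sg := (sg R).
Notation par := (par R).

(* The height that makes the edges from the inner vertices to the corners unit. *)
Definition h1_square : R := 1 - 800 / 841 * ((61 / 100) ^+ 2 + (22 / 100) ^+ 2 + (39 / 100) ^+ 2).
Definition h1 : R := Num.sqrt h1_square.
(** [sl R ^+ 2 / 3] is the squared circumradius of the triangle of inner vertices; the apex stands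
    above its centre at distance 1 from them. *)
Definition h2 : R := h1 + Num.sqrt (1 - sl R ^+ 2 / 3).
Definition lht (x : lvert) : R := match x with inl _ => 0 | inr (Some _) => h1 | inr None => h2 end.

Definition pos (v : hvert tvert (thats K)) : 'rV[R]_3 :=
  match v with
  | inl u => pos0 u
  | inr (i, o) => flat tcorner pos0 (inr (i, o)) + lht (inr o) *: nrm i
  end.

Lemma pos_glob i x : pos (glob tcorner i x) =
  \sum_k lbary R x k *: pos0 (tcorner (inl i) k) + lht x *: nrm i.
Proof.
case: x => [l|o] //=; rewrite scale0r addr0 (bigD1 l) //= eqxx scale1r big1 ?addr0 // => k.
by rewrite eq_sym => /negbTE->; rewrite scale0r.
Qed.

Lemma lev_corner i k : lev (tcorner (inl i) k) = (i.2 + step k)%N.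
Proof. by case: i => [[s s'] j]; rewrite /= lev_at //; have := ltn_ord j; case: k => /=; lia. Qed.

Lemma side_corner i k : (tcorner (inl i) k).1 = side i.1.1 i.1.2 (i.2 + step k).
Proof. by case: i => [[s s'] j]. Qed.

(** A vertical side spans two levels, and twice 20/29 is 40/29. A slanted side spans one level and
    changes one horizontal coordinate by [2 * wid]: 1200/841 + 400/841 = 1600/841. *)
Lemma hat_equilateral i k l : k != l ->
  d2 (pos0 (tcorner (inl i) k)) (pos0 (tcorner (inl i) l)) = (40 / 29) ^+ 2.
Proof.
rewrite d2_3E /pos0 !mk3E !lev_corner !side_corner; case: i => [[s s'] j] /=.
have W := wid_sqr R; rewrite !natrD /side /par !oddD /rise.
by case: k l => [] [] //= _; case: s s' (odd j) => [] [] []; rewrite /sg /=; lra.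
Qed.

Lemma nrm_corner i k : dot3 (nrm i) (pos0 (tcorner (inl i) k)) = wid.
Proof.
rewrite /dot3 /pos0 /nrm !mk3E lev_corner side_corner; case: i => [[s s'] j] /=.
rewrite /side /par oddD.
by case: k => /=; case: s s' (odd j) => [] [] []; rewrite /sg /=; field.
Qed.

Lemma nrm_unit i : dot3 (nrm i) (nrm i) = 1.
Proof. by rewrite /dot3 /nrm !mk3E; case: i => [[[] []] j]; rewrite /sg /=; field. Qed.

Lemma h1_square_gt0 : 0 < h1_square. Proof. by rewrite /h1_square; lra. Qed.
Lemma h1_sqr : h1 ^+ 2 = h1_square.
Proof. by rewrite sqr_sqrtr // ltW // h1_square_gt0. Qed.

Lemma h12_sqr : (h1 - h2) ^+ 2 = 1 - sl R ^+ 2 / 3.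
Proof. by rewrite /h2 opprD addrA subrr sub0r sqrrN sqr_sqrtr // /sl; lra. Qed.

Lemma h1_gt0 : 0 < h1. Proof. by rewrite sqrtr_gt0 h1_square_gt0. Qed.

Lemma h1_lt : h1 < 7 / 10.
Proof. by have := h1_sqr; rewrite /h1_square; have := h1_gt0 => ? ?; nra. Qed.

Lemma h2_gt : h1 + 9 / 10 < h2.
Proof.
rewrite /h2 ltrD2l -(@ltr_pXn2r _ 2) ?nnegrE ?sqrtr_ge0 ?divr_ge0 //.
by rewrite sqr_sqrtr /sl; lra.
Qed.

Lemma hat_dist i x y f : inc f x -> inc f y -> x != y ->
  d2 (pos (glob tcorner i x)) (pos (glob tcorner i y)) = lenR R (lenk x y) ^+ 2.
Proof.
move=> fx fy xy; rewrite !pos_glob.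
rewrite (prism_dist (L := (40 / 29) ^+ 2)); last by rewrite !sum_lbary.
- have H1 := h1_sqr; have H2 := h12_sqr.
  have : has (fun g => inc g x && inc g y) lfaces by apply/hasP; exists f; rewrite ?mem_lfaces ?fx.
  rewrite big_tri /lht /lbary /lenR; move: xy {fx fy}.
  case: x y => [[]|[[]|]] [[]|[[]|]] // _ _; rewrite /beta /=;
  rewrite ?sub0r ?subr0 ?subrr -?[h2 - h1]opprB ?sqrrN ?H1 ?H2 /h1_square /sl; by field.
- by move=> k l; apply: hat_equilateral.
- exact: nrm_unit.
- by move=> k l; rewrite !nrm_corner.
Qed.

(** The third side is the diagonal of the horizontal square, of squared length [8 * wid ^+ 2]; being
    less than 1600/841 + 1600/841, it leaves the cap acute. *)
Lemma cap_dist (c : tcaps) : [/\ d2 (pos0 (tcorner (inr c) t0)) (pos0 (tcorner (inr c) t1)) = 1600 / 841,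
  d2 (pos0 (tcorner (inr c) t0)) (pos0 (tcorner (inr c) t2)) = 1600 / 841 &
  d2 (pos0 (tcorner (inr c) t1)) (pos0 (tcorner (inr c) t2)) = 2400 / 841].
Proof.
have W := wid_sqr R; have K2 := K_gt1.
rewrite !d2_3E /pos0 !mk3E; case: c => top b.
have L0 : lev (tcorner (inr (top, b)) t0) = if top then K else 1%N.
  by rewrite lev_at //; case: (top).
have L1 : lev (tcorner (inr (top, b)) t1) = if top then K.+1 else 0%N.
  by rewrite lev_at //; case: (top).
have L2 : lev (tcorner (inr (top, b)) t2) = if top then K.+1 else 0%N.
  by rewrite lev_at //; case: (top).
rewrite L0 L1 L2 /=.
have p0 : par (if top then K else 1%N) = if top then 1 else -1.
  by case: (top); rewrite /par ?(negbTE K_even).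
have p1 : par (if top then K.+1 else 0%N) = if top then -1 else 1.
  by case: (top); rewrite /par /= ?K_even.
rewrite p0 p1 /rise; set x := (if top then K else 1%N)%:R; set y := (if top then K.+1 else 0%N)%:R.
have xy : (x - y) ^+ 2 = 1.
  by rewrite /x /y; case: (top); rewrite ?subr0 ?expr1n // -natr1 opprD addrA subrr sub0r sqrrN expr1n.
clearbody x y.
have D z : (x * z - y * z) ^+ 2 = z ^+ 2 by rewrite -mulrBl exprMn xy mul1r.
by rewrite !D; move: W; case: top b {L0 L1 L2 p0 p1} => [] [] W; rewrite /sg /=; split; lra.
Qed.

Lemma cap_acute c : acute_isosceles pos (hface tcorner (inr c)).
Proof.
have [D01 D02 D12] := cap_dist c.
exists (inl (tcorner (inr c) t0)), (inl (tcorner (inr c) t1)), (inl (tcorner (inr c) t2)).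
have ne k l : k != l -> inl (tcorner (inr c) k) != inl (tcorner (inr c) l) :> hvert tvert (thats K).
  by move=> kl; apply: contra kl => /eqP[H]; apply/eqP; exact: (@tcorner_inj K K_gt1 (inr c) k l H).
have d2C (u v : 'rV[R]_3) : d2 u v = d2 v u by apply: eq_bigr => k _; ring.
split.
  apply/setP => v; apply/imsetP/idP => [[k _ ->]|].
    by case: k; rewrite !inE eqxx ?orbT.
  by rewrite !inE => /orP[/orP[]|] /eqP->; eexists.
do 3 (split; first exact: ne).
have PE u : pos (inl u) = pos0 u by [].
rewrite !PE; split; first by rewrite D01 D02.
rewrite !(d2C (pos0 (tcorner _ t2))) (d2C (pos0 (tcorner _ t1)) (pos0 (tcorner _ t0))) D01 D02 D12.
by split; lra.
Qed.
End TubeMetric.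

(** * Flattening the hats by clamping *)

Section TubeFlat.
Variables (R : realType) (K : nat).
Hypothesis K_even : ~~ odd K.
Hypothesis K_gt1 : (1 < K)%N.

Notation tvert := (tvert K).
Notation tcorner := (@tcorner K).
Notation cset := (cset tcorner).
Notation pos0 := (@pos0 R K).
Notation nrm := (@nrm R K).
Notation wid := (wid R).
Notation sg := (sg R).
Notation par := (par R).
Notation flat := (flat tcorner pos0).
Notation pos := (@pos R K).
Notation hface := (hface tcorner).
Let hv := hvert tvert (thats K).

Lemma d2C n (p q : 'rV[R]_n) : d2 p q = d2 q p.
Proof. by apply: eq_bigr => i _; ring. Qed.

Lemma coarse_free r (d : tvert -> R) : (forall v, v \notin cset r -> d v = 0) ->
  \sum_v d v = 0 -> \sum_v d v *: pos0 v = 0 -> d =1 fun=> 0.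
Proof.
have ne k l : k != l -> tcorner r k != tcorner r l.
  by move=> kl; apply: contra kl => /eqP H; apply/eqP; exact: (@tcorner_inj K K_gt1 r k l H).
have E : cset r = [set tcorner r t0; tcorner r t1; tcorner r t2].
  apply/setP => u; apply/csetP/idP => [[[] ->]|]; rewrite !inE ?eqxx ?orbT //.
  by move=> /orP[/orP[]|] /eqP->; eexists.
rewrite E => d0; apply: (acute_free (ne t0 t1 isT) (ne t1 t2 isT) (ne t0 t2 isT)) => // {E d0}.
all: rewrite ?(d2C (pos0 (tcorner r t2)) (pos0 (tcorner r t0))) ?(d2C (pos0 (tcorner r t2)) (pos0 (tcorner r t1)))
  ?(d2C (pos0 (tcorner r t1)) (pos0 (tcorner r t0))).
all: case: r {ne} => [i|c].
all: try by rewrite !hat_equilateral //; lra.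
all: by have [-> -> ->] := cap_dist R K_even K_gt1 c; lra.
Qed.

(** The triangles of a strip are coplanar, so supporting planes in space cannot tell them apart; the
    lift by the squared level can. It confines [w'] to the triangle [r], where affine independence
    concludes. *)
Lemma coarse_unique r r' (w w' : tvert -> R) : weights (cset r) w -> weights (cset r') w' ->
  \sum_u w u *: pos0 u = \sum_u w' u *: pos0 u -> w =1 w'.
Proof.
move=> W W' E.
have [a [b [c [d Hr]]]] := kap_affine R r; have [a' [b' [c' [d' Hr']]]] := kap_affine R r'.
have S q a0 b0 c0 d0 : (forall u, kap R q u = (lev u)%:R ^+ 2 - (a0 * pos0 u 0 0 + b0 * pos0 u 0 1 + c0 * pos0 u 0 2 + d0)) ->
    forall v, if v \in cset q then (lev v)%:R ^+ 2 - (a0 * pos0 v 0 0 + b0 * pos0 v 0 1 + c0 * pos0 v 0 2 + d0) = 0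
      else 0 < (lev v)%:R ^+ 2 - (a0 * pos0 v 0 0 + b0 * pos0 v 0 1 + c0 * pos0 v 0 2 + d0).
  by move=> Hq v; rewrite -Hq (tcset K_gt1); apply: (kap_sign R K_even).
have w'r := supporting_weights (S _ _ _ _ _ Hr) (S _ _ _ _ _ Hr') W W' E.
case: W W' => [_ wr w1] [_ _ w'1].
have Z : (fun v => w v - w' v) =1 fun=> 0.
  apply: (@coarse_free r).
  - by move=> v vr; rewrite wr // w'r // subrr.
  - by rewrite sumrB w1 w'1 subrr.
  - under eq_bigr do rewrite scalerBl.
    by rewrite sumrB E subrr.
by move=> v; apply/eqP; rewrite -subr_eq0; apply/eqP; exact: (Z v).
Qed.

Definition clamp (x : R) : R := Num.max (- wid) (Num.min wid x).
Definition proj (p : 'rV[R]_3) : 'rV[R]_3 := mk3 (clamp (p 0 0)) (clamp (p 0 1)) (p 0 2).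

Lemma clamp_id x : - wid <= x <= wid -> clamp x = x.
Proof. by case/andP=> ? ?; rewrite /clamp min_r // max_r. Qed.

Lemma clamp_gt x : wid <= x -> clamp x = wid.
Proof. by move=> ?; rewrite /clamp min_l // max_r //; have := wid_gt0 R; lra. Qed.

Lemma clamp_lt x : x <= - wid -> clamp x = - wid.
Proof. by move=> ?; rewrite /clamp max_l // ge_min; apply/orP; right. Qed.

Lemma convex_le (T : finType) (w g : T -> R) (a : R) : (forall v, 0 <= w v) -> \sum_v w v = 1 ->
  (forall v, w v != 0 -> g v <= a) -> \sum_v w v * g v <= a.
Proof.
move=> w0 w1 ga; rewrite -[a]mul1r -w1 mulr_suml; apply: ler_sum => v _.
by case: (eqVneq (w v) 0) => [->|/ga]; rewrite ?mul0r // => ?; apply: ler_wpM2l.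
Qed.

Lemma convex_eq (T : finType) (w g : T -> R) (a : R) : \sum_v w v = 1 ->
  (forall v, w v != 0 -> g v = a) -> \sum_v w v * g v = a.
Proof.
move=> w1 ga; rewrite -[RHS]mul1r -w1 mulr_suml; apply: eq_bigr => v _.
by case: (eqVneq (w v) 0) => [->|/ga->] //; rewrite !mul0r.
Qed.

Lemma convex_ge (T : finType) (w g : T -> R) (a : R) : (forall v, 0 <= w v) -> \sum_v w v = 1 ->
  (forall v, w v != 0 -> a <= g v) -> a <= \sum_v w v * g v.
Proof.
move=> w0 w1 ga; rewrite -[a]mul1r -w1 mulr_suml; apply: ler_sum => v _.
by case: (eqVneq (w v) 0) => [->|/ga]; rewrite ?mul0r // => ?; apply: ler_wpM2l.
Qed.

Lemma pos0_bound u : (- wid <= pos0 u 0 0 <= wid) /\ (- wid <= pos0 u 0 1 <= wid).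
Proof.
have := wid_gt0 R; rewrite /pos0 !mk3E /sg /par => w0.
by case: (u.1); case: (odd _); split; lra.
Qed.

Lemma flat_coord (j : 'I_3) i o : flat (inr (i, o)) 0 j = \sum_k beta R o k * pos0 (tcorner (inl i) k) 0 j.
Proof. exact: sum_coord. Qed.

Lemma flat_bound v : (- wid <= flat v 0 0 <= wid) /\ (- wid <= flat v 0 1 <= wid).
Proof.
case: v => [u|[i o]]; first exact: pos0_bound.
rewrite !flat_coord; split; apply/andP; split.
- by apply: convex_ge => [k||k _]; rewrite ?sum_beta ?(ltW (beta_gt0 R o k)) //; case: (pos0_bound (tcorner (inl i) k)) => /andP[].
- by apply: convex_le => [k||k _]; rewrite ?sum_beta ?(ltW (beta_gt0 R o k)) //; case: (pos0_bound (tcorner (inl i) k)) => /andP[].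
- by apply: convex_ge => [k||k _]; rewrite ?sum_beta ?(ltW (beta_gt0 R o k)) //; case: (pos0_bound (tcorner (inl i) k)) => _ /andP[].
- by apply: convex_le => [k||k _]; rewrite ?sum_beta ?(ltW (beta_gt0 R o k)) //; case: (pos0_bound (tcorner (inl i) k)) => _ /andP[].
Qed.

Lemma sum_flat_bound (S : {set hv}) w : weights S w -> let p := \sum_v w v *: flat v in
  (- wid <= p 0 0 <= wid) /\ (- wid <= p 0 1 <= wid).
Proof.
case=> w0 _ w1 p; rewrite /p !sum_coord; split; apply/andP; split.
- by apply: convex_ge => // v _; case: (flat_bound v) => /andP[].
- by apply: convex_le => // v _; case: (flat_bound v) => /andP[].
- by apply: convex_ge => // v _; case: (flat_bound v) => _ /andP[].
- by apply: convex_le => // v _; case: (flat_bound v) => _ /andP[].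
Qed.

Lemma flat_glob i x : flat (glob tcorner i x) = \sum_k lbary R x k *: pos0 (tcorner (inl i) k).
Proof.
case: x => [l|o] //=; rewrite (bigD1 l) //= eqxx scale1r big1 ?addr0 // => k.
by rewrite eq_sym => /negbTE->; rewrite scale0r.
Qed.

Lemma dot3_sum (T : finType) (n : 'rV[R]_3) (w : T -> R) (p : T -> 'rV[R]_3) :
  dot3 n (\sum_v w v *: p v) = \sum_v w v * dot3 n (p v).
Proof.
rewrite /dot3 !sum_coord !mulr_sumr -!big_split /=; apply: eq_bigr => v _; ring.
Qed.

Lemma nrm_flat i x : dot3 (nrm i) (flat (glob tcorner i x)) = wid.
Proof.
rewrite flat_glob dot3_sum; apply: convex_eq; first exact: sum_lbary.
by move=> k _; apply: nrm_corner.
Qed.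

Lemma lht_ge0 x : 0 <= lht R x.
Proof.
have := h1_gt0 R; have := h2_gt R.
by case: x => [k|[k|]] /=; lra.
Qed.

(** The normal of a hat is parallel to a horizontal axis, and its base lies where that coordinate is
    [wid] or [- wid]. The hat adds an outward shift [H >= 0] in this coordinate alone, which
    clamping undoes. *)
Lemma proj_flat r w : weights (hface r) w -> proj (\sum_v w v *: pos v) = \sum_v w v *: flat v.
Proof.
move=> W; have [B0 B1] := sum_flat_bound W; case: (W) => w0 wr w1.
case: r W wr => [[i f]|c] W wr; last first.
  have -> : \sum_v w v *: pos v = \sum_v w v *: flat v.
    apply: eq_bigr => v _; case: v => [u|jo] //.
    by rewrite wr ?scale0r // inner_cap.
  by apply: row3P; rewrite /proj !mk3E ?clamp_id.
have wv v : w v != 0 -> exists x, v = glob tcorner i x.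
  move=> /eqP wv; case: (boolP (v \in hface (inl (i, f)))) => [/hatP[x _ ->]|/wr//].
  by exists x.
pose H := \sum_v w v * (if v is inr (_, o) then lht R (inr o) else 0).
have H0 : 0 <= H.
  by apply: sumr_ge0 => -[u|[j o]] _; rewrite ?mulr0 // mulr_ge0 // lht_ge0.
have -> : \sum_v w v *: pos v = \sum_v w v *: flat v + H *: nrm i.
  rewrite /H scaler_suml -big_split /=; apply: eq_bigr => v _.
  case: (eqVneq (w v) 0) => [->|/wv[x ->]]; first by rewrite !mul0r !scale0r addr0.
  by case: x => [k|o]; rewrite /= ?mulr0 ?scale0r ?addr0 // scalerDr scalerA.
have N : dot3 (nrm i) (\sum_v w v *: flat v) = wid.
  rewrite dot3_sum; apply: convex_eq => // v /wv[x ->]; exact: nrm_flat.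
move: B0 B1 N; set p := \sum_v w v *: flat v => /andP[B0 B0'] /andP[B1 B1'] N.
have w_gt0 := wid_gt0 R.
have addE j : (p + H *: nrm i) 0 j = p 0 j + H * nrm i 0 j by rewrite mxE [X in _ + X]mxE.
apply: row3P; rewrite /proj !mk3E addE; move: N; rewrite /dot3 /nrm !mk3E.
- case: i.1.1 i.1.2 => [] []; rewrite /sg /= => N; try (by rewrite clamp_id; [lra|apply/andP; split; lra]).
  + by rewrite clamp_gt; lra.
  + by rewrite clamp_lt; lra.
- case: i.1.1 i.1.2 => [] []; rewrite /sg /= => N; try (by rewrite clamp_id; [lra|apply/andP; split; lra]).
  + by rewrite clamp_gt; lra.
  + by rewrite clamp_lt; lra.
- by move=> _; rewrite mulr0 addr0.
Qed.
End TubeFlat.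

(** * Creases *)

Section Affine.
Variable R : realType.
Definition affine (g : 'rV[R]_3 -> R) :=
  exists a b c d, forall y, g y = a * y 0 0 + b * y 0 1 + c * y 0 2 + d.

Lemma affine_sum g (T : finType) (w : T -> R) (p : T -> 'rV[R]_3) : affine g -> \sum_v w v = 1 ->
  g (\sum_v w v *: p v) = \sum_v w v * g (p v).
Proof.
move=> [a [b [c [d H]]]] w1; rewrite H !sum_coord !mulr_sumr -[d in LHS]mul1r -w1 mulr_suml -!big_split /=.
by apply: eq_bigr => v _; rewrite H; ring.
Qed.

Lemma affine_comb g h (s t : R) : affine g -> affine h -> affine (fun y => s * g y + t * h y).
Proof.
move=> [a [b [c [d H]]]] [a' [b' [c' [d' H']]]].
exists (s * a + t * a'), (s * b + t * b'), (s * c + t * c'), (s * d + t * d') => y.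
by rewrite H H'; ring.
Qed.

(** The certificate for every crease: an affine function that vanishes on one face and not at the
    extra vertex of the other. *)
Lemma affine_hull_vanish g (V : finType) (p : V -> 'rV[R]_3) (f : {set V}) v : affine g ->
  (forall u, u \in f -> g (p u) = 0) -> g (p v) != 0 -> ~ aff_hull p f (p v).
Proof.
move=> ag gf gv [w [wf [w1 E]]]; move: gv; rewrite E (affine_sum _ ag w1) big1 ?eqxx // => u _.
by case: (boolP (u \in f)) => [/gf->|/wf->]; rewrite ?mulr0 ?mul0r.
Qed.
End Affine.

Section Noncoplanar.
Variables (R : realType) (K : nat).
Hypothesis K_even : ~~ odd K.
Hypothesis K_gt1 : (1 < K)%N.

Notation thats := (thats K).
Notation tcorner := (@tcorner K).
Notation tin := (@tin K).
Notation pos0 := (@pos0 R K).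
Notation nrm := (@nrm R K).
Notation wid := (wid R).
Notation rise := (rise R).
Notation sg := (sg R).
Notation par := (par R).
Notation pos := (@pos R K).
Notation h1 := (h1 R).
Notation h2 := (h2 R).

(* Height above the plane of the hat [i], and the barycentric coordinates in
   its base triangle, extended along the normal. *)
Definition fH (i : thats) (y : 'rV[R]_3) : R := dot3 (nrm i) y - wid.
Definition across (i : thats) (y : 'rV[R]_3) : R :=
  par i.2 * ((sg i.1.1 - sg i.1.2) / 2 * y 0 0 + (sg i.1.1 + sg i.1.2) / 2 * y 0 1) / wid.
Definition fE (i : thats) (k : tri) (y : 'rV[R]_3) : R :=
  let e := (1 + across i y) / 2 in let z := y 0 2 / rise - ((i.2 : nat)%:R + 1) in
  match k with t0 => (e - z) / 2 | t1 => 1 - e | t2 => (e + z) / 2 end.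

Lemma affine_fH i : affine (fH i).
Proof. by exists (nrm i 0 0), (nrm i 0 1), (nrm i 0 2), (- wid) => y; rewrite /fH /dot3. Qed.

Lemma affine_fE i k : affine (fE i k).
Proof.
have w0 : wid != 0 by rewrite gt_eqF ?wid_gt0.
case: k.
- exists (par i.2 * ((sg i.1.1 - sg i.1.2) / 2) / wid / 4), (par i.2 * ((sg i.1.1 + sg i.1.2) / 2) / wid / 4),
    (- 1 / rise / 2), (1 / 4 + ((i.2 : nat)%:R + 1) / 2) => y.
  by rewrite /fE /across /rise; field.
- exists (- par i.2 * ((sg i.1.1 - sg i.1.2) / 2) / wid / 2), (- par i.2 * ((sg i.1.1 + sg i.1.2) / 2) / wid / 2),
    0, (1 / 2) => y.
  by rewrite /fE /across /rise; field.
- exists (par i.2 * ((sg i.1.1 - sg i.1.2) / 2) / wid / 4), (par i.2 * ((sg i.1.1 + sg i.1.2) / 2) / wid / 4),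
    (1 / rise / 2), (1 / 4 - ((i.2 : nat)%:R + 1) / 2) => y.
  by rewrite /fE /across /rise; field.
Qed.

Lemma fH_pos0 i u : fH i (pos0 u) = wid * (ncoord R i.1.1 i.1.2 u - 1).
Proof. by rewrite /fH /dot3 /nrm /pos0 !mk3E /ncoord; field. Qed.

Lemma across_pos0 i u : across i (pos0 u) = par i.2 * xcoord R i.1.1 i.1.2 u.
Proof.
have w0 : wid != 0 by rewrite gt_eqF ?wid_gt0.
by rewrite /across /pos0 !mk3E /xcoord; field.
Qed.

Lemma fE_pos0 i k u : fE i k (pos0 u) =
  let e := (1 + par i.2 * xcoord R i.1.1 i.1.2 u) / 2 in let z := (lev u)%:R - ((i.2 : nat)%:R + 1) in
  match k with t0 => (e - z) / 2 | t1 => 1 - e | t2 => (e + z) / 2 end.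
Proof.
rewrite /fE across_pos0 /pos0 mk3E2 mulfK //; by rewrite gt_eqF // /rise; lra.
Qed.

Lemma fE_corner i k l : fE i k (pos0 (tcorner (inl i) l)) = (k == l)%:R.
Proof.
rewrite fE_pos0 /xcoord lev_corner // side_corner; case: i => [[s s'] j] /=.
rewrite natrD /side /par oddD.
by case: k l => [] []; case: s s' (odd j) => [] [] []; rewrite /sg /=; field.
Qed.

Lemma fH_corner i l : fH i (pos0 (tcorner (inl i) l)) = 0.
Proof. by rewrite /fH nrm_corner ?subrr. Qed.

Lemma fH_shift i y t n : fH i (y + t *: n) = fH i y + t * dot3 (nrm i) n.
Proof. by rewrite /fH /dot3 !mxE; ring. Qed.

Lemma fE_shift i k y t i' : fE i k (y + t *: nrm i') = fE i k y +
  t * (match k with t1 => -1 / 2 | _ => 1 / 4 end) * across i (nrm i').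
Proof.
have addE j : (y + t *: nrm i') 0 j = y 0 j + t * nrm i' 0 j by rewrite mxE [X in _ + X]mxE.
have w0 : wid != 0 by rewrite gt_eqF ?wid_gt0.
have n2 : nrm i' 0 2 = 0 by rewrite /nrm mk3E2.
have r0 : rise != 0 by rewrite gt_eqF // /rise; lra.
rewrite /fE /across !addE n2 mulr0 addr0.
by case: k; field; rewrite ?w0 ?r0.
Qed.

Lemma fE_sum i k (a : tri -> R) (p : tri -> 'rV[R]_3) : \sum_l a l = 1 ->
  fE i k (\sum_l a l *: p l) = \sum_l a l * fE i k (p l).
Proof. exact/affine_sum/affine_fE. Qed.

Lemma fH_sum i (a : tri -> R) (p : tri -> 'rV[R]_3) : \sum_l a l = 1 ->
  fH i (\sum_l a l *: p l) = \sum_l a l * fH i (p l).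
Proof. exact/affine_sum/affine_fH. Qed.

Lemma across_nrm i : across i (nrm i) = 0.
Proof. by rewrite /across /nrm !mk3E; case: i => [[[] []] j]; rewrite /sg /=; field; rewrite gt_eqF ?wid_gt0. Qed.

Lemma fE_glob i k x : fE i k (pos (glob tcorner i x)) = lbary R x k.
Proof.
rewrite pos_glob fE_shift across_nrm mulr0 addr0 fE_sum ?sum_lbary //.
rewrite (bigD1 k) //= fE_corner eqxx mulr1 big1 ?addr0 // => l lk.
by rewrite fE_corner eq_sym (negbTE lk) mulr0.
Qed.

Lemma fH_glob i x : fH i (pos (glob tcorner i x)) = lht R x.
Proof.
rewrite pos_glob fH_shift nrm_unit mulr1 fH_sum ?sum_lbary // big1 ?add0r // => l _.
by rewrite fH_corner mulr0.
Qed.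

(** Heights over the three base corners of the plane carrying the face [f]: the formulas behind
    [support], with the true heights [h1] and [h2] in place of 1 and 21/20. *)
Definition slope (f : lface) (k : tri) : R :=
  match f.1 with
  | Brim => if k == f.2 then 50 / 11 * h1 else 0
  | Skirt => if k == f.2 then 0 else 100 / 61 * h1
  | Spike => if k == f.2 then 3 * h2 - 2 * (100 / 17 * (117 / 100 * h2 - h1)) else 100 / 17 * (117 / 100 * h2 - h1)
  end.
Definition crease i f y := \sum_k slope f k * fE i k y - fH i y.

Lemma affine_crease i f : affine (crease i f).
Proof.
have [a [b [c [d H]]]] : affine (fun y => 1 * (slope f t0 * fE i t0 y + slope f t1 * fE i t1 y) + 1 * (slope f t2 * fE i t2 y + -1 * fH i y)).
  by apply: affine_comb; apply: affine_comb; rewrite ?affine_fE //; [exact: affine_fE|exact: affine_fE|exact: affine_fE|exact: affine_fH].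
by exists a, b, c, d => y; rewrite -H /crease big_tri; ring.
Qed.

(** Settles all creases between two faces of the same hat. *)
Lemma crease_glob i f x : if inc f x then crease i f (pos (glob tcorner i x)) = 0
  else crease i f (pos (glob tcorner i x)) != 0.
Proof.
rewrite /crease fH_glob big_tri !fE_glob.
have H0 := h1_gt0 R; have H1 := h1_lt R; have H2 := h2_gt R.
case: f x => [[] []] [[]|[[]|]]; rewrite /slope /lbary /beta /inc /lht /=;
  solve [by field | by apply/eqP => H; lra].
Qed.

(** The side opposite the middle corner [t1] is vertical and borders the adjacent strip at the same
    [j]. The other two sides lead up or down within the strip, or to a cap at its ends. *)
Lemma neighbor (s s' : bool) (j : 'I_K) k q : q != inl (s, s', j) ->
  tin q (tcorner (inl (s, s', j)) (nxt k)) -> tin q (tcorner (inl (s, s', j)) (nxt (nxt k))) ->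
  match k with
  | t0 => (exists2 j' : 'I_K, q = inl (s, s', j') & j' = j.+1 :> nat) \/
          q = inr (true, side s s' K) /\ j.+1 = K
  | t1 => q = inl (if odd j then (~~ s, s', j) else (s, ~~ s', j))
  | t2 => (exists2 j' : 'I_K, q = inl (s, s', j') & j = j'.+1 :> nat) \/
          q = inr (false, s') /\ j = 0 :> nat
  end.
Proof.
have jK := ltn_ord j; move=> ne.
have lv l : lev (tcorner (inl (s, s', j)) l) = (j + step l)%N by rewrite lev_corner.
case: q ne => [[[z z'] j']|[top b]] ne.
  have j'K := ltn_ord j'.
  rewrite /tin !lv !side_corner /= => /andP[h1 /eqP e1] /andP[h2 /eqP e2].
  have nj : j' = j :> nat -> (z, z') != (s, s').
    by move=> /ord_inj E; apply: contra ne => /eqP[-> ->]; rewrite E.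
  case: k h1 h2 e1 e2 => /= h1 h2 e1 e2.
  - left; exists j'; last first.
      case: (eqVneq (j' : nat) j) => [E|]; last by lia.
      by case/eqP: (nj E); move: e1 e2; rewrite /side addn1 addn2 /=; case: (odd j) => /= -> ->.
    by move: e1 e2; rewrite /side addn1 addn2 /=; case: (odd j) => /= -> ->.
  - have E : j' = j :> nat by lia.
    have := nj E; move: e1 e2; rewrite /side addn0 addn2 /= negbK (ord_inj E).
    case: (odd j) => -> _ H; congr (inl (_, _, _)); move: H.
      by case: (z) (s) => [] []; rewrite ?eqxx.
    by case: (z') (s') => [] []; rewrite ?eqxx.
  - left; exists j'; last first.
      case: (eqVneq (j' : nat) j) => [E|]; last by lia.
      by case/eqP: (nj E); move: e1 e2; rewrite /side addn0 addn1 /=; case: (odd j) => /= -> ->.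
    by move: e1 e2; rewrite /side addn0 addn1 /=; case: (odd j) => /= -> ->.
rewrite /tin; case: top {ne}; rewrite !lv !side_corner /=.
  case: k => /= h1 h2; try (exfalso; lia).
  right; have E : j.+1 = K by lia.
  split=> //; congr (inr (_, _)); move: h1; rewrite addn1 E eqxx (_ : K == K.+1 = false) /=; last by lia.
  by move/eqP.
case: k => /= h1 h2; try (exfalso; lia).
right; have E : j = 0%N :> nat by lia.
split=> //; congr (inr (_, _)); move: h2; rewrite E addn1 /= => /eqP.
by [].
Qed.

Lemma crease_brim i k y : crease i (Brim, k) y = 50 / 11 * h1 * fE i k y - fH i y.
Proof. by rewrite /crease big_tri /slope /=; case: k => /=; ring. Qed.

Lemma crease_brim_shift i k y t i' : crease i (Brim, k) (y + t *: nrm i') = crease i (Brim, k) y +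
  t * (50 / 11 * h1 * (match k with t1 => -1 / 2 | _ => 1 / 4 end) * across i (nrm i') - dot3 (nrm i) (nrm i')).
Proof. by rewrite !crease_brim fE_shift fH_shift; case: k; field. Qed.

Lemma crease_brim_corner i k l : k != l -> crease i (Brim, k) (pos0 (tcorner (inl i) l)) = 0.
Proof. by move=> kl; rewrite crease_brim fE_corner fH_corner (negbTE kl) mulr0 subr0. Qed.

(* Seen from the brim [k] of the hat [i], the inner vertex [k'] of a neighbouring
   hat [i'] is governed by the corner of [i'] off the common side. *)
Lemma crease_brim_inner i k i' k' : (forall l, l != k' -> crease i (Brim, k) (pos0 (tcorner (inl i') l)) = 0) ->
  crease i (Brim, k) (pos (glob tcorner i' (Inn k'))) =
  11 / 50 * crease i (Brim, k) (pos0 (tcorner (inl i') k')) +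
  h1 * (50 / 11 * h1 * (match k with t1 => -1 / 2 | _ => 1 / 4 end) * across i (nrm i') - dot3 (nrm i) (nrm i')).
Proof.
move=> H; rewrite pos_glob crease_brim_shift (affine_sum _ (affine_crease _ _)) ?sum_lbary //.
congr (_ + _); rewrite (bigD1 k') //= eqxx big1 ?addr0 // => l lk'.
by rewrite H ?mulr0.
Qed.
End Noncoplanar.

Section HatCreases.
Variables (R : realType) (K : nat).
Hypothesis K_even : ~~ odd K.
Hypothesis K_gt1 : (1 < K)%N.

Notation tvert := (tvert K).
Notation thats := (thats K).
Notation tcorner := (@tcorner K).
Notation tin := (@tin K).
Notation pos0 := (@pos0 R K).
Notation nrm := (@nrm R K).
Notation wid := (wid R).
Notation rise := (rise R).
Notation sg := (sg R).
Notation par := (par R).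
Notation pos := (@pos R K).
Notation hface := (hface tcorner).
Notation h1 := (h1 R).

Lemma brim_of_two i f (a b : tvert) : a != b -> inl a \in hface (inl (i, f)) -> inl b \in hface (inl (i, f)) ->
  exists2 k, f = (Brim, k) & forall l, l != k -> tcorner (inl i) l = a \/ tcorner (inl i) l = b.
Proof.
move=> ab /base_hat[k Ea fk] /base_hat[l Eb fl]; subst a b.
have kl : k != l by apply/negP => /eqP kl; case/eqP: ab; rewrite kl.
case: f fk fl => [[] m] /= fk fl.
- exists m => // n nm; have : (n == k) || (n == l) by move: fk fl kl nm; clear; case: k l m n => [] [] [] [].
  by case/orP=> /eqP->; [left|right].
- by case/eqP: kl; rewrite (eqP fk) (eqP fl).
- by move: fk.
Qed.

Definition fC (c : tcaps) (y : 'rV[R]_3) : R :=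
  if c.1 then y 0 2 / rise - K.+1%:R + sg c.2 * (y 0 0 + y 0 1) / (2 * wid)
  else y 0 2 / rise - sg c.2 * (y 0 0 - y 0 1) / (2 * wid).

Let w0 : wid != 0. Proof. by rewrite gt_eqF ?wid_gt0. Qed.
Let r0 : rise != 0. Proof. by rewrite gt_eqF // /rise; lra. Qed.

Lemma affine_fC c : affine (fC c).
Proof.
case: c => [[] b].
- exists (sg b / (2 * wid)), (sg b / (2 * wid)), (1 / rise), (- K.+1%:R) => y.
  by rewrite /fC /=; field; rewrite ?w0 ?r0.
- exists (- sg b / (2 * wid)), (sg b / (2 * wid)), (1 / rise), 0 => y.
  by rewrite /fC /=; field; rewrite ?w0 ?r0.
Qed.

Lemma fC_pos0 c u : fC c (pos0 u) = if c.1 then (lev u)%:R - K.+1%:R + sg c.2 * sg u.1 * ((1 + par (lev u)) / 2)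
  else (lev u)%:R - sg c.2 * sg u.1 * ((1 - par (lev u)) / 2).
Proof. by rewrite /fC /pos0 !mk3E; case: c.1; field; rewrite ?w0 ?r0. Qed.

Lemma fC_in c u : tin (inr c) u -> fC c (pos0 u) = 0.
Proof.
have ss t : sg t * sg t = 1 by rewrite -expr2 sg_sqr.
rewrite fC_pos0; case: c => [[] b]; rewrite /tin /=.
  case/orP=> [/eqP->|/andP[/eqP-> /eqP->]].
    by rewrite /par /= K_even; field.
  by rewrite ss /par (negbTE K_even) -natr1; field.
case/orP=> [/eqP->|/andP[/eqP-> /eqP->]].
  by rewrite /par /=; field.
by rewrite ss /par /=; field.
Qed.

Lemma fC_shift c y t i : fC c (y + t *: nrm i) = fC c y +
  t * (if c.1 then sg c.2 * sg i.1.1 else - sg c.2 * sg i.1.2) / (2 * wid).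
Proof.
have addE j : (y + t *: nrm i) 0 j = y 0 j + t * nrm i 0 j by rewrite mxE [X in _ + X]mxE.
rewrite /fC !addE /nrm !mk3E; case: c.1; field; rewrite ?w0 ?r0 //.
Qed.

Lemma h1_wid : 22 / 25 * wid < h1.
Proof.
rewrite -(@ltr_pXn2r _ 2) ?nnegrE ?(ltW (h1_gt0 R)) //; last by have := wid_gt0 R; lra.
by rewrite exprMn wid_sqr h1_sqr /h1_square; lra.
Qed.

Lemma crease_hat_hat i k i' k' : i != i' -> (forall l, l != k -> tin (inl i') (tcorner (inl i) l)) ->
  (forall l, l != k' -> exists2 m, m != k & tcorner (inl i') l = tcorner (inl i) m) ->
  crease i (Brim, k) (pos (glob tcorner i' (Inn k'))) != 0.
Proof.
move=> ii Hk Hk'; rewrite crease_brim_inner //; last first.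
  by move=> l /Hk'[m mk ->]; apply: crease_brim_corner; rewrite // eq_sym.
rewrite crease_brim.
have nk : nxt k != k by case: (k). have nnk : nxt (nxt k) != k by case: (k).
case: i ii Hk Hk' => [[s s'] j] ii Hk Hk'.
have ne : inl i' != inl (s, s', j) :> thats + tcaps by rewrite eq_sym (inj_eq inl_inj).
have NB := neighbor K_even K_gt1 ne (Hk _ nk) (Hk _ nnk).
have P := h1_gt0 R; have W0 := wid_gt0 R; have W2 := wid_sqr R.
have levs l : l != k' -> exists2 m, m != k & (i'.2 + step l = j + step m)%N.
  by move=> /Hk'[m mk /(congr1 (@lev K))]; rewrite !lev_corner // => E; exists m.
(* Along a strip the bases are coplanar and the two hats mirror each other, so the value is
   [- 2 * h1]. Across a vertical edge the base planes are perpendicular, and a flat crease would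
   require [25 * h1 = 11 * wid]. *)
have coplanar (c : R) : [/\ fE (s, s', j) k (pos0 (tcorner (inl i') k')) = -1,
    fH (s, s', j) (pos0 (tcorner (inl i') k')) = 0,
    across (s, s', j) (nrm i') = 0 & dot3 (nrm (s, s', j)) (nrm i') = 1] ->
    11 / 50 * (50 / 11 * h1 * fE (s, s', j) k (pos0 (tcorner (inl i') k')) - fH (s, s', j) (pos0 (tcorner (inl i') k'))) +
    h1 * (50 / 11 * h1 * c * across (s, s', j) (nrm i') - dot3 (nrm (s, s', j)) (nrm i')) != 0.
  by case=> -> -> -> ->; apply/eqP => H; lra.
have strip (j' : 'I_K) : across (s, s', j) (nrm (s, s', j')) = 0 /\ dot3 (nrm (s, s', j)) (nrm (s, s', j')) = 1.
  by rewrite /across /dot3 /nrm !mk3E; case: (s) (s') => [] []; rewrite /sg /=; split; field.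
have levR l n : (i'.2 + step l = j + n)%N -> (lev (tcorner (inl i') l))%:R = (j : nat)%:R + n%:R :> R /\
    odd (lev (tcorner (inl i') l)) = odd j (+) odd n.
  by move=> E; rewrite lev_corner // E natrD oddD.
case: k {ne nk nnk Hk Hk'} NB levs coplanar => NB levs coplanar.
- case: NB => [[j' [Ei] Ej]|[//]]; subst i'; apply: coplanar.
  have Ek : k' = t2.
    case: k' levs {levR} => // levs; exfalso.
      by have [[] // _] := levs t2 isT; rewrite /=; lia.
    by have [[] // _] := levs t2 isT; rewrite /=; lia.
  subst k'; have [|L O] := levR t2 3%N; first by rewrite /= Ej; lia.
  have [A D] := strip j'; split=> //.
    rewrite fE_pos0 /xcoord side_corner L -!lev_corner // /side /par O.
    by case: (odd j) (s) (s') => [] [] []; rewrite /sg /=; field.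
  rewrite fH_pos0 /ncoord side_corner -!lev_corner // /side /par O.
  by case: (odd j) (s) (s') => [] [] []; rewrite /sg /=; field.
- have {}NB : i' = if odd j then (~~ s, s', j) else (s, ~~ s', j) by case: NB.
  have Ek : k' = t1.
    case: k' levs {levR coplanar} => // levs; exfalso.
      have [[] // _] := levs t1 isT; rewrite NB; case: (odd j); rewrite /=; lia.
    have [[] // _] := levs t1 isT; rewrite NB; case: (odd j); rewrite /=; lia.
  subst k'; have [|L O] := levR t1 1%N; first by rewrite NB; case: (odd j).
  have -> : fE (s, s', j) t1 (pos0 (tcorner (inl i') t1)) = 0.
    rewrite fE_pos0 /xcoord side_corner -!lev_corner // /side /par O NB.
    by case: (odd j) (s) (s') => [] [] []; rewrite /sg /=; field.
  have -> : fH (s, s', j) (pos0 (tcorner (inl i') t1)) = - 2 * wid.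
    rewrite fH_pos0 /ncoord side_corner -!lev_corner // /side /par O NB.
    by case: (odd j) (s) (s') => [] [] []; rewrite /sg /=; field.
  have -> : across (s, s', j) (nrm i') = 1 / wid.
    rewrite /across /nrm !mk3E /par NB.
    by case: (odd j) (s) (s') => [] [] []; rewrite /sg /=; field.
  have -> : dot3 (nrm (s, s', j)) (nrm i') = 0.
    rewrite /dot3 /nrm !mk3E NB.
    by case: (odd j) (s) (s') => [] [] []; rewrite /sg /=; field.
  have E2 : 25 / 11 * h1 ^+ 2 != 11 / 25 * wid ^+ 2.
    by rewrite h1_sqr wid_sqr /h1_square; apply/eqP => H; lra.
  apply: contra E2 => /eqP H; apply/eqP.
  have : wid * (11 / 50 * (50 / 11 * h1 * 0 - - 2 * wid) + h1 * (50 / 11 * h1 * (-1 / 2) * (1 / wid) - 0)) =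
     11 / 25 * wid ^+ 2 - 25 / 11 * h1 ^+ 2 by field.
  by rewrite H mulr0; lra.
- case: NB => [[j' [Ei] Ej]|[//]]; subst i'; apply: coplanar.
  have Ek : k' = t0.
    case: k' levs {levR} => // levs; exfalso.
      by have [[] // _] := levs t0 isT; rewrite /=; lia.
    by have [[] // _] := levs t0 isT; rewrite /=; lia.
  subst k'; have Ej1 : (j : nat)%:R = (j' : nat)%:R + 1 :> R by rewrite Ej natr1.
  have L : (lev (tcorner (inl (s, s', j')) t0))%:R = (j' : nat)%:R :> R by rewrite lev_corner //= addn0.
  have O : odd (lev (tcorner (inl (s, s', j')) t0)) = ~~ odd j by rewrite lev_corner //= addn0 Ej /= negbK.
  have [A D] := strip j'; split=> //.
    rewrite fE_pos0 /xcoord side_corner L -!lev_corner // /side /par O Ej1.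
    by case: (odd j) (s) (s') => [] [] []; rewrite /sg /=; field.
  rewrite fH_pos0 /ncoord side_corner -!lev_corner // /side /par O.
  by case: (odd j) (s) (s') => [] [] []; rewrite /sg /=; field.
Qed.

End HatCreases.

Section CapCreases.
Variables (R : realType) (K : nat).
Hypothesis K_even : ~~ odd K.
Hypothesis K_gt1 : (1 < K)%N.

Notation tvert := (tvert K).
Notation thats := (thats K).
Notation tcorner := (@tcorner K).
Notation tin := (@tin K).
Notation pos0 := (@pos0 R K).
Notation wid := (wid R).
Notation sg := (sg R).
Notation par := (par R).
Notation pos := (@pos R K).
Notation hface := (hface tcorner).
Notation hfaces := (hfaces tcorner).
Notation h1 := (h1 R).

Notation fC := (@fC R K).
Let w0 : wid != 0. Proof. by rewrite gt_eqF ?wid_gt0. Qed.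

Lemma crease_hat_cap i k c u : (forall l, l != k -> tin (inr c) (tcorner (inl i) l)) -> tin (inr c) u ->
  (forall l, l != k -> u != tcorner (inl i) l) -> crease i (Brim, k) (pos0 u) != 0.
Proof.
case: i => [[s s'] j] Hk Hu Hne.
have nk : nxt k != k by case: (k). have nnk : nxt (nxt k) != k by case: (k).
have NB := neighbor K_even K_gt1 (isT : inr c != inl (s, s', j) :> thats + tcaps) (Hk _ nk) (Hk _ nnk).
have out l : l != k -> lev u = (j + step l)%N -> u.1 = ~~ side s s' (lev u).
  move=> lk E; have : u.1 != side s s' (lev u); last by case: (u.1) (side _ _ _) => [] [].
  by apply: contra (Hne l lk) => /eqP Eu; rewrite [u]at_levE Eu E.
have P := h1_wid R; have W0 := wid_gt0 R.
rewrite crease_brim fE_pos0 fH_pos0 /xcoord /ncoord.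
case: k {nk nnk Hk Hne} NB out => [[[j' //]|[[Ec] Ej]]|//|[[j' //]|[[Ec] Ej]]] out; subst c.
- have Er : K.+1%:R = (j : nat)%:R + 2 :> R by rewrite -[in LHS]Ej -addn2 natrD.
  have oj : odd j by have /= oK := congr1 odd Ej; move: K_even; rewrite -oK negbK.
  have L : lev u = K.+1.
    move: Hu; rewrite /tin => /orP[/eqP//|/andP[/eqP L /eqP S]].
    have := out t1 isT; rewrite addn1 Ej L S /side /par (negbTE K_even) => /(_ erefl).
    by case: (s).
  have := out t2 isT; rewrite addn2 Ej L /side /= K_even /par /= K_even oj Er => /(_ erefl) ->.
  have -> : (j : nat)%:R + 2 - ((j : nat)%:R + 1) = 1 :> R by ring.
  by apply/eqP; case: (s) (s') => [] []; rewrite /sg /= => H; lra.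
- have L : lev u = 0%N.
    move: Hu; rewrite /tin => /orP[/eqP//|/andP[/eqP L /eqP S]].
    have := out t1 isT; rewrite L Ej => /(_ erefl).
    by rewrite S /side /=; case: (s').
  have := out t0 isT; rewrite L Ej => /(_ erefl).
  rewrite /side /par /= => ->.
  by apply/eqP; case: (s) (s') => [] []; rewrite /sg /= => H; lra.
Qed.

Lemma crease_cap_hat i k c : (forall l, l != k -> tin (inr c) (tcorner (inl i) l)) ->
  fC c (pos (glob tcorner i (Inn k))) != 0.
Proof.
case: i => [[s s'] j] Hk.
have nk : nxt k != k by case: (k). have nnk : nxt (nxt k) != k by case: (k).
have NB := neighbor K_even K_gt1 (isT : inr c != inl (s, s', j) :> thats + tcaps) (Hk _ nk) (Hk _ nnk).
have P := h1_wid R; have W0 := wid_gt0 R; have P1 := h1_gt0 R.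
rewrite pos_glob fC_shift (affine_sum _ (affine_fC R K c)) ?sum_lbary // (bigD1 k) //=.
rewrite big1 ?addr0 => [|l lk]; last by rewrite fC_in ?mulr0 //; apply: Hk.
rewrite eqxx fC_pos0 -[at_level _ _ _]/(tcorner (inl (s, s', j)) k) lev_corner // side_corner.
(* The base corner off the cap lies two levels from its plane and enters with weight [11 / 50]; the
   lift along the normal contributes [h1 / (2 * wid)] with the opposite sign, so the two must
   differ. *)
have X : 0 < h1 / (2 * wid) - 22 / 50.
  by rewrite subr_gt0 ltr_pdivlMr; lra.
have E t : h1 * t / (2 * wid) = t * (h1 / (2 * wid)) by field.
move: X E; set x := h1 / (2 * wid) => X E; rewrite E.
case: k {nk nnk Hk} NB => [[[j' //]|[[Ec] Ej]]|//|[[j' //]|[[Ec] Ej]]]; subst c.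
- have Er : K.+1%:R = (j : nat)%:R + 2 :> R by rewrite -[in LHS]Ej -addn2 natrD.
  have oj : odd j by have /= oK := congr1 odd Ej; move: K_even; rewrite -oK negbK.
  rewrite /side /par (negbTE K_even) /= addn0 oj /= Er.
  by apply/eqP; case: (s) (s') => [] []; rewrite /sg /= => H; lra.
- rewrite /side /par /= Ej /=.
  by apply/eqP; case: (s) (s') => [] []; rewrite /sg /= => H; lra.
Qed.

Lemma crease_cap_cap c c' a u : tin (inr c) a -> tin (inr c') a -> tin (inr c') u -> ~~ tin (inr c) u ->
  fC c (pos0 u) != 0.
Proof.
rewrite fC_pos0; have K2 := K_gt1.
case: c c' => [[] b] [[] b']; rewrite /tin /=; try lia.
- move=> _ _; case: eqP => //= _ /andP[/eqP L /eqP B]; rewrite L eqxx /= B => bb.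
  rewrite /par (negbTE K_even) -natr1; apply/eqP.
  by case: b b' bb {B L} => [] [] // _; rewrite /sg => H; lra.
- move=> _ _; case: eqP => //= _ /andP[/eqP L /eqP B]; rewrite L eqxx /= B => bb.
  rewrite /par /=; apply/eqP.
  by case: b b' bb {B L} => [] [] // _; rewrite /sg => H; lra.
Qed.

(** The first face selects the affine function. If the faces do not belong to one hat, they share a
    base edge, so each of them is a brim or a cap. *)
Lemma noncoplanar f g : f \in hfaces -> g \in hfaces -> #|f :&: g| = 2 ->
  forall v, v \in g :\: f -> ~ aff_hull pos f (pos v).
Proof.
move=> /hfacesP[r ->] /hfacesP[r' ->] C2 v; rewrite inE => /andP[vf vg].
have [x [y [xy Exy]]] := cards2P _ (introT eqP C2).
have : x \in hface r :&: hface r' by rewrite Exy !inE eqxx.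
have : y \in hface r :&: hface r' by rewrite Exy !inE eqxx orbT.
rewrite !inE => /andP[yr yr'] /andP[xr xr'] {Exy C2}.
have tcap (a : tvert) c : (inl a \in hface (inr c)) = tin (inr c) a by rewrite in_cap tcset.
have cinj := @tcorner_inj K K_gt1.
case: r vf xr yr => [[i m]|c] vf xr yr.
  apply: (affine_hull_vanish (affine_crease R i m)).
    by move=> _ /hatP[t mt ->]; have := crease_glob R K_even K_gt1 i m t; rewrite mt.
  case: (boolP (v \in [set glob tcorner i t | t : lvert])) => [/imsetP[t _ Ev]|nv].
    by have := crease_glob R K_even K_gt1 i m t; rewrite Ev; rewrite Ev in_hat // in vf; rewrite (negbTE vf).
  have not_i h : r' != inl (i, h).
    by apply/eqP => E; case/negP: nv; move: vg; rewrite E => /hatP[t _ ->]; apply: imset_f.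
  have is_inl z : z \in hface (inl (i, m)) -> z \in hface r' -> exists a, z = inl a.
    case: z => [a|[j o]]; first by exists a.
    rewrite inner_hat => /andP[/eqP -> _]; case: (r') not_i => [[i' h]|c] not_i; last by rewrite inner_cap.
    by rewrite inner_hat => /andP[/eqP E _]; case/eqP: (not_i h); rewrite E.
  have [a Ea] := is_inl x xr xr'; have [b Eb] := is_inl y yr yr'; subst x y.
  have ab : a != b by apply: contra xy => /eqP->.
  have [k Em Hk] := brim_of_two ab xr yr; subst m.
  case: r' vg xr' yr' not_i {is_inl} => [[i' m']|c] vg xr' yr' not_i; last first.
    case: v vf vg nv => [u|jo]; last by rewrite inner_cap.
    rewrite !tcap in xr' yr' * => uf uc nv.
    apply: (@crease_hat_cap i k c u) => // [l /Hk[]->//|l lk].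
    by apply: contra nv => /eqP->; apply/imsetP; exists (Cor l).
  have ii : i != i' by apply/eqP => E; case/eqP: (not_i m'); rewrite E.
  have [k' Em' Hk'] := brim_of_two ab xr' yr'; subst m'.
  have [k1 Ek1 fk1] := base_hat xr; have [k2 Ek2 fk2] := base_hat yr.
  have [l1 El1 _] := base_hat xr'; have [l2 El2 _] := base_hat yr'.
  have tin' : tin (inl i') a /\ tin (inl i') b.
    by rewrite -!tcset //; split; apply/csetP; [exists l1|exists l2].
  case/hatP: vg vf => z kz Ev vf; subst v.
  have -> : z = Inn k'.
    case: z kz vf {nv} => [l|[l|]] kz vf //; last by move: kz; rewrite /inc /= => /eqP->.
    case/negP: vf; case: (Hk' l kz) => /= ->; [exact: xr|exact: yr].
  apply: crease_hat_hat => //.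
  - by move=> l /Hk[]->; case: tin'.
  - by move=> l /Hk'[]->; [exists k1|exists k2].
apply: (affine_hull_vanish (affine_fC R K c)).
  by move=> _ /imsetP[l _ ->]; rewrite fC_in // -tcap; apply: imset_f.
case: x xy xr xr' => [a|jo] xy xr xr'; last by rewrite inner_cap in xr.
case: y xy yr yr' => [b|jo] xy yr yr'; last by rewrite inner_cap in yr.
have ab : a != b by apply: contra xy => /eqP->.
rewrite !tcap in xr yr.
case: r' vg xr' yr' => [[i m]|c'] vg xr' yr'; last first.
  case: v vf vg => [u|jo]; last by rewrite !inner_cap.
  rewrite !tcap in xr' yr' * => uc uc'.
  exact: crease_cap_cap xr xr' uc' uc.
have [k Em Hk] := brim_of_two ab xr' yr'; subst m.
case/hatP: vg vf => z kz Ev vf; subst v.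
have -> : z = Inn k.
  case: z kz vf => [l|[l|]] kz vf //; last by move: kz; rewrite /inc /= => /eqP->.
  by case/negP: vf; case: (Hk l kz) => /= ->; rewrite tcap.
by apply: crease_cap_hat => l /Hk[]->.
Qed.
End CapCreases.

(** * Radial projection to the sphere *)

Section LocalCover.
Variable R : realType.

Definition face_weights (f : lface) (a : tri -> R) (x : lvert) : R :=
  if inc f x then
    let: (k, l, m) := (f.2, nxt f.2, nxt (nxt f.2)) in
    match f.1, x with
    | Brim, inl n => a n - 39 / 22 * a k
    | Brim, inr _ => 50 / 11 * a k
    | Skirt, inl _ => a k - 39 / 61 * (1 - a k)
    | Skirt, inr (Some n) => (39 / 100 * (1 - a k - a n) - 22 / 100 * a n) * 10000 / 1037
    | Spike, inr (Some n) => 100 / 17 * (a k - a n)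
    | _, _ => 1 - 100 / 17 * (3 * a k - 1)
    end
  else 0.

(** Let [a k] be the largest coordinate. Up to [39 / 100], its value at the two inner vertices of
    [Spike k], the point lies in that spike. Beyond, the lines from [Cor k] to these inner vertices,
    where the other two coordinates have ratio 22 to 39, separate [Skirt k] from the two brims. *)
Lemma local_cover (a : tri -> R) : (forall k, 0 <= a k) -> \sum_k a k = 1 ->
  exists f, exists w : lvert -> R, [/\ weights [set x | inc f x] w & forall k, a k = \sum_x w x * lbary R x k].
Proof.
move=> a0; rewrite big_tri => a1; have [[A0 A1] A2] := (a0 t0, a0 t1, a0 t2).
have [k kmax] : exists k, forall l, a l <= a k.
  have [H01|H01] := leP (a t0) (a t1); have [H12|H12] := leP (a t1) (a t2).
  - by exists t2 => -[]; lra.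
  - by exists t1 => -[]; lra.
  - have [H02|H02] := leP (a t0) (a t2); first by exists t2 => -[]; lra.
    by exists t0 => -[]; lra.
  - by exists t0 => -[]; lra.
have [[M0 M1] M2] := (kmax t0, kmax t1, kmax t2).
suff [f [H [H' H'']]] : exists f, (forall x, inc f x -> 0 <= face_weights f a x) /\
    \sum_x face_weights f a x = 1 /\ forall k, a k = \sum_x face_weights f a x * lbary R x k.
  exists f, (face_weights f a); split=> //; split=> [x|x|//]; last by rewrite inE /face_weights => /negbTE->.
  by case: (boolP (inc f x)) => [|/negbTE nf]; [exact: H|rewrite /face_weights nf].
have [kl|kl] := leP (a k) (39 / 100).
  exists (Spike, k); split; [|split].
  - by clear kmax; case: k M0 M1 M2 kl => M0 M1 M2 kl [[]|[[]|]] // _; rewrite /face_weights /=; lra.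
  - by clear - a1; rewrite big_lvert; case: k; rewrite /face_weights /=; lra.
  - by clear - a1; case: k; case; rewrite big_lvert /face_weights /lbary /beta /=; lra.
have [lm|lm] := leP (22 / 39 * a (nxt k)) (a (nxt (nxt k))); last first.
  exists (Brim, nxt (nxt k)); split; [|split].
  - by clear kmax; case: k M0 M1 M2 kl lm => M0 M1 M2 kl lm [[]|[[]|]] // _; rewrite /face_weights /= in lm *; lra.
  - by clear - a1; rewrite big_lvert; case: k; rewrite /face_weights /=; lra.
  - by clear - a1; case: k; case; rewrite big_lvert /face_weights /lbary /beta /=; lra.
have [ml|ml] := leP (22 / 39 * a (nxt (nxt k))) (a (nxt k)); last first.
  exists (Brim, nxt k); split; [|split].
  - by clear kmax; case: k M0 M1 M2 kl lm ml => M0 M1 M2 kl lm ml [[]|[[]|]] // _; rewrite /face_weights /= in lm ml *; lra.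
  - by clear - a1; rewrite big_lvert; case: k; rewrite /face_weights /=; lra.
  - by clear - a1; case: k; case; rewrite big_lvert /face_weights /lbary /beta /=; lra.
exists (Skirt, k); split; [|split].
- by clear kmax; case: k M0 M1 M2 kl lm ml => M0 M1 M2 kl lm ml [[]|[[]|]] // _; rewrite /face_weights /= in lm ml *; lra.
- by clear - a1; rewrite big_lvert; case: k; rewrite /face_weights /=; lra.
- by clear - a1; case: k; case; rewrite big_lvert /face_weights /lbary /beta /=; lra.
Qed.
End LocalCover.

Lemma push_weights (R : realType) (T V : finType) (h : T -> V) (S : {set T}) (w : T -> R) : weights S w ->
  exists2 u, weights (h @: S) u & forall p : V -> 'rV[R]_3, \sum_v u v *: p v = \sum_x w x *: p (h x).
Proof.
case=> w0 wS w1; exists (fun v => \sum_x w x * (h x == v)%:R).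
  split=> [v|v vS|]; first by apply: sumr_ge0 => x _; rewrite mulr_ge0 ?ler0n.
    apply: big1 => x _; case: (boolP (x \in S)) => [xS|/wS->]; last by rewrite mul0r.
    by case: eqP vS => [<-|_ _]; [rewrite imset_f|rewrite mulr0].
  rewrite exchange_big /= -[RHS]w1; apply: eq_bigr => x _.
  by rewrite (bigD1 (h x)) //= eqxx mulr1 big1 ?addr0 // => v; rewrite eq_sym => /negbTE->; rewrite mulr0.
move=> p; under eq_bigr do rewrite scaler_suml.
rewrite exchange_big /=; apply: eq_bigr => x _.
rewrite (bigD1 (h x)) //= eqxx mulr1 big1 ?addr0 // => v.
by rewrite eq_sym => /negbTE->; rewrite mulr0 scale0r.
Qed.

(** * The tube as a convex polytope *)

Section Support.
Variables (R : realType) (K : nat).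
Hypothesis K_even : ~~ odd K.
Hypothesis K_gt1 : (1 < K)%N.

Notation tvert := (tvert K).
Notation thats := (thats K).
Notation tcorner := (@tcorner K).
Notation pos0 := (@pos0 R K).
Notation wid := (wid R).
Notation rise := (rise R).
Notation sg := (sg R).
Notation par := (par R).
Notation flat := (flat tcorner pos0).
Notation hface := (hface tcorner).
Let hv := hvert tvert thats.

Let w0 : wid != 0. Proof. by rewrite gt_eqF ?wid_gt0. Qed.
Let r0 : rise != 0. Proof. by rewrite gt_eqF // /rise; lra. Qed.

Definition mid : R := K.+1%:R / 2.
Definition center : 'rV[R]_3 := mk3 0 0 (mid * rise).
Definition tsides := (bool * bool + bool * bool)%type.
Definition side_of (r : thats + tcaps) : tsides := match r with inl (s, s', _) => inl (s, s') | inr c => inr c end.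

(** Linear forms, one for each strip and each cap, normalised to 1 on that side as seen from
    [center]; their maximum is the gauge of the tube. *)
Definition supp (d : tsides) (y : 'rV[R]_3) : R :=
  match d with
  | inl (s, s') => (sg s + sg s') / 2 * (y 0 0 / wid) + (sg s - sg s') / 2 * (y 0 1 / wid)
  | inr (true, b) => (y 0 2 / rise + sg b / 2 * (y 0 0 / wid) + sg b / 2 * (y 0 1 / wid)) / mid
  | inr (false, b) => (- (y 0 2 / rise) + sg b / 2 * (y 0 0 / wid) - sg b / 2 * (y 0 1 / wid)) / mid
  end.

Lemma mid_gt0 : 0 < mid. Proof. by rewrite divr_gt0 ?ltr0n. Qed.
Let m0 : mid != 0. Proof. by rewrite gt_eqF ?mid_gt0. Qed.

Lemma suppZ d t y : supp d (t *: y) = t * supp d y.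
Proof. by case: d => [[s s']|[[] b]]; rewrite /supp !mxE; field; rewrite ?w0 ?r0 ?m0. Qed.

Lemma affine_supp d : affine (fun y => supp d (y - center)).
Proof.
case: d => [[s s']|[[] b]].
- exists ((sg s + sg s') / 2 / wid), ((sg s - sg s') / 2 / wid), 0, 0 => y.
  by rewrite /supp !mxE /=; field; rewrite ?w0 ?r0 ?m0.
- exists (sg b / 2 / wid / mid), (sg b / 2 / wid / mid), (1 / rise / mid), (- 1) => y.
  by rewrite /supp !mxE /=; field; rewrite ?w0 ?r0 ?m0.
- exists (sg b / 2 / wid / mid), (- sg b / 2 / wid / mid), (- 1 / rise / mid), 1 => y.
  by rewrite /supp !mxE /=; field; rewrite ?w0 ?r0 ?m0.
Qed.

Lemma supp_center_pos0 d u : supp d (pos0 u - center) =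
  match d with
  | inl (s, s') => ncoord R s s' u
  | inr (true, b) => ((lev u)%:R - mid + sg b * sg u.1 * ((1 + par (lev u)) / 2)) / mid
  | inr (false, b) => (mid - (lev u)%:R + sg b * sg u.1 * ((1 - par (lev u)) / 2)) / mid
  end.
Proof.
have E (y z : 'rV[R]_3) j : (y - z) 0 j = y 0 j - z 0 j by rewrite mxE [X in _ + X]mxE.
by case: d => [[s s']|[[] b]]; rewrite /supp !E /pos0 /center !mk3E /ncoord; field; rewrite ?w0 ?r0 ?m0.
Qed.

Lemma supp_pos0_le d u : supp d (pos0 u - center) <= 1.
Proof.
rewrite supp_center_pos0; have B := lev_bound u; have M := mid_gt0.
have top : (lev u)%:R + (if odd (lev u) then 0 else 1) <= K.+1%:R :> R.
  case: (boolP (odd (lev u))) => [_|o]; first by rewrite addr0 ler_nat.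
  have oK : lev u != K.+1 by apply: contra o => /eqP->; rewrite /= K_even.
  by rewrite natr1 ler_nat; lia.
have bot : (if odd (lev u) then 1 else 0) <= (lev u)%:R :> R.
  by case: (boolP (odd (lev u))) => [/odd_gt0 o|_]; rewrite ?ler1n ?ler0n.
case: d => [[s s']|[t b]].
- by rewrite /ncoord /par; case: (s) (s') (u.1) (odd _) => [] [] [] []; rewrite /sg; lra.
have Em : K.+1%:R = 2 * mid :> R by rewrite /mid; field.
rewrite Em in top; move: top bot; rewrite /par.
by case: t; rewrite ler_pdivrMr //; case: (odd (lev u)) (b) (u.1) => [] [] []; rewrite /sg => ? ?; lra.
Qed.

Lemma supp_corner r k : supp (side_of r) (pos0 (tcorner r k) - center) = 1.
Proof.
rewrite supp_center_pos0.
case: r => [[[s s'] j]|[t b]] /=.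
  rewrite /ncoord -[at_level _ _ _]/(tcorner (inl (s, s', j)) k) lev_corner // side_corner /= /side /par.
  by case: (odd _) (s) (s') => [] [] []; rewrite /sg; field.
have Em : K%:R = 2 * mid - 1 :> R by rewrite /mid -natr1; field.
have Em1 : K.+1%:R = 2 * mid :> R by rewrite /mid; field.
by case: t k => [] [] /=; rewrite lev_at //= /par ?(negbTE K_even) /= ?K_even ?Em1 ?Em; case: b; rewrite /sg /=; field; rewrite m0.
Qed.

Definition boundary (q : 'rV[R]_3) :=
  (forall d, supp d (q - center) <= 1) /\ exists d, supp d (q - center) = 1.

Lemma flat_supp_le d v : supp d (flat v - center) <= 1.
Proof.
case: v => [u|[i o]] /=; first exact: supp_pos0_le.
rewrite (affine_sum _ (affine_supp d)) ?sum_beta //; apply: convex_le.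
- by move=> k; apply/ltW/beta_gt0.
- exact: sum_beta.
- by move=> k _; apply: supp_pos0_le.
Qed.

Lemma boundary_flat r w : weights (hface r) w -> boundary (\sum_v w v *: flat v).
Proof.
case=> wp wr w1; split=> [d|].
  by rewrite (affine_sum _ (affine_supp d)) //; apply: convex_le => // v _; apply: flat_supp_le.
exists (side_of (match r with inl (i, _) => inl i | inr c => inr c end)).
rewrite (affine_sum _ (affine_supp _)) //; apply: convex_eq => // v.
case: (boolP (v \in hface r)) => [vr _|/wr->]; last by rewrite eqxx.
case: r vr {wr} => [[i f]|c]; last by case/imsetP => k _ ->; apply: supp_corner.
case/hatP=> x _ ->; rewrite flat_glob (affine_sum _ (affine_supp _)) ?sum_lbary //.
apply: convex_eq; first exact: sum_lbary.
by move=> k _; have := supp_corner (inl i) k; case: (i) => [[s s'] j].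
Qed.

Definition covered (q : 'rV[R]_3) := exists r, exists2 w, weights (hface r) w & q = \sum_v w v *: flat v.

Lemma cap_covered c (a : tri -> R) : (forall k, 0 <= a k) -> \sum_k a k = 1 ->
  covered (\sum_k a k *: pos0 (tcorner (inr c) k)).
Proof.
move=> a0 a1; have W : weights [set: tri] a by split=> // k; rewrite inE.
have [u U E] := push_weights (fun k => inl (tcorner (inr c) k) : hv) W.
exists (inr c), u; last by rewrite E.
suff -> : hface (inr c) = [set inl (tcorner (inr c) k) | k in [set: tri]] by [].
by apply/setP => v; apply/imsetP/imsetP => -[k _ ->]; exists k.
Qed.

Lemma hat_covered i (a : tri -> R) : (forall k, 0 <= a k) -> \sum_k a k = 1 ->
  covered (\sum_k a k *: pos0 (tcorner (inl i) k)).
Proof.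
move=> a0 a1; have [f [w [W aE]]] := local_cover a0 a1.
have [u U E] := push_weights (glob tcorner i) W.
exists (inl (i, f)), u.
  suff -> : hface (inl (i, f)) = [set glob tcorner i x | x in [set x | inc f x]] by [].
  by apply/setP => v; apply/imsetP/imsetP => -[k]; rewrite ?inE => kf ->; exists k; rewrite ?inE.
rewrite E; under [RHS]eq_bigr do rewrite flat_glob scaler_sumr.
rewrite exchange_big /=; apply: eq_bigr => k _; rewrite aE scaler_suml.
by apply: eq_bigr => x _; rewrite scalerA.
Qed.

Lemma supp_center d q : supp d (q - center) =
  let: (x, y, z) := (q 0 0 / wid, q 0 1 / wid, q 0 2 / rise) in
  match d with
  | inl (s, s') => (sg s + sg s') / 2 * x + (sg s - sg s') / 2 * y
  | inr (true, b) => (z - mid + sg b / 2 * x + sg b / 2 * y) / mid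
  | inr (false, b) => (mid - z + sg b / 2 * x - sg b / 2 * y) / mid
  end.
Proof.
have E (y z : 'rV[R]_3) j : (y - z) 0 j = y 0 j - z 0 j by rewrite mxE [X in _ + X]mxE.
by case: d => [[s s']|[[] b]]; rewrite /supp !E /center !mk3E; field; rewrite ?w0 ?r0 ?m0.
Qed.

(** At position [e] across the strip, triangle [j] covers the heights, counted in levels, within
    [en j] of [j + 1]. These intervals abut since [en j + en (j + 1) = 1]. *)
Lemma strip_level (e z : R) (n : nat) : let en j := if odd j then 1 - e else e in
  1 - e <= z <= n.+1%:R + en n -> exists2 j, (j <= n)%N & j.+1%:R - en j <= z <= j.+1%:R + en j.
Proof.
move=> en; elim: n => [|n IH] /andP[lo hi]; first by exists 0%N => //; rewrite /en /= lo.
have [H|H] := leP z (n.+1%:R + en n).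
  by have [|j jn B] := IH; [rewrite lo|exists j => //; rewrite (leq_trans jn)].
exists n.+1 => //; rewrite hi andbT -natr1.
by move: H; rewrite /en /=; case: (odd n) => /=; lra.
Qed.

Lemma boundary_covered q : boundary q -> covered q.
Proof.
move=> [le1 [d E]].
set x := q 0 0 / wid; set y := q 0 1 / wid; set z := q 0 2 / rise.
have Ex : q 0 0 = x * wid by rewrite divfK.
have Ey : q 0 1 = y * wid by rewrite divfK.
have Ez : q 0 2 = z * rise by rewrite divfK.
have M := mid_gt0.
have lat s s' : (sg s + sg s') / 2 * x + (sg s - sg s') / 2 * y <= 1.
  by have := le1 (inl (s, s')); rewrite supp_center.
have top b : z - mid + sg b / 2 * x + sg b / 2 * y <= mid.
  by have := le1 (inr (true, b)); rewrite supp_center /= ler_pdivrMr // mul1r.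
have bot b : mid - z + sg b / 2 * x - sg b / 2 * y <= mid.
  by have := le1 (inr (false, b)); rewrite supp_center /= ler_pdivrMr // mul1r.
have x1 : x <= 1 by have := lat true true; rewrite /sg; lra.
have x1' : - 1 <= x by have := lat false false; rewrite /sg; lra.
have y1 : y <= 1 by have := lat true false; rewrite /sg; lra.
have y1' : - 1 <= y by have := lat false true; rewrite /sg; lra.
move: E; rewrite supp_center -/x -/y -/z /=.
have Em : K%:R = 2 * mid - 1 :> R by rewrite /mid -natr1; field.
have Em1 : K.+1%:R = 2 * mid :> R by rewrite /mid; field.
case: d => [[s s']|[[] b]]; last first.
- move=> /(canRL (divfK m0)); rewrite mul1r => E.
  (* Only the corner [t0] of a bottom cap is off level 0, and it is at level 1, so its weight is the
     height [z]; the horizontal coordinates give the other two. *)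
  pose a k := match k with t0 => z | t1 => if b then (1 + y) / 2 else (1 + x) / 2 | t2 => if b then (1 - x) / 2 else (1 - y) / 2 end.
  have -> : q = \sum_k a k *: pos0 (tcorner (inr (false, b)) k).
    by apply: row3P; rewrite sum_coord big_tri /pos0 !mk3E /= ?lev_at //= ?Ex ?Ey ?Ez /par /=; case: b @a E => a; rewrite /a /sg => E; nra.
  apply: cap_covered => [k|]; last by rewrite big_tri /a; case: b E {a}; rewrite /sg; lra.
  rewrite /a; have H2 := bot (~~ b).
  by case: k; case: b E H2 {a}; rewrite /sg /=; lra.
- move=> /(canRL (divfK m0)); rewrite mul1r => E.
  pose a k := match k with t0 => 2 * mid - z | t1 => if b then (1 - y) / 2 else (1 + x) / 2 | t2 => if b then (1 - x) / 2 else (1 + y) / 2 end.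
  have E' : z = 2 * mid - sg b / 2 * x - sg b / 2 * y by lra.
  have -> : q = \sum_k a k *: pos0 (tcorner (inr (true, b)) k).
    apply: row3P; rewrite sum_coord big_tri /pos0 !mk3E /= ?lev_at //= ?Ex ?Ey ?Ez /par /= ?(negbTE K_even) ?K_even ?Em ?Em1 /a E';
      by case: (b); rewrite /sg /=; field.
  clear E'; apply: cap_covered => [k|]; last by rewrite big_tri /a; case: b E {a}; rewrite /sg; lra.
  rewrite /a; have H2 := top (~~ b).
  by case: k; case: b E H2 {a}; rewrite /sg /=; lra.
move=> E; pose e := (1 + ((sg s - sg s') / 2 * x + (sg s + sg s') / 2 * y)) / 2.
have [j jK B] : exists2 j, (j <= K.-1)%N & let en := if odd j then 1 - e else e in j.+1%:R - en <= z <= j.+1%:R + en.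
  apply: strip_level; have -> : odd K.-1 by case: (K) K_even K_gt1 => //= n; rewrite negbK.
  have H1 := top s; have H2 := bot s'; rewrite (ltn_predK K_gt1) Em.
  by rewrite /e; case: s s' E H1 H2 {e} => [] []; rewrite /sg; lra.
have jK1 : (j < K)%N by rewrite (leq_ltn_trans jK) // ltn_predL ltnW.
pose i : thats := (s, s', Ordinal jK1); pose en := if odd j then 1 - e else e; pose h := z - j.+1%:R.
(* The middle corner alone lies on the other vertical line, so the position across the strip gives
   its weight [1 - en]; the height above level [j + 1] is the difference of the two remaining
   weights. *)
pose a k := match k with t0 => (en - h) / 2 | t1 => 1 - en | t2 => (en + h) / 2 end.
have -> : q = \sum_k a k *: pos0 (tcorner (inl i) k).
  have Ew := congr1 ( *%R^~ wid) E.
  apply: row3P; rewrite sum_coord big_tri /pos0 !mk3E ?lev_corner // ?side_corner /i /= ?Ex ?Ey ?Ez /side /par ?addn0 ?addn1 ?addn2 /= ?negbK.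
  - by rewrite /a /en /e; case: (odd j) (s) (s') Ew => [] [] []; rewrite /sg /= => Ew; lra.
  - by rewrite /a /en /e; case: (odd j) (s) (s') Ew => [] [] []; rewrite /sg /= => Ew; lra.
  - by rewrite /a /h -!natr1; field.
apply: hat_covered => [k|]; last by rewrite big_tri /a; field.
have {}B : j.+1%:R - en <= z <= j.+1%:R + en := B; have ee : 0 <= en <= 1.
  by rewrite /en /e; case: (odd j) (s) (s') => [] [] []; rewrite /sg; lra.
by rewrite /a /h; clearbody en; case: k {a}; lra.
Qed.
End Support.

(** * Rays from the center of the tube *)

Section Rays.
Variables (R : realType) (K : nat).
Hypothesis K_even : ~~ odd K.
Hypothesis K_gt1 : (1 < K)%N.

Notation supp := (@supp R K).
Notation center := (center R K).
Notation boundary := (@boundary R K).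
Notation wid := (wid R).
Notation rise := (rise R).
Let w0 : wid != 0. Proof. by rewrite gt_eqF ?wid_gt0. Qed.
Let r0 : rise != 0. Proof. by rewrite gt_eqF // /rise; lra. Qed.

Lemma supp_gt0 v : v != 0 -> exists d, 0 < supp d v.
Proof.
move=> v0; set x := v 0 0 / wid; set y := v 0 1 / wid; set z := v 0 2 / rise.
have : [|| x != 0, y != 0 | z != 0].
  apply: contraTT v0; rewrite !negb_or !negbK => /and3P[/eqP x0 /eqP y0 /eqP z0].
  have E c : c != 0 -> forall t, t / c = 0 -> t = 0 :> R by move=> c0 t /(canRL (divfK c0)); rewrite mul0r.
  by apply/eqP/row3P; rewrite [RHS]mxE; [apply: (E _ w0)|apply: (E _ w0)|apply: (E _ r0)].
have M := @mid_gt0 R K.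
have [x0|x0|x0] := ltgtP x 0; [exists (inl (false, false))|exists (inl (true, true))|].
- by rewrite /supp -/x -/y /sg; lra.
- by rewrite /supp -/x -/y /sg; lra.
have [y0|y0|y0] := ltgtP y 0; [exists (inl (false, true))|exists (inl (true, false))|].
- by rewrite /supp -/x -/y /sg; lra.
- by rewrite /supp -/x -/y /sg; lra.
rewrite /=; have [z0|z0|//] := ltgtP z 0.
- by exists (inr (false, true)); rewrite /supp -/x -/y -/z divr_gt0 // x0 y0; lra.
- by exists (inr (true, true)); rewrite /supp -/x -/y -/z divr_gt0 // x0 y0; lra.
Qed.

(** The ray meets the boundary at the reciprocal of the gauge of [v]. *)
Lemma ray_hits v : v != 0 -> exists2 t, 0 < t & boundary (center + t *: v).
Proof.
move=> v0; have [d0 d0P] := supp_gt0 v0.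
case: (@Order.TotalTheory.arg_maxP _ _ _ (inl (true, true) : tsides) xpredT (supp^~ v) isT) => d _ dmax.
have P : 0 < supp d v by apply: lt_le_trans d0P (dmax d0 isT).
exists (supp d v)^-1; first by rewrite invr_gt0.
split=> [d'|]; last by exists d; rewrite addrC addKr suppZ mulVf // gt_eqF.
by rewrite addrC addKr suppZ mulrC ler_pdivrMr // mul1r; apply: dmax.
Qed.

Lemma ray_unique q q' t : 0 < t -> boundary q -> boundary q' -> q' - center = t *: (q - center) -> q' = q.
Proof.
move=> t0 [le1 [d Ed]] [le1' [d' Ed']] E.
have := le1' d; rewrite E suppZ Ed mulr1 => t1.
have := le1 d'; move: Ed'; rewrite E suppZ => Ed' L.
have {}t1 : t = 1.
  apply/eqP; rewrite eq_le t1 /= -Ed' -[leRHS]mulr1 ler_pM2l //.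
by apply: (addIr (- center)); rewrite E t1 scale1r.
Qed.

Lemma boundary_neq_center q : boundary q -> q - center != 0.
Proof.
move=> [_ [d Ed]]; apply/negP => /eqP E; move: Ed; rewrite E -(scale0r (0 : 'rV[R]_3)) suppZ mul0r => /eqP.
by rewrite eq_sym oner_eq0.
Qed.
End Rays.

Section Sphere.
Variables (R : realType) (K : nat).
Hypothesis K_even : ~~ odd K.
Hypothesis K_gt1 : (1 < K)%N.

Notation tcorner := (@tcorner K).
Notation wid := (wid R).
Notation pos := (@pos R K).
Notation proj := (@proj R).
Notation hface := (hface tcorner).
Notation hfaces := (hfaces tcorner).
Notation center := (@center R K).
Notation boundary := (@boundary R K).

Definition scale (v : 'rV[R]_3) : R := (Num.sqrt (d2 v 0))^-1.
Definition radial (p : 'rV[R]_3) : 'rV[R]_3 := scale (proj p - center) *: (proj p - center).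

Lemma d2_gt0 (v : 'rV[R]_3) : v != 0 -> 0 < d2 v 0.
Proof.
move=> v0; rewrite lt_neqAle d2_3E !mxE !subr0 eq_sym !addr_ge0 ?sqr_ge0 // andbT.
apply: contra v0; rewrite !paddr_eq0 ?addr_ge0 ?sqr_ge0 // !sqrf_eq0 => /andP[/andP[/eqP a /eqP b] /eqP c].
by apply/eqP/row3P; rewrite mxE.
Qed.

Lemma scale_gt0 v : v != 0 -> 0 < scale v.
Proof. by move=> v0; rewrite invr_gt0 sqrtr_gt0 d2_gt0. Qed.

Lemma d2Z t (v : 'rV[R]_3) : d2 (t *: v) 0 = t ^+ 2 * d2 v 0.
Proof. by rewrite !d2_3E !mxE; ring. Qed.

Lemma scale_unit v : v != 0 -> unit_sphere3 (scale v *: v).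
Proof.
move=> v0; rewrite /unit_sphere3 /= d2Z /scale exprVn sqr_sqrtr ?ltW ?d2_gt0 //.
by rewrite mulVf // gt_eqF ?d2_gt0.
Qed.

Lemma clamp_continuous : continuous (@clamp R).
Proof.
move=> x; apply: (@continuous_max _ _ (fun=> - wid) (fun x => Num.min wid x)); first exact: cst_continuous.
by apply: (@continuous_min _ _ (fun=> wid) id); [exact: cst_continuous|exact: cvg_id].
Qed.

Lemma proj_continuous : continuous proj.
Proof.
apply: continuous_row => i; rewrite /proj.
have C0 j : continuous (fun p : 'rV[R]_3 => clamp (p 0 j)).
  by move=> p; apply: (@continuous_comp _ _ _ (fun p : 'rV[R]_3 => p 0 j)); [exact: coord_continuous|exact: clamp_continuous].
have -> : (fun p : 'rV[R]_3 => mk3 (clamp (p 0 0)) (clamp (p 0 1)) (p 0 2) 0 i) =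
   (if i == 0 then fun p => clamp (p 0 0) else if i == 1 then fun p => clamp (p 0 1) else fun p => p 0 2).
  by apply/funext => p; rewrite mxE; case: ifP => // _; case: ifP.
by case: ifP => // _; case: ifP => // _; exact: coord_continuous.
Qed.

Lemma d2_continuous : continuous (fun v : 'rV[R]_3 => d2 v 0).
Proof.
apply: continuous_sum => i v.
have -> : (fun v : 'rV[R]_3 => (v 0 i - (0 : 'rV[R]_3) 0 i) ^+ 2) = (fun v => v 0 i * v 0 i).
  by apply/funext => u; rewrite mxE subr0 expr2.
by apply: continuousM; exact: coord_continuous.
Qed.

Lemma radial_continuous p : proj p - center != 0 -> {for p, continuous radial}.
Proof.
move=> ne; have cv : continuous (fun p => proj p - center).
  move=> x; apply: (@continuousB _ _ _ proj (fun=> center)); first exact: proj_continuous.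
  exact: cst_continuous.
apply: continuousZ; last exact: cv.
apply: (@continuousV _ _ (fun p => Num.sqrt (d2 (proj p - center) 0))).
  by rewrite gt_eqF // sqrtr_gt0 d2_gt0.
apply: (@continuous_comp _ _ _ (fun p => d2 (proj p - center) 0)); last exact: sqrt_continuous.
by apply: (@continuous_comp _ _ _ (fun p => proj p - center) (fun v => d2 v 0)); [exact: cv|exact: d2_continuous].
Qed.

Lemma surfaceP p : surface pos hfaces p <-> exists r, exists2 w, weights (hface r) w & p = \sum_v w v *: pos v.
Proof.
split=> [[f /hfacesP[r ->]]|[r [w W ->]]].
  by move=> [w [w0 [wr [w1 ->]]]]; exists r, w.
by exists (hface r); [apply/hfacesP; exists r|case: W => w0 wr w1; exists w].
Qed.

Lemma surface_boundary p : surface pos hfaces p -> boundary (proj p).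
Proof.
by move=> /surfaceP[r [w W ->]]; rewrite (proj_flat K_even K_gt1 W); apply: boundary_flat W.
Qed.

Lemma surface_sphere : homeomorphic (surface pos hfaces) (@unit_sphere3 R).
Proof.
have ne p : surface pos hfaces p -> proj p - center != 0.
  by move=> /surface_boundary/boundary_neq_center.
apply: (@compact_homeomorphic _ _ (0 : 'rV[R]_3) _ _ radial); first exact: norm_hausdorff.
- exact: surface_compact.
- by apply: continuous_in_subspaceT => p; rewrite in_setE => /ne/radial_continuous.
- move=> p q Sp Sq E.
  have Epq : proj p = proj q.
    apply: (ray_unique (K := K) (t := (scale (proj p - center))^-1 * scale (proj q - center))).
    + apply: mulr_gt0; first (rewrite invr_gt0; exact: (@scale_gt0 (proj p - center) (ne _ Sp))).
      exact: (@scale_gt0 (proj q - center) (ne _ Sq)).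
    + exact: surface_boundary.
    + exact: surface_boundary.
    + by rewrite -scalerA -[_ *: (proj q - _)]/(radial q) -E scalerA mulVf ?scale1r // gt_eqF //; apply/scale_gt0/ne.
  move: Sp Sq Epq => /surfaceP[r [w W ->]] /surfaceP[r' [w' W' ->]].
  rewrite (proj_flat K_even K_gt1 W) (proj_flat K_even K_gt1 W') => Ew.
  apply: eq_bigr => v _; congr (_ *: _).
  apply: (flat_unique (tcorner_inj K_gt1) (@coarse_unique R K K_even K_gt1) (tcset_inj K_gt1) W W' Ew).
- by move=> p /ne; apply: scale_unit.
- move=> y Sy; have y0 : y != 0.
    by apply/eqP => E; move: Sy; rewrite E /unit_sphere3 /= d2_3E !subrr expr0n /= !addr0 => /eqP; rewrite eq_sym oner_eq0.
  (* Surjectivity: the ray through [y] hits the tube in some flattened face, and the same weights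
     applied to [pos] give a point of the surface above it. *)
  have [t t0 /(boundary_covered K_even K_gt1)[r [w W E]]] := ray_hits K y0.
  exists (\sum_v w v *: pos v); first by apply/surfaceP; exists r, w.
  rewrite /radial (proj_flat K_even K_gt1 W) -E addrC addKr scalerA.
  rewrite /scale d2Z Sy mulr1 sqrtr_sqr ger0_norm ?ltW // mulVf ?scale1r // gt_eqF //.
Qed.
End Sphere.

Theorem theorem3 (R : realType) (N : nat) : (0 < N)%N ->
  exists (V : finType) (pos : V -> 'rV[R]_3) (F : {set {set V}}),
    topologically_convex pos F /\
    (forall f, f \in F -> acute_isosceles pos f) /\
    (forall cut : {set {set V}}, valid_unfolding pos F cut ->
       (N <= #|pieces F cut|)%N).
Proof.
(* An even [K] puts the two end levels on different diagonals, as the formulas for the caps assume;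
   the count yields [2 * K - 2 = 4 * N + 2] pieces. *)
move=> N0; pose K := (2 * N).+2.
have K_even : ~~ odd K by rewrite /= oddM.
have K_gt1 : (1 < K)%N by [].
have cinj := tcorner_inj K_gt1; have csinj := tcset_inj K_gt1; have two := ttwo K_gt1.
have uniq := @coarse_unique R K K_even K_gt1.
have kinj := cap_inj csinj.
exists (hvert (tvert K) (thats K)), (@pos R K), (hfaces (@tcorner K)); split; [split; [|split]|split].
- apply: (hatted_polyhedron cinj csinj uniq two (tcover K_gt1) (@proj_flat R K K_even K_gt1)).
  + exact: hat_dist.
  + exact: cap_acute.
  + exact: noncoplanar.
- exact: surface_sphere.
- exact: (three_connected_hats cinj (card_tvert K_gt1) (tconnected K_gt1)).
- by apply: hfaces_acute => //; [exact: hat_dist|exact: cap_acute].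
move=> cut valid.
have b2 e : e \in base_edges (@tcorner K) -> (#|[set f in hfaces (@tcorner K) | e \subset f]| <= 2)%N.
  by rewrite inE => /andP[/(edges_two cinj kinj two)->].
have H1 := card_pieces_hats cinj kinj (@hat_dist R K K_even K_gt1) valid b2.
have H2 := card_base_edges cinj kinj two.
have cI : #|{: thats K}| = (4 * K)%N by rewrite !card_prod !card_bool card_ord.
have cC : #|{: tcaps}| = 4%N by rewrite card_prod !card_bool.
by move: H1 H2; rewrite cI cC; move: #|pieces _ _| #|base_edges _| => p b; rewrite /K; lia.
Qed.
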